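(* Let $(\mathcal A,\varphi)$ be a von Neumann algebra with a faithful normal tracial state, and let $x,y\in\mathcal A$. The following statements are equivalent. (1) The pair $(L(x),R(y))$ is $R$-diagonal in $(B(L^2(\mathcal A,\varphi)),\varphi)$. (2) $\varphi(p_{i_1,i_2}\,p_{i_2,i_3}\cdots p_{i_{n-1},i_n})=0$ for all $n\ge2$, all $i_1,\dots,i_n\in\{1,2\}$ and all $p_{i_k,i_{k+1}}\in P_{i_k,i_{k+1}}(x,y)$, $k=1,\dots,n-1$, such that either (a) there is $0\le m\le n-1$ such that $p_{i_1,i_2},\dots,p_{i_m,i_{m+1}}$ only contain factors from $\{x,x^*\}$ and $p_{i_{m+1},i_{m+2}},\dots,p_{i_{n-1},i_n}$ only contain factors from $\{y,y^*\}$; or (b) there is $1\le m\le n-1$ such that $p_{i_1,i_2},\dots,p_{i_{m-1},i_m}$ only contain factors from $\{x,x^*\}$, $p_{i_m,i_{m+1}}$ contains factors both from $\{x,x^*\}$ and from $\{y,y^*\}$, and $p_{i_{m+1},i_{m+2}},\dots,p_{i_{n-1},i_n}$ only contain factors from $\{y,y^*\}$. (3) If $u$ is a Haar unitary such that $u$ and $\{x,y\}$ are $*$-free in $\mathcal A$, then $(L(x),R(y))$ and $(L(ux),R(uy))$ have the same $*$-distribution. (4) If $u$ is a unitary in $\mathcal A$ such that $u$ and $\{x,y\}$ are $*$-free in $\mathcal A$, then $(L(x),R(y))$ and $(L(ux),R(uy))$ have the same $*$-distribution.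
   Context: For a von Neumann algebra $\mathcal A$ with faithful normal tracial state $\varphi$, $L:\mathcal A\to B(L^2(\mathcal A,\varphi))$ and $R:\mathcal A^{op}\to B(L^2(\mathcal A,\varphi))$ are the left and right multiplication representations, $L(a)b=ab$, $R(a)b=ba$ for $b\in\mathcal A\subset L^2(\mathcal A,\varphi)$. On $B(L^2(\mathcal A,\varphi))$ one uses the state $\varphi(T)=\langle Te,e\rangle$, where $e$ is the unit of $\mathcal A$ viewed as a vector. A Haar unitary is a unitary $u$ with $\varphi(u^n)=0$ for all $n\in\mathbb Z\setminus\{0\}$. Two pairs have the same $*$-distribution if all corresponding words in the entries and their adjoints have the same expectation. The sets $P_{i,j}(x,y)$: consider alternating words $z=x^{\omega(1)}\cdots x^{\omega(k_1)}y^{\omega(k_1+1)}\cdots y^{\omega(k_1+k_2)}$ with $k_1,k_2\ge0$, $\omega:\{1,\dots,k_1+k_2\}\to\{1,*\}$, $\omega(i)\ne\omega(i+1)$ for all $i$. Then $P_{1,1}(x,y)$ = the set of such words $z$ with $k_1+k_2$ odd and $\omega(1)=*$; $P_{2,2}(x,y)$ = the set of such words $z$ with $k_1+k_2$ odd and $\omega(1)=1$; $P_{1,2}(x,y)$ = the set of $z-\varphi(z)$ with $z$ such a word, $k_1+k_2\ge2$ even and $\omega(1)=*$; $P_{2,1}(x,y)$ = the set of $z-\varphi(z)$ with $z$ such a word, $k_1+k_2\ge2$ even and $\omega(1)=1$. An element of $P_{i,j}(x,y)$ (with its given presentation) only contains factors from $\{x,x^*\}$ if $k_2=0$, only contains factors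 from $\{y,y^*\}$ if $k_1=0$, and contains both kinds if $k_1,k_2\ge1$. For $\chi:\{1,\dots,n\}\to\{l,r\}$, the permutation $s_\chi$ is defined by $\chi^{-1}(\{l\})=\{s_\chi(1)<\cdots<s_\chi(k)\}$ and $\chi^{-1}(\{r\})=\{s_\chi(k+1)>\cdots>s_\chi(n)\}$. The set of bi-non-crossing partitions is $BNC(\chi)=\{s_\chi\cdot\pi:\pi\in NC(n)\}$ ($NC(n)$ the non-crossing partitions of $\{1,\dots,n\}$, $s_\chi$ applied to the blocks of $\pi$). The bi-free cumulants $\kappa_\chi$ are the multilinear functionals determined recursively by $\varphi(a_1\cdots a_n)=\sum_{\pi\in BNC(\chi)}\prod_{V\in\pi}\kappa_{\chi|_V}((a_1,\dots,a_n)|_V)$, where for $V=\{i_1<\dots<i_m\}$, $(a_1,\dots,a_n)|_V=(a_{i_1},\dots,a_{i_m})$ and $\chi|_V$ is relabelled order-preservingly to $\{1,\dots,m\}$. A pair $(X,Y)$ in a $*$-probability space is $R$-diagonal if, for all $\chi:\{1,\dots,m\}\to\{l,r\}$ and all $z_1,\dots,z_m$ with $z_i\in\{X,X^*\}$ when $\chi(i)=l$ and $z_i\in\{Y,Y^*\}$ when $\chi(i)=r$, one has $\kappa_\chi(z_1,\dots,z_m)=0$ unless $m=2n$ is even and $(z_{s_\chi(1)},\dots,z_{s_\chi(2n)})=(X^{\omega(1)},\dots,X^{\omega(k)},Y^{\omega(k+1)},\dots,Y^{\omega(2n)})$ for some $0\le k\le2n$ and some alternating $\omega:\{1,\dots,2n\}\to\{1,*\}$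 ($\omega(i)\neq\omega(i+1)$ for all $i$).
   Formalization: In (3) and (4), u ranges over unitaries in all trace-preserving enlargements of A (not only in A itself), since A = C, x = y = 1 contains no Haar unitary, so that (3) read literally holds vacuously while (1) fails. *)

(* Defs.v *)
From HB Require Import structures.
From mathcomp Require Import all_boot all_order all_algebra.
From mathcomp Require Import boolp.

Set Implicit Arguments.
Unset Strict Implicit.
Unset Printing Implicit Defensive.

Import Order.TTheory GRing.Theory Num.Theory.

Local Open Scope ring_scope.

(* Unital *-algebras over the complex field. *)

HB.mixin Record hasStar (C : numClosedFieldType) A of GRing.Algebra C A := {
  star : A -> A;
  starK : involutive star;
  starD : {morph star : a b / a + b};
  starZ : forall (c : C) a, star (c *: a) = c^* *: star a;
  starM : forall a b, star (a * b) = star b * star a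
}.

#[short(type="starAlgType")]
HB.structure Definition StarAlgebra (C : numClosedFieldType) :=
  {A of hasStar C A & GRing.Algebra C A}.

(* Exponents in {1, *} are booleans, true standing for *. *)

Definition expo (C : numClosedFieldType) (A : starAlgType C) (a : A) (e : bool) :=
  if e then star a else a.

Definition alternating (w : seq bool) := sorted (fun e e' => e != e') w.

Inductive side := left_side | right_side.

Definition is_left (s : side) : bool :=
  if s is left_side then true else false.

Definition pair_letter (C : numClosedFieldType) (A : starAlgType C) (X Y : A)
    (c : side * bool) : A :=
  expo (if is_left c.1 then X else Y) c.2.

Definition same_star_distribution (C : numClosedFieldType)
    (A B : starAlgType C) (phi : A -> C) (psi : B -> C)
    (X Y : A) (X' Y' : B) :=
  forall w : seq (side * bool),
    phi (\prod_(c <- w) pair_letter X Y c) =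
    psi (\prod_(c <- w) pair_letter X' Y' c).

(* Bi-non-crossing partitions and bi-free cumulants. *)

Definition s_chi n (chi : 'I_n -> side) (k : 'I_n) : 'I_n :=
  nth k ([seq i <- enum 'I_n | is_left (chi i)] ++
         rev [seq i <- enum 'I_n | ~~ is_left (chi i)]) k.

Definition noncrossing n (pi : {set {set 'I_n}}) : bool :=
  partition pi [set: 'I_n] &&
  [forall V in pi, forall W in pi, (V != W) ==>
     ~~ [exists a in V, exists b in W, exists c in V, exists d in W,
           (a < b)%N && (b < c)%N && (c < d)%N]].

Definition relabel n (s : 'I_n -> 'I_n) (pi : {set {set 'I_n}}) :=
  [set s @: (V : {set 'I_n}) | V in pi].

Definition BNC n (chi : 'I_n -> side) : {set {set {set 'I_n}}} :=
  [set relabel (s_chi chi) pi | pi in [pred pi | noncrossing pi]].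

(* The moment-cumulant formula solved for the one-block partition. For a block
   V, enum_val : 'I_#|V| -> 'I_n is the increasing enumeration of V. The first
   argument bounds the depth of the recursion; n suffices. *)
Fixpoint cumulant_rec (C : numClosedFieldType) (A : starAlgType C)
    (phi : A -> C) (depth : nat) n (chi : 'I_n -> side) (a : 'I_n -> A) : C :=
  if depth is depth'.+1 then
    phi (\prod_(i < n) a i) -
    \sum_(pi in BNC chi | pi != [set [set: 'I_n]])
      \prod_(V in pi)
        cumulant_rec phi depth' (fun i : 'I_#|V| => chi (enum_val i))
                                (fun i : 'I_#|V| => a (enum_val i))
  else 0.

Definition cumulant (C : numClosedFieldType) (A : starAlgType C)
    (phi : A -> C) n (chi : 'I_n -> side) (a : 'I_n -> A) : C :=
  cumulant_rec phi n chi a.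

Lemma s_chi_inj n (chi : 'I_n -> side) : injective (s_chi chi).
Proof.
set l := [seq i <- enum 'I_n | is_left (chi i)] ++
         rev [seq i <- enum 'I_n | ~~ is_left (chi i)].
have lP : perm_eq l (enum 'I_n).
  apply: perm_trans (permEl (perm_filterC (fun i => is_left (chi i)) _)).
  by rewrite perm_cat2l perm_rev.
have sz : size l = n by rewrite (perm_size lP) size_enum_ord.
have ul : uniq l by rewrite (perm_uniq lP) enum_uniq.
move=> j k; rewrite /s_chi -/l (set_nth_default k) ?sz ?ltn_ord // => /eqP.
by rewrite nth_uniq ?sz ?ltn_ord // => /eqP/val_inj.
Qed.

Lemma BNC_partition n (chi : 'I_n -> side) (pi : {set {set 'I_n}}) :
  pi \in BNC chi -> partition pi [set: 'I_n].
Proof.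
case/imsetP => rho /[!inE] /andP[rhoP _] ->.
have sI := @s_chi_inj n chi.
have sT : s_chi chi @: [set: 'I_n] = [set: 'I_n].
  by apply/eqP; rewrite eqEcard subsetT card_imset //=.
by rewrite -[X in partition _ X]sT imset_partition.
Qed.

Section MomentCumulant.
Variables (C : numClosedFieldType) (A : starAlgType C) (phi : A -> C).

Lemma partition_block_card n (pi : {set {set 'I_n}}) (V : {set 'I_n}) :
  partition pi [set: 'I_n] -> pi != [set [set: 'I_n]] -> V \in pi ->
  (#|V| < n)%N.
Proof.
case/and3P=> /eqP cov triv p0 piT Vpi; rewrite -[X in (_ < X)%N]card_ord.
rewrite ltn_neqAle max_card andbT; apply: contra piT => /eqP cV.
have VT : V = [set: 'I_n].
  by apply/eqP; rewrite eqEcard subsetT cardsT cV leqnn.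
subst V; rewrite eqEsubset !sub1set Vpi andbT; apply/subsetP => W Wpi.
rewrite inE; apply/negPn/negP => WT.
have := trivIsetP triv _ _ Wpi Vpi WT.
rewrite -setI_eq0 setIT => /eqP W0.
by move: p0; rewrite -W0 Wpi.
Qed.

Lemma cumulant_recS d n (chi : 'I_n -> side) (a : 'I_n -> A) :
  cumulant_rec phi d.+1 chi a =
  phi (\prod_(i < n) a i) -
  \sum_(pi in BNC chi | pi != [set [set: 'I_n]]) \prod_(V in pi)
    cumulant_rec phi d (fun i : 'I_#|V| => chi (enum_val i))
                       (fun i : 'I_#|V| => a (enum_val i)).
Proof. by []. Qed.

Lemma cumulant_recE d n (chi : 'I_n -> side) (a : 'I_n -> A) :
  (n <= d)%N -> (0 < n)%N -> cumulant_rec phi d chi a = cumulant phi chi a.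
Proof.
elim/ltn_ind: n d chi a => n IH [|d] chi a; first by case: n {IH} chi a.
case: n IH chi a => // n IH chi a nd _.
rewrite /cumulant !cumulant_recS; congr (_ - _); apply: eq_bigr => pi /andP[piB piT].
have piP := BNC_partition piB.
apply: eq_bigr => V Vpi; have cV := partition_block_card piP piT Vpi.
have V0 : (0 < #|V|)%N.
  rewrite card_gt0; case/and3P: piP => _ _; apply: contra => /eqP <- //.
rewrite !IH // -ltnS; exact: leq_trans cV nd.
Qed.

Lemma cumulant_cast m n (e : m = n) (f : 'I_m -> 'I_n) chi a :
  (forall i, f i = i :> nat) ->
  cumulant phi (fun i => chi (f i)) (fun i => a (f i)) =
  cumulant phi chi a.
Proof.
subst m => fE.
have E i : f i = i by apply/val_inj/fE.
have -> : (fun i => chi (f i)) = chi by apply/funext => i; rewrite E.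
by have -> : (fun i => a (f i)) = a by apply/funext => i; rewrite E.
Qed.

Lemma one_block_BNC n (chi : 'I_n -> side) :
  (0 < n)%N -> [set [set: 'I_n]] \in BNC chi.
Proof.
move=> n0; apply/imsetP; exists [set [set: 'I_n]].
  rewrite inE /noncrossing; apply/andP; split.
    apply/and3P; split; first by rewrite /cover big_set1.
      by apply/trivIsetP => V W; rewrite !inE => /eqP-> /eqP->; rewrite eqxx.
    by rewrite inE eq_sym -card_gt0 cardsT card_ord.
  apply/forall_inP => V; rewrite inE => /eqP->.
  by apply/forall_inP => W; rewrite inE => /eqP->; rewrite eqxx.
have sI := @s_chi_inj n chi.
rewrite /relabel imset_set1; congr [set _].
by apply/eqP; rewrite eq_sym eqEcard subsetT card_imset //=.
Qed.

Lemma moment_cumulant n (chi : 'I_n -> side) (a : 'I_n -> A) : (0 < n)%N ->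
  phi (\prod_(i < n) a i) =
  \sum_(pi in BNC chi) \prod_(V in pi)
    cumulant phi (fun i : 'I_#|V| => chi (enum_val i))
                 (fun i : 'I_#|V| => a (enum_val i)).
Proof.
move=> n0; rewrite (bigD1 [set [set: 'I_n]]) ?one_block_BNC //= big_set1.
rewrite (@cumulant_cast _ _ _ enum_val); first last.
- move=> i; have ilt : (i < n)%N by case: i => i /=; rewrite cardsT card_ord.
  rewrite {1}(enum_val_nth (Ordinal ilt)) (_ : enum _ = enum 'I_n).
    exact: nth_enum_ord.
  by rewrite enum_setT enumT.
- by rewrite cardsT card_ord.
case: n n0 chi a => // n _ chi a; rewrite {1}/cumulant cumulant_recS.
rewrite [X in _ - X + _](_ : _ =
  \sum_(pi in BNC chi | pi != [set [set: 'I_n.+1]]) \prod_(V in pi)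
    cumulant phi (fun i : 'I_#|V| => chi (enum_val i))
                 (fun i : 'I_#|V| => a (enum_val i))) ?subrK //.
apply: eq_bigr => pi /andP[piB piT]; have piP := BNC_partition piB.
apply: eq_bigr => V Vpi; have cV := partition_block_card piP piT Vpi.
rewrite cumulant_recE // card_gt0.
by case/and3P: piP => _ _; apply: contra => /eqP <-.
Qed.
End MomentCumulant.

(* The letters z_i are indexed by formal exponents eps i, so that the condition
   keeps its meaning when X or Y is self-adjoint. *)
Definition R_diagonal (C : numClosedFieldType) (A : starAlgType C)
    (phi : A -> C) (X Y : A) :=
  forall m (chi : 'I_m -> side) (eps : 'I_m -> bool),
    ~ (~~ odd m /\
       exists k (omega : m.-tuple bool), [/\ (k <= m)%N, alternating omega &
         forall j : 'I_m,
           (chi (s_chi chi j), eps (s_chi chi j)) =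
           (if (j < k)%N then left_side else right_side, tnth omega j)]) ->
    cumulant phi chi (fun i => pair_letter X Y (chi i, eps i)) = 0.

(* The sets P_{i,j}(x, y). A word x^{w(1)} .. x^{w(k1)} y^{w(k1+1)} .. y^{w(k1+k2)}
   is presented by its two lists of exponents, of lengths k1 and k2. *)

Definition presentation := (seq bool * seq bool)%type.

Definition in_P (i j : nat) (p : presentation) : bool :=
  let w := p.1 ++ p.2 in
  alternating w &&
  match i, j with
  | 1, 1 => odd (size w) && (ohead w == Some true)
  | 2, 2 => odd (size w) && (ohead w == Some false)
  | 1, 2 => [&& 2 <= size w, ~~ odd (size w) & ohead w == Some true]%N
  | 2, 1 => [&& 2 <= size w, ~~ odd (size w) & ohead w == Some false]%N
  | _, _ => false
  end.

Definition only_x (p : presentation) := p.2 = [::].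
Definition only_y (p : presentation) := p.1 = [::].
Definition both_xy (p : presentation) := p.1 <> [::] /\ p.2 <> [::].

Section PSets.
Variables (C : numClosedFieldType) (A : starAlgType C) (phi : A -> C) (x y : A).

Definition word_elt (p : presentation) : A :=
  (\prod_(e <- p.1) expo x e) * (\prod_(e <- p.2) expo y e).

Definition P_elt (i j : nat) (p : presentation) : A :=
  let z := word_elt p in if i == j then z else z - (phi z)%:A.

(* i 1, ..., i n are the indices and p k presents p_{i k, i (k+1)}. *)
Definition P_products_vanish :=
  forall (n : nat) (i : nat -> nat) (p : nat -> presentation),
    (2 <= n)%N ->
    (forall k, (1 <= k < n)%N -> in_P (i k) (i k.+1) (p k)) ->
    (exists2 m, (m <= n.-1)%N &
       (forall k, (1 <= k <= m)%N -> only_x (p k)) /\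
       (forall k, (m < k < n)%N -> only_y (p k)))
    \/
    (exists2 m, (1 <= m <= n.-1)%N &
       [/\ forall k, (1 <= k < m)%N -> only_x (p k),
           both_xy (p m) &
           forall k, (m < k < n)%N -> only_y (p k)]) ->
    phi (\prod_(1 <= k < n) P_elt (i k) (i k.+1) (p k)) = 0.

End PSets.

From mathcomp Require Import complex.
From mathcomp Require Import all_classical all_reals all_analysis.

Import numFieldNormedType.Exports.

Local Open Scope classical_set_scope.

(* Complex Hilbert spaces. The inner product is linear in its first argument.
   The zero space is excluded because B(0) is the zero ring, which is not an
   algType; an algebra carrying a state never acts on it. *)

Record hilbert (R : realType) := Hilbert {
  hilbert_sort :> completeNormedModType R[i];
  inner : {dot hilbert_sort for (@Num.conj R[i])};
  innerE : forall v : hilbert_sort, `|v| ^+ 2 = inner v v;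
  hilbert_neq0 : exists v : hilbert_sort, v != 0
}.

(* B(H): everywhere defined bounded linear operators, packaged with their
   adjoint, which exists and is unique by the Riesz representation theorem. *)

Definition bounded_op (R : realType) (H : hilbert R) (T : H -> H) :=
  exists M : R[i], forall v, `|T v| <= M * `|v|.

Record bop (R : realType) (H : hilbert R) := BOp {
  bop_fun :> H -> H;
  bop_adj : H -> H;
  bop_linear : linear bop_fun;
  bop_bounded : bounded_op bop_fun;
  bop_adj_linear : linear bop_adj;
  bop_adj_bounded : bounded_op bop_adj;
  bop_adjP : forall v w, inner H (bop_fun v) w = inner H v (bop_adj w)
}.

Section BopTheory.
Variables (R : realType) (H : hilbert R).
Implicit Types (S T : bop H).

HB.instance Definition _ := gen_eqMixin (bop H).
HB.instance Definition _ := gen_choiceMixin (bop H).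

Lemma innerC (v w : H) : inner H v w = (inner H w v)^*.
Proof. by rewrite hermC expr0 mul1r. Qed.

Lemma inner_inj (v w : H) : (forall u, inner H u v = inner H u w) -> v = w.
Proof.
move=> vw; apply/eqP; rewrite -subr_eq0 -(dnorm_eq0 (inner H)).
by rewrite linearBr /= vw subrr.
Qed.

Lemma bop_ext S T : (forall v, S v = T v) -> S = T.
Proof.
case: S T => [s s' sl sb sl' sb' sP] [t t' tl tb tl' tb' tP] /= st.
have {}st : s = t by apply/funext.
subst t; have st' : s' = t'.
  by apply/funext => w; apply: inner_inj => u; rewrite -sP tP.
subst t'; f_equal; exact: Prop_irrelevance.
Qed.

Lemma bopP T (c : R[i]) (v w : H) : T (c *: v + w) = c *: T v + T w.
Proof. exact: bop_linear. Qed.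

Lemma bopD T (v w : H) : T (v + w) = T v + T w.
Proof. by rewrite -[v]scale1r bopP !scale1r. Qed.

Lemma bop0 T : T 0 = 0.
Proof. by apply: (@addrI _ (T 0)); rewrite -bopD !addr0. Qed.

Lemma bopZ T c (v : H) : T (c *: v) = c *: T v.
Proof. by rewrite -[c *: v]addr0 bopP bop0 addr0. Qed.

Lemma bounded_opP (f : H -> H) :
  bounded_op f -> exists2 M, 0 <= M & forall v, `|f v| <= M * `|v|.
Proof.
move=> [M fM]; exists `|M| => // v.
rewrite -[X in X <= _]normr_id -[in leRHS](normr_id v) -normrM.
have M0 : 0 <= M * `|v| := le_trans (normr_ge0 _) (fM v).
by rewrite normr_id (ger0_norm M0).
Qed.

Lemma bounded_op_comp (f g : H -> H) :
  bounded_op f -> bounded_op g -> bounded_op (f \o g).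
Proof.
move=> /bounded_opP[M M0 fM] /bounded_opP[N N0 gN]; exists (M * N) => v /=.
by rewrite -mulrA (le_trans (fM _)) // ler_wpM2l.
Qed.

Lemma bounded_op_add (f g : H -> H) :
  bounded_op f -> bounded_op g -> bounded_op (f \+ g).
Proof.
move=> /bounded_opP[M M0 fM] /bounded_opP[N N0 gN]; exists (M + N) => v /=.
by rewrite mulrDl (le_trans (ler_normD _ _)) // lerD.
Qed.

Lemma bounded_op_scale (c : R[i]) (f : H -> H) :
  bounded_op f -> bounded_op (c \*: f).
Proof.
move=> /bounded_opP[M M0 fM]; exists (`|c| * M) => v /=.
by rewrite normrZ -mulrA ler_wpM2l.
Qed.

Lemma bounded_op_id : bounded_op (@id H).
Proof. by exists 1 => v; rewrite mul1r. Qed.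

Lemma bounded_op_0 : bounded_op (fun _ : H => 0).
Proof. by exists 0 => v; rewrite mul0r normr0. Qed.

Lemma linear_bop_add (f g : H -> H) : linear f -> linear g -> linear (f \+ g).
Proof. by move=> fl gl c v w; rewrite /= fl gl scalerDr addrACA. Qed.

Lemma linear_bop_scale (c : R[i]) (f : H -> H) :
  linear f -> linear (c \*: f).
Proof. by move=> fl d v w; rewrite /= fl scalerDr !scalerA mulrC. Qed.

Lemma linear_bop_comp (f g : H -> H) : linear f -> linear g -> linear (f \o g).
Proof. by move=> fl gl c v w; rewrite /= gl fl. Qed.

Lemma linear_bop_id : linear (@id H).
Proof. by []. Qed.

Lemma linear_bop_0 : linear (fun _ : H => 0 : H).
Proof. by move=> c v w; rewrite scaler0 addr0. Qed.

Lemma bop_adjP' T v w : inner H (bop_adj T v) w = inner H v (T w).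
Proof. by rewrite innerC -bop_adjP -innerC. Qed.

Lemma zero_bop_adjP (v w : H) : inner H 0 w = inner H v 0.
Proof. by rewrite linear0l linear0r. Qed.

Definition zero_bop : bop H :=
  BOp linear_bop_0 bounded_op_0 linear_bop_0 bounded_op_0 zero_bop_adjP.

Definition one_bop : bop H :=
  BOp linear_bop_id bounded_op_id linear_bop_id bounded_op_id
    (fun v w => erefl).

Lemma add_bop_adjP S T v w :
  inner H (S v + T v) w = inner H v (bop_adj S w + bop_adj T w).
Proof. by rewrite linearDl linearDr /= !bop_adjP. Qed.

Definition add_bop S T : bop H :=
  BOp (linear_bop_add (@bop_linear _ _ S) (@bop_linear _ _ T))
      (bounded_op_add (bop_bounded S) (bop_bounded T))
      (linear_bop_add (@bop_adj_linear _ _ S) (@bop_adj_linear _ _ T))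
      (bounded_op_add (bop_adj_bounded S) (bop_adj_bounded T))
      (add_bop_adjP S T).

Lemma scale_bop_adjP (c : R[i]) T v w :
  inner H (c *: T v) w = inner H v (c^* *: bop_adj T w).
Proof. by rewrite linearZl_LR linearZr_LR /= conjCK bop_adjP. Qed.

Definition scale_bop (c : R[i]) T : bop H :=
  BOp (linear_bop_scale c (@bop_linear _ _ T))
      (bounded_op_scale c (bop_bounded T))
      (linear_bop_scale c^* (@bop_adj_linear _ _ T))
      (bounded_op_scale c^* (bop_adj_bounded T))
      (scale_bop_adjP c T).

Definition opp_bop T : bop H := scale_bop (- 1) T.

Lemma mul_bop_adjP S T v w :
  inner H (S (T v)) w = inner H v (bop_adj T (bop_adj S w)).
Proof. by rewrite !bop_adjP. Qed.

Definition mul_bop S T : bop H :=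
  BOp (linear_bop_comp (@bop_linear _ _ S) (@bop_linear _ _ T))
      (bounded_op_comp (bop_bounded S) (bop_bounded T))
      (linear_bop_comp (@bop_adj_linear _ _ T) (@bop_adj_linear _ _ S))
      (bounded_op_comp (bop_adj_bounded T) (bop_adj_bounded S))
      (mul_bop_adjP S T).

Definition star_bop T : bop H :=
  BOp (@bop_adj_linear _ _ T) (bop_adj_bounded T)
      (@bop_linear _ _ T) (bop_bounded T) (bop_adjP' T).

Lemma add_bopA : associative add_bop.
Proof. by move=> S T U; apply: bop_ext => v /=; rewrite addrA. Qed.
Lemma add_bopC : commutative add_bop.
Proof. by move=> S T; apply: bop_ext => v /=; rewrite addrC. Qed.
Lemma add_0bop : left_id zero_bop add_bop.
Proof. by move=> S; apply: bop_ext => v /=; rewrite add0r. Qed.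
Lemma add_Nbop : left_inverse zero_bop opp_bop add_bop.
Proof. by move=> S; apply: bop_ext => v /=; rewrite scaleN1r addNr. Qed.

HB.instance Definition _ :=
  GRing.isZmodule.Build (bop H) add_bopA add_bopC add_0bop add_Nbop.

Lemma mul_bopA : associative mul_bop.
Proof. by move=> S T U; apply: bop_ext. Qed.
Lemma mul_1bop : left_id one_bop mul_bop.
Proof. by move=> S; apply: bop_ext. Qed.
Lemma mul_bop1 : right_id one_bop mul_bop.
Proof. by move=> S; apply: bop_ext. Qed.
Lemma mul_bopDl : left_distributive mul_bop +%R.
Proof. by move=> S T U; apply: bop_ext. Qed.
Lemma mul_bopDr : right_distributive mul_bop +%R.
Proof. by move=> S T U; apply: bop_ext => v /=; rewrite bopD. Qed.
Lemma one_bop_neq0 : one_bop != 0.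
Proof.
apply/eqP => /(congr1 (fun T : bop H => T : H -> H)) /= E.
have [v /eqP[]] := hilbert_neq0 H.
exact: (congr1 (fun f => f v) E).
Qed.

HB.instance Definition _ := GRing.Zmodule_isNzRing.Build (bop H)
  mul_bopA mul_1bop mul_bop1 mul_bopDl mul_bopDr one_bop_neq0.

Lemma scale_bopA (a b : R[i]) T :
  scale_bop a (scale_bop b T) = scale_bop (a * b) T.
Proof. by apply: bop_ext => v /=; rewrite scalerA. Qed.
Lemma scale_1bop : left_id 1 scale_bop.
Proof. by move=> T; apply: bop_ext => v /=; rewrite scale1r. Qed.
Lemma scale_bopDr : right_distributive scale_bop +%R.
Proof. by move=> a S T; apply: bop_ext => v /=; rewrite scalerDr. Qed.
Lemma scale_bopDl T : {morph scale_bop^~ T : a b / a + b}.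
Proof. by move=> a b; apply: bop_ext => v /=; rewrite scalerDl. Qed.

HB.instance Definition _ := GRing.Zmodule_isLmodule.Build R[i] (bop H)
  scale_bopA scale_1bop scale_bopDr scale_bopDl.

Lemma scale_bopAl (a : R[i]) S T : a *: (S * T) = (a *: S) * T.
Proof. by apply: bop_ext. Qed.
HB.instance Definition _ := GRing.Lmodule_isLalgebra.Build R[i] (bop H)
  scale_bopAl.

Lemma scale_bopAr (a : R[i]) S T : a *: (S * T) = S * (a *: T).
Proof. by apply: bop_ext => v; rewrite [RHS]bopZ. Qed.
HB.instance Definition _ := GRing.Lalgebra_isAlgebra.Build R[i] (bop H)
  scale_bopAr.

Lemma star_bopK : involutive star_bop.
Proof. by move=> T; apply: bop_ext. Qed.
Lemma star_bopD : {morph star_bop : S T / S + T}.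
Proof. by move=> S T; apply: bop_ext. Qed.
Lemma star_bopZ (c : R[i]) T : star_bop (c *: T) = c^* *: star_bop T.
Proof. by apply: bop_ext. Qed.
Lemma star_bopM S T : star_bop (S * T) = star_bop T * star_bop S.
Proof. by apply: bop_ext. Qed.

HB.instance Definition _ := hasStar.Build R[i] (bop H)
  star_bopK star_bopD star_bopZ star_bopM.

End BopTheory.

(* Von Neumann algebras, with a concrete faithful normal representation: the
   image of vn_rep is a *-subalgebra of B(H) equal to its bicommutant. *)

Definition commutant (A : pzRingType) (S : set A) : set A :=
  [set t | forall s, S s -> s * t = t * s].

Record vnAlgebra (R : realType) := VNAlgebra {
  vn_alg :> starAlgType R[i];
  vn_space : hilbert R;
  vn_rep : {lrmorphism vn_alg -> bop vn_space};
  vn_rep_star : forall a, vn_rep (star a) = star (vn_rep a);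
  vn_rep_inj : injective vn_rep;
  vn_bicommutant : commutant (commutant (range vn_rep)) = range vn_rep
}.

Section TracialState.
Variables (R : realType) (A : vnAlgebra R) (phi : {scalar A}).

Definition vn_le (a b : A) :=
  forall v, 0 <= inner (vn_space A) (vn_rep A (b - a) v) v.

Definition is_state := phi 1 = 1 /\ forall a : A, 0 <= phi (star a * a).

Definition tracial := forall a b : A, phi (a * b) = phi (b * a).

Definition faithful := forall a : A, phi (star a * a) = 0 -> a = 0.

(* Increasing nets are given as upward directed sets indexed by themselves. *)
Definition directed (D : set A) :=
  [/\ D !=set0, forall d, D d -> star d = d &
      forall d d', D d -> D d' -> exists2 d'', D d'' & vn_le d d'' /\ vn_le d' d''].

Definition sot_limit (D : set A) (a : A) :=
  forall (v : vn_space A) (e : R[i]), 0 < e -> exists2 d0, D d0 &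
    forall d, D d -> vn_le d0 d -> `|vn_rep A d v - vn_rep A a v| < e.

(* A bounded increasing net of self-adjoint operators converges strongly to its
   supremum. *)
Definition normal := forall (D : set A) (a : A),
  directed D -> sot_limit D a ->
  forall e : R[i], 0 < e -> exists2 d0, D d0 &
    forall d, D d -> vn_le d0 d -> `|phi d - phi a| < e.

Definition faithful_normal_tracial_state :=
  [/\ is_state, faithful, normal & tracial].

End TracialState.

(* L^2(A, phi) is the Hilbert space completion of A for <a, b> = phi (b^* a).
   L a and R a are the bounded extensions of left and right multiplication;
   all the fields are determined by A and phi up to a unique unitary. *)

Record L2space (R : realType) (A : vnAlgebra R) (phi : {scalar A}) := L2Space {
  L2 :> hilbert R;
  L2vec : {linear A -> L2};
  L2_inner : forall a b, inner L2 (L2vec a) (L2vec b) = phi (star b * a);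
  L2_dense : dense (range L2vec);
  L2_left : A -> bop L2;
  L2_leftE : forall a b, L2_left a (L2vec b) = L2vec (a * b);
  L2_right : A -> bop L2;
  L2_rightE : forall a b, L2_right a (L2vec b) = L2vec (b * a)
}.

Definition L2_state (R : realType) (A : vnAlgebra R) (phi : {scalar A})
    (V : L2space phi) (T : bop V) : R[i] :=
  inner V (T (L2vec V 1)) (L2vec V 1).

Section Freeness.
Variables (C : numClosedFieldType) (A : starAlgType C) (phi : A -> C).

Definition star_subalgebra (S : set A) :=
  [/\ S 1, forall (c : C) a b, S a -> S b -> S (c *: a + b),
      forall a b, S a -> S b -> S (a * b) & forall a, S a -> S (star a)].

Definition star_generated (X : set A) : set A :=
  [set a | forall S, star_subalgebra S -> X `<=` S -> S a].

Definition star_free (I : eqType) (X : I -> set A) :=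
  forall n (i : nat -> I) (a : nat -> A), (0 < n)%N ->
    (forall k, (k < n)%N -> star_generated (X (i k)) (a k) /\ phi (a k) = 0) ->
    (forall k, (k.+1 < n)%N -> i k != i k.+1) ->
    phi (\prod_(0 <= k < n) a k) = 0.

Definition star_free2 (X Y : set A) :=
  star_free (fun b : bool => if b then X else Y).

Definition unitary (u : A) := star u * u = 1 /\ u * star u = 1.

(* u ^ z for a unitary u, whose inverse is u^*. *)
Definition upow (u : A) (z : int) : A :=
  match z with Posz n => u ^+ n | Negz n => star u ^+ n.+1 end.

Definition Haar_unitary (u : A) :=
  unitary u /\ forall z : int, z != 0 -> phi (upow u z) = 0.

End Freeness.

(* An enlargement of (A, phi): a trace-preserving unital *-homomorphism into a
   von Neumann algebra with faithful normal tracial state. A unitary *-free from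
   {x, y} is looked for in enlargements: A itself may contain no Haar unitary at
   all (A = C), or no non-scalar unitary *-free from {x, y} (A commutative). *)
Definition enlargement (R : realType) (A B : vnAlgebra R)
    (phi : {scalar A}) (psi : {scalar B}) (j : {lrmorphism A -> B}) :=
  [/\ faithful_normal_tracial_state psi, forall a, j (star a) = star (j a) &
      forall a, psi (j a) = phi a].

(* Main.v *)
(* (1) <-> (2). The moment-cumulant formula, written in the order of [s_chi], is a sum
   over non-crossing partitions, and subtracting the mean of an even piece of a
   word removes the partitions for which that piece is a union of blocks. If all
   blocks of a partition are even and alternating, some even piece is a union of
   blocks, so R-diagonality kills every term. Conversely, split a word that is not
   alternating of even length into alternating pieces: by induction on its length
   all terms but the one-block cumulant vanish.

   (2) -> (4). In the letters of ux and uy, a centred piece becomes a centred piece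
   of x and y between powers of u that depend only on its end exponents. Freeness
   from u, after expanding the uncentred powers of u, shows that its products
   vanish, and the moments then agree by induction on the length.

   (3) -> (2). Over a free Haar unitary the products of (2) for (ux, uy) are
   alternating products of centred elements. A free Haar unitary is constructed on
   the reproducing kernel Hilbert space of words a0 u^e1 a1 ... u^en an; the vacuum is
   a cyclic trace vector for the algebra M generated by A and u there, and the
   commutant of J M J is a von Neumann algebra with a faithful normal trace. *)

From HB Require Import structures.
Require Import Defs.
From mathcomp Require Import all_boot all_order all_algebra.
From mathcomp Require Import boolp.

Set Implicit Arguments.
Unset Strict Implicit.
Unset Printing Implicit Defensive.

Import Order.TTheory GRing.Theory Num.Theory.

Local Open Scope ring_scope.

(** Consecutive pieces share an index, so the exponent repeats exactly at the cuts between pieces.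
    This serves both halves. Combinatorially, an even alternating block that is an interval has ends
    of opposite exponents, so deleting it keeps the pattern of cuts around it. After multiplication
    by u, the factor left at a cut is u or its adjoint, never 1, so consecutive pieces stay
    separated. For an arbitrary unitary u the separating factors may have nonzero mean. Replacing
    one by its mean merges two neighbours, and the merged product is again of the kind in (2); hence
    (2) is used for all runs of consecutive pieces at once. Statement (3) has no content unless a
    free Haar unitary exists in some enlargement. The obstacle in its construction is the trace
    property: right multiplication is the natural tool, but it cannot be assumed to respect the null
    vectors of the form. It is therefore defined on formal sums of words and compared there with
    left multiplication. *)

Lemma scalarZ (C : numClosedFieldType) (A : algType C) (phi : {scalar A}) (c : C) (a : A) :
  phi (c *: a) = c * phi a.
Proof. exact: linearZ. Qed.

Section StarAlgebraFacts.
Variables (C : numClosedFieldType) (A : starAlgType C).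

Lemma star1 : star (1 : A) = 1.
Proof. by rewrite -[LHS]mulr1 -{2}[1]starK -starM mulr1 starK. Qed.

Lemma star0 : star (0 : A) = 0.
Proof. by apply: (@addrI _ (star 0)); rewrite -starD !addr0. Qed.

Lemma starN (a : A) : star (- a) = - star a.
Proof. by rewrite -scaleN1r starZ rmorphN1 scaleN1r. Qed.

Lemma starB (a b : A) : star (a - b) = star a - star b.
Proof. by rewrite starD starN. Qed.

Lemma star_sum I (r : seq I) (F : I -> A) :
  star (\sum_(i <- r) F i) = \sum_(i <- r) star (F i).
Proof. by elim/big_rec2: _ => [|i x y _ <-]; rewrite ?star0 ?starD. Qed.
End StarAlgebraFacts.

(** * Non-crossing partitions *)

Section SaturatedPiece.
Variables (T : eqType) (Lb : eqType) (e : T -> bool) (q : T -> nat) (lab : T -> Lb).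
Implicit Types (s t b : seq T).

Definition noncrossing_seq s := forall p1 p2 p3 p4,
  subseq [:: p1; p2; p3; p4] s -> lab p1 = lab p3 -> lab p2 = lab p4 -> lab p1 = lab p2.

(** Neighbouring positions have different exponents exactly when they lie in the same piece: [e] is
    the exponent, [q] the number of the piece, and [lab] will be the block of a position. *)
Definition piece_rel p p' := (e p != e p') == (q p == q p').

Definition class l s := [seq p <- s | lab p == l].

Lemma noncrossing_subseq s t : subseq s t -> noncrossing_seq t -> noncrossing_seq s.
Proof. by move=> st nt p1 p2 p3 p4 ps; apply: nt; exact: subseq_trans st. Qed.

Lemma class_nil l s : (forall p, p \in s -> lab p != l) -> class l s = [::].
Proof.
move=> sl; rewrite /class; apply/eqP; rewrite -(negbK (_ == _)) -has_filter.
by apply/hasPn.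
Qed.

(* Among the label-closed factors of [s], a shortest one has a single label. *)
Lemma interval_block n s1 t s2 : (size t <= n)%N -> t != [::] ->
  noncrossing_seq (s1 ++ t ++ s2) ->
  (forall p p', p \in t -> p' \in s1 ++ s2 -> lab p != lab p') ->
  exists u1 b u2 l, [/\ s1 ++ t ++ s2 = u1 ++ b ++ u2, b != [::],
    all (fun p => lab p == l) b & forall p, p \in u1 ++ u2 -> lab p != l].
Proof.
elim: n s1 t s2 => [|n IH] s1 [|x t] s2 // tn _ nc cl.
pose a p := lab p == lab x.
have [hs|] := boolP (has (predC a) (x :: t)); last first.
  rewrite -all_predC => al; exists s1, (x :: t), s2, (lab x); split=> //.
    by apply: sub_all al => p /=; rewrite negbK.
  by move=> p ps; rewrite eq_sym; apply: cl ps; exact: mem_head.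
case: {-1}_ _ _ / (split_find hs) (erefl (x :: t)) => y f g ay.
rewrite -all_predC => fa tE.
have {fa} fa : all a f by apply: sub_all fa => p /=; rewrite negbK.
case: f fa tE => [_ [xy _]|x' f fa [xx' tE]]; first by rewrite -xy /= /a eqxx in ay.
(* After the initial run of the label of [x], the stretch [h] before the next occurrence of that
   label, or up to the end of [t], is a shorter label-closed factor. *)
subst x'; have step h s2' : y :: g = h ++ s2' -> h != [::] -> all (predC a) h ->
    (forall p p', p \in h -> p' \in s2' -> lab p != lab p') ->
    exists u1 b u2 l, [/\ s1 ++ (x :: t) ++ s2 = u1 ++ b ++ u2, b != [::],
    all (fun p => lab p == l) b & forall p, p \in u1 ++ u2 -> lab p != l].
  move=> hE h0 ha hs2.
  have sE : s1 ++ (x :: t) ++ s2 = (s1 ++ x :: f) ++ h ++ (s2' ++ s2).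
    by rewrite tE cat_rcons hE -!catA /= -!catA.
  rewrite sE in nc *; apply: IH => //.
    move: tn; rewrite tE cat_rcons hE /= !size_cat ltnS; apply: leq_trans.
    by rewrite addnCA leq_addr.
  have xh p : p \in h -> lab p != lab x by move=> ph; have /allP/(_ p ph) := ha.
  have cls p p' : p \in h -> p' \in s1 ++ s2 -> lab p != lab p'.
    by move=> ph; apply: cl; rewrite tE cat_rcons hE inE !mem_cat ph !orbT.
  move=> p p' ph; rewrite mem_cat => /orP[]; rewrite mem_cat => /orP[] p's.
  - by apply: cls => //; rewrite mem_cat p's.
  - have -> : lab p' = lab x by have /allP/(_ p' p's)/eqP := fa.
    exact: xh.
  - exact: hs2.
  - by apply: cls => //; rewrite mem_cat p's orbT.
have -> : rcons (x :: f) y ++ g = x :: t by rewrite tE.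
have [hg|] := boolP (has a g); last first.
  rewrite -all_predC => ag; apply: (step (y :: g) [::]); rewrite ?cats0 //=.
  by rewrite ag andbT.
case: {-1}_ _ _ / (split_find hg) (erefl g) => z g1 g2 az.
rewrite -all_predC => ag1 gE; apply: (step (y :: g1) (z :: g2)) => //.
- by rewrite gE cat_rcons.
- by rewrite /= ag1 andbT.
move=> p p' ph; rewrite inE => /predU1P[->|p'g].
  rewrite (eqP az); move: ph; rewrite inE => /predU1P[->//|pg].
  by have /allP/(_ p pg) := ag1.
(* A label shared by [p] before [z] and [p'] after it would cross the label shared by [x] and
   [z]. *)
apply/eqP => pp'; have sub : subseq [:: x; p; z; p'] (s1 ++ (x :: t) ++ s2).
  apply: subseq_trans (suffix_subseq _ _); apply: subseq_trans (prefix_subseq _ _).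
  have -> : x :: t = (x :: f) ++ (y :: g1) ++ (z :: g2).
    by rewrite tE cat_rcons gE cat_rcons.
  rewrite -[[:: x; p; z; p']]/([:: x] ++ [:: p] ++ [:: z; p']).
  apply: cat_subseq; first by rewrite sub1seq mem_head.
  by apply: cat_subseq; rewrite ?sub1seq //= eqxx sub1seq.
have := nc _ _ _ _ sub (esym (eqP az)) pp' => xp.
move: ph; rewrite inE => /predU1P[py|pg]; first by move: ay; rewrite /= /a -py -xp eqxx.
by have /allP/(_ p pg) := ag1; rewrite /= /a -xp eqxx.
Qed.

Lemma path_alt_last p b : path (fun p p' => e p != e p') p b ->
  e (last p b) = e p (+) odd (size b).
Proof.
elim: b p => [|p' b IH] p /=; first by rewrite addbF.
by move=> /andP[pp' /IH ->]; case: (e p) (e p') pp' (odd _) => [] [] // _ [].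
Qed.

Lemma sorted_mid (r : rel T) u b v : b != [::] -> sorted r (u ++ b ++ v) -> sorted r b.
Proof. by move=> _ /cat_sorted2[_] /cat_sorted2[]. Qed.

Lemma sorted_join (r : rel T) u i j v :
  sorted r (rcons u i ++ j :: v) = [&& sorted r (rcons u i), r i j & path r j v].
Proof.
rewrite sorted_cat_cons; case: u => [|h u] /=; first by rewrite andbT.
by rewrite !rcons_path last_rcons -!andbA.
Qed.

(* Remove a block that is an interval: being even and alternating it lies in one
   piece, and its removal leaves the alternation pattern at the cut unchanged, so
   either that piece is used up or induction applies. *)
Lemma saturated_piece s : s != [::] -> sorted piece_rel s -> sorted (fun p p' => q p <= q p')%N s ->
  noncrossing_seq s ->
  (forall l, ~~ odd (size (class l s)) && sorted (fun p p' => e p != e p') (class l s)) ->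
  exists2 p0, p0 \in s & forall p p', p \in s -> p' \in s -> q p = q p0 -> lab p = lab p' ->
    q p' = q p0.
Proof.
have [n] := ubnP (size s); elim: n s => // n IH s sn s0 sr sq nc good.
have [u [b [v [l [sE b0 bl uvl]]]]] : exists u1 b u2 l, [/\ s = u1 ++ b ++ u2, b != [::],
    all (fun p => lab p == l) b & forall p, p \in u1 ++ u2 -> lab p != l].
  have := @interval_block (size s) [::] s [::]; rewrite /= cats0.
  by apply.
have cb : class l s = b.
  rewrite sE /class !filter_cat (all_filterP bl).
  rewrite -/(class l u) -/(class l v) !class_nil ?cats0 // => p ps; apply: uvl.
    by rewrite mem_cat ps orbT.
  by rewrite mem_cat ps.
have /andP[be ba] : ~~ odd (size b) && sorted (fun p p' => e p != e p') b by rewrite -cb.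
case: b b0 be ba bl sE cb => // x b _ be ba bl sE cb.
(* Exponents alternate along the block, which is an interval of [s], so [piece_rel] keeps it inside
   one piece. *)
have qb p : p \in x :: b -> q p = q x.
  have : path piece_rel x b by apply: (@sorted_mid _ u (x :: b) v); rewrite -?sE.
  elim: (b) (x) ba p => [|x' b' IHb] x0 /=; first by move=> _ p _; rewrite inE => /eqP ->.
  rewrite {1}/piece_rel => /andP[-> ba'] p /andP[/eqP qq pb']; rewrite inE => /predU1P[->//|pb].
  by rewrite (IHb x' ba' p pb' pb); apply/eqP; rewrite eq_sym -qq.
have xs : x \in s by rewrite sE !mem_cat mem_head orbT.
have mem_s p : (p \in s) = (p \in x :: b) || (p \in u ++ v).
  by rewrite sE !mem_cat orbCA.
have labb p : p \in x :: b -> lab p = l by move=> pb; apply/eqP; apply: (allP bl).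
have [hc|nc'] := boolP (has (fun p => q p == q x) (u ++ v)); last first.
  exists x => // p p'; rewrite !mem_s => /orP[pb|pu] /orP[p'b|p'u] qp pp' //.
  - exact: qb.
  - by have := uvl p' p'u; rewrite -pp' labb ?eqxx.
  - exact: qb.
  - by have := hasPn nc' p pu; rewrite qp eqxx.
have sub : subseq (u ++ v) s by rewrite sE cat_subseq // suffix_subseq.
have qm : transitive (fun p p' => q p <= q p')%N by move=> ? ? ?; exact: leq_trans.
have [||||||p0 p0s p0P] := IH (u ++ v).
- by move: sn; rewrite sE !size_cat /= ltnS addSn addnS; apply: leq_trans; rewrite ltnS leq_add2l leq_addl.
- by apply: contraTneq hc => ->.
- case: (lastP u) sE hc => [|u' i] sE hc.
    by move: sr; rewrite sE => /cat_sorted2[_ /cat_sorted2[]].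
  case vE: v sE hc => [|j w] sE hc.
    by rewrite cats0; move: sr; rewrite sE => /cat_sorted2[].
  have sr1 : sorted piece_rel (rcons u' i ++ x :: (b ++ j :: w)) by rewrite -sE.
  have sq1 : sorted (fun p p' => q p <= q p')%N (rcons u' i ++ x :: (b ++ j :: w)) by rewrite -sE.
  move: (sr1); rewrite sorted_join => /and3P[ru rix].
  rewrite cat_path => /andP[_ /= /andP[rlj rv]].
  rewrite sorted_join ru rv andbT /=.
  move: (sq1); rewrite sorted_join => /and3P[qu qix].
  rewrite cat_path => /andP[_ /= /andP[qlj qv]].
  have lb : last x b \in x :: b by exact: mem_last.
  move: rix rlj qlj; rewrite /piece_rel (qb _ lb) (path_alt_last ba).
  (* [b] lacks the first position [x] of the even block; hence the two ends of the block have
     opposite exponents. *)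
  have -> : odd (size b) = true by move: be => /=; rewrite negbK.
  rewrite addbT => rix rlj qxj.
  have [qi|qi] := eqVneq (q i) (q x).
    by move: rix rlj; rewrite qi eqxx; case: (q x == q j); case: (e i) (e x) (e j) => [] [] [].
  have [qj|qj] := eqVneq (q j) (q x).
    by move: rix rlj; rewrite qj eqxx (negPf qi); case: (e i) (e x) (e j) => [] [] [].
  have ix : (q i < q x)%N by rewrite ltn_neqAle qi.
  have xj : (q x < q j)%N by rewrite ltn_neqAle eq_sym qj.
  (* Both neighbours lie outside the piece of [x]; as [q] is monotone, that piece has no position
     besides the block, against [hc]. *)
  exfalso; case/hasP: hc => p; rewrite mem_cat => /orP[pu|pv] /eqP qp.
    have : (q p <= q i)%N.
      move: pu qu; rewrite mem_rcons inE => /predU1P[->//|pu'].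
      rewrite (sorted_pairwise qm) -cats1 pairwise_cat => /and3P[/allrelP rel _ _].
      by apply: rel => //; rewrite mem_head.
    by rewrite qp leqNgt ix.
  have : (q j <= q p)%N.
    move: pv; rewrite inE => /predU1P[->//|pv'].
    by have /allP := order_path_min qm qv; exact.
  by rewrite qp leqNgt xj.
- exact: subseq_sorted qm _ _ sub sq.
- exact: noncrossing_subseq sub nc.
- move=> l'; have := good l'; have [->|ll'] := eqVneq l' l.
    by rewrite [class l (u ++ v)]class_nil.
  suff -> : class l' s = class l' (u ++ v) by [].
  rewrite sE /class !filter_cat -/(class l' (x :: b)) (class_nil (s := x :: b)) //.
  by move=> p pb; rewrite labb // eq_sym.
exists p0 => [|p p']; first by rewrite mem_s p0s orbT.
rewrite !mem_s => /orP[pb|pu] /orP[p'b|p'u] qp pp'.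
- by rewrite (qb p') // -(qb p).
- by have := uvl p' p'u; rewrite -pp' labb ?eqxx.
- by have := uvl p pu; rewrite pp' labb ?eqxx.
- exact: p0P pp'.
Qed.
End SaturatedPiece.

(** * Sums over non-crossing partitions of sets of positions *)

Section NoncrossingSubsets.
Variable n : nat.
Implicit Types (S T Z V W : {set 'I_n}) (pi : {set {set 'I_n}}).

Definition nc S pi : bool :=
  partition pi S &&
  [forall V in pi, forall W in pi, (V != W) ==>
     ~~ [exists a in V, exists b in W, exists c in V, exists d in W,
           (a < b)%N && (b < c)%N && (c < d)%N]].

Definition no_crossing pi := forall V W, V \in pi -> W \in pi -> V != W ->
  forall a b c d, a \in V -> b \in W -> c \in V -> d \in W ->
  (a < b)%N -> (b < c)%N -> (c < d)%N -> False.

Lemma ncP S pi : reflect (partition pi S /\ no_crossing pi) (nc S pi).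
Proof.
apply: (iffP andP) => -[pP cr]; split=> //.
  move=> V W Vp Wp VW a b c d aV bW cV dW ab bc cd.
  have /forall_inP/(_ V Vp)/forall_inP/(_ W Wp)/implyP/(_ VW)/negP := cr; apply.
  apply/exists_inP; exists a => //; apply/exists_inP; exists b => //.
  apply/exists_inP; exists c => //; apply/exists_inP; exists d => //.
  by rewrite ab bc cd.
apply/forall_inP => V Vp; apply/forall_inP => W Wp; apply/implyP => VW.
apply/negP => /exists_inP[a aV /exists_inP[b bW /exists_inP[c cV /exists_inP[d dW]]]].
by move=> /andP[/andP[ab bc] cd]; exact: cr Vp Wp VW a b c d aV bW cV dW ab bc cd.
Qed.

(** For a subset [Z] of the partitioned set: [Z] is a union of blocks. *)
Definition sat Z pi := [forall V in pi, (V \subset Z) || [disjoint V & Z]].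

Definition restr T pi := [set V in pi | V \subset T].

Lemma partition_sub S pi V : partition pi S -> V \in pi -> V \subset S.
Proof. by move=> /and3P[/eqP <- _ _] Vp; exact: bigcup_sup. Qed.

Lemma block_inhabited S pi V : partition pi S -> V \in pi -> exists a, a \in V.
Proof.
move=> /and3P[_ _ p0] Vp; apply/set0Pn; apply: contraNneq p0 => <-.
exact: Vp.
Qed.

Lemma partition_mem S pi a : partition pi S -> a \in S -> exists2 V, V \in pi & a \in V.
Proof. by move=> /and3P[/eqP <- _ _] /bigcupP[V Vp aV]; exists V. Qed.

Lemma sat_sub S Z pi V a : sat Z pi -> V \in pi -> a \in V -> a \in Z -> V \subset Z.
Proof.
move=> /forall_inP/(_ V) h Vp aV aZ; have /orP[//|] := h Vp.
by rewrite -setI_eq0 => /eqP/setP/(_ a); rewrite !inE aV aZ.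
Qed.

Lemma partition_restr S Z pi : Z \subset S -> partition pi S -> sat Z pi ->
  partition (restr Z pi) Z.
Proof.
move=> ZS pP st; apply/and3P; split.
- rewrite eqEsubset; apply/andP; split.
    by apply/bigcupsP => V; rewrite inE => /andP[].
  apply/subsetP => a aZ; have [V Vp aV] := partition_mem pP (subsetP ZS a aZ).
  by apply/bigcupP; exists V; rewrite // inE Vp (sat_sub S st Vp aV).
- case/and3P: pP => _ tr _; apply: trivIsetS tr; apply/subsetP => V.
  by rewrite inE => /andP[].
- by case/and3P: pP => _ _; apply: contra; rewrite inE => /andP[].
Qed.

Lemma sat_compl Z T pi : [disjoint Z & T] -> partition pi (Z :|: T) -> sat Z pi -> sat T pi.
Proof.
move=> ZT pP st; apply/forall_inP => V Vp.
have /forall_inP/(_ V Vp)/orP[VZ|VZ] := st.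
  by rewrite (disjointWl VZ ZT) orbT.
apply/orP; left; apply/subsetP => a aV; have := subsetP (partition_sub pP Vp) a aV.
by rewrite inE (disjointFr VZ aV).
Qed.

Lemma restrU Z T pi : [disjoint Z & T] -> partition pi (Z :|: T) -> sat Z pi ->
  restr Z pi :|: restr T pi = pi.
Proof.
move=> ZT pP st; apply/setP => V; rewrite !inE -andb_orr.
have [Vp|//] := boolP (V \in pi); have /forall_inP/(_ V Vp)/orP[->//|VZ] := st.
have /forall_inP/(_ V Vp)/orP[->|VT] := sat_compl ZT pP st; first by rewrite orbT.
have [a aV] := block_inhabited pP Vp; have := subsetP (partition_sub pP Vp) a aV.
by rewrite inE (disjointFr VZ aV) (disjointFr VT aV).
Qed.

Lemma nc_restr S Z pi : Z \subset S -> nc S pi -> sat Z pi -> nc Z (restr Z pi).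
Proof.
move=> ZS /ncP[pP cr] st; apply/ncP; split; first exact: partition_restr pP st.
by move=> V W; rewrite !inE => /andP[Vp _] /andP[Wp _]; exact: cr.
Qed.

(** For disjoint sets, [Z] is an interval of [Z :|: T], so a block inside [Z] cannot cross a block
    inside [T]. *)
Definition convex_in Z T := forall a b c, a \in Z -> b \in T -> c \in Z ->
  (a < b)%N -> (b < c)%N -> False.

Lemma restr_union Z T pi1 pi2 : [disjoint Z & T] -> partition pi1 Z -> partition pi2 T ->
  restr Z (pi1 :|: pi2) = pi1.
Proof.
move=> ZT p1 p2; apply/setP => V; rewrite !inE.
have [V1|V1] := boolP (V \in pi1); first by rewrite (partition_sub p1 V1).
apply/negP => /andP[V2 VZ]; have [a aV] := block_inhabited p2 V2.
have := subsetP (partition_sub p2 V2) a aV.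
by rewrite (disjointFr ZT (subsetP VZ a aV)).
Qed.

Lemma nc_union Z T pi1 pi2 : [disjoint Z & T] -> convex_in Z T ->
  nc Z pi1 -> nc T pi2 -> nc (Z :|: T) (pi1 :|: pi2).
Proof.
move=> ZT cv /ncP[p1 c1] /ncP[p2 c2]; apply/ncP; split.
  apply/and3P; split.
  - by rewrite /cover bigcup_setU; case/and3P: p1 => /eqP <- _ _; case/and3P: p2 => /eqP <-.
  - case/and3P: (p1) => /eqP e1 t1 _; case/and3P: (p2) => /eqP e2 t2 _.
    by apply: trivIsetU => //; rewrite e1 e2.
  - by rewrite inE negb_or; case/and3P: p1 => _ _ ->; case/and3P: p2.
have s1 := partition_sub p1; have s2 := partition_sub p2.
move=> V W; rewrite !inE => /orP[V1|V2] /orP[W1|W2] VW a b c d aV bW cV dW ab bc cd.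
- exact: c1 V1 W1 VW a b c d aV bW cV dW ab bc cd.
- exact: cv (subsetP (s1 _ V1) a aV) (subsetP (s2 _ W2) b bW) (subsetP (s1 _ V1) c cV) ab bc.
- exact: cv (subsetP (s1 _ W1) b bW) (subsetP (s2 _ V2) c cV) (subsetP (s1 _ W1) d dW) bc cd.
- exact: c2 V2 W2 VW a b c d aV bW cV dW ab bc cd.
Qed.

Lemma sat_union Z T pi1 pi2 : [disjoint Z & T] -> partition pi1 Z -> partition pi2 T ->
  sat Z (pi1 :|: pi2).
Proof.
move=> ZT p1 p2; apply/forall_inP => V; rewrite inE => /orP[/(partition_sub p1) ->//|V2].
by rewrite (disjointWl (partition_sub p2 V2)) ?orbT // disjoint_sym.
Qed.

Lemma sat_restr Z Z' T pi : [disjoint Z & T] -> partition pi (Z :|: T) -> sat Z pi ->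
  Z' \subset T -> sat Z' (restr T pi) = sat Z' pi.
Proof.
move=> ZT pP st Z'T; apply/forall_inP/forall_inP => h V; last first.
  by rewrite inE => /andP[/h].
move=> Vp; have /forall_inP/(_ V Vp)/orP[VT|VT] := sat_compl ZT pP st.
  by apply: h; rewrite inE Vp.
by rewrite (disjointWr Z'T VT) orbT.
Qed.

Section Sums.
Variables (R : comNzRingType) (kappa : {set 'I_n} -> R).

Definition kappa_prod pi : R := \prod_(V in pi) kappa V.

Lemma kappa_prodU Z T pi1 pi2 : [disjoint Z & T] -> partition pi1 Z -> partition pi2 T ->
  kappa_prod (pi1 :|: pi2) = kappa_prod pi1 * kappa_prod pi2.
Proof.
move=> ZT p1 p2; rewrite /kappa_prod -bigU //=.
  by apply: eq_bigl => V; rewrite inE.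
rewrite -setI_eq0; apply/eqP/setP => V; rewrite !inE; apply/negP => /andP[V1 V2].
have [a aV] := block_inhabited p1 V1.
have := subsetP (partition_sub p2 V2) a aV.
by rewrite (disjointFr ZT (subsetP (partition_sub p1 V1) a aV)).
Qed.

(** A non-crossing partition having the interval [Z] as a union of blocks is an independent pair of
    non-crossing partitions of [Z] and [T]. The weight [g] leaves room for the conditions imposed by
    the remaining pieces. *)
Lemma nc_sum_split Z T (g : {set {set 'I_n}} -> R) : [disjoint Z & T] -> convex_in Z T ->
  \sum_(pi | nc (Z :|: T) pi && sat Z pi) kappa_prod pi * g (restr T pi) =
  (\sum_(pi | nc Z pi) kappa_prod pi) * \sum_(pi | nc T pi) kappa_prod pi * g pi.
Proof.
move=> ZT cv; rewrite mulr_suml; under [RHS]eq_bigr do rewrite mulr_sumr.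
rewrite pair_big /=.
rewrite (reindex_onto (fun p : {set {set 'I_n}} * {set {set 'I_n}} => p.1 :|: p.2)
  (fun pi => (restr Z pi, restr T pi))) /=; last first.
  by move=> pi /andP[/ncP[pP _] st]; exact: restrU.
have TZ : [disjoint T & Z] by rewrite disjoint_sym.
apply: eq_big => [[p1 p2]|[p1 p2]] /=.
  apply/idP/idP => [/andP[/andP[np st] /eqP[E1 E2]]|/andP[n1 n2]].
    have pP : partition (p1 :|: p2) (Z :|: T) by case/ncP: np.
    have n1 : nc Z p1 by rewrite -E1; apply: nc_restr np st; exact: subsetUl.
    rewrite n1 -E2; apply: nc_restr np _; first exact: subsetUr.
    exact: sat_compl pP st.
  have [P1 _] := ncP _ _ n1; have [P2 _] := ncP _ _ n2.
  rewrite nc_union // (sat_union ZT P1 P2) /= (restr_union ZT P1 P2).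
  by rewrite setUC (restr_union TZ P2 P1).
move=> /andP[/andP[np st] /eqP[E1 E2]].
have pP : partition (p1 :|: p2) (Z :|: T) by case/ncP: np.
have P1 : partition p1 Z by rewrite -E1; apply: partition_restr pP st; exact: subsetUl.
have P2 : partition p2 T.
  rewrite -E2; apply: (partition_restr _ pP); first exact: subsetUr.
  exact: sat_compl pP st.
by rewrite E2 (kappa_prodU ZT P1 P2) mulrA.
Qed.
End Sums.
End NoncrossingSubsets.

(** * Moments over sets of positions *)

Lemma sorted_enum n (A : {set 'I_n}) : sorted ltn (map val (enum A)).
Proof.
have -> : enum A = [seq x <- enum 'I_n | x \in A] by rewrite enumT.
rewrite sorted_map; apply: sorted_filter; first by move=> ? ? ?; exact: ltn_trans.
by have := iota_ltn_sorted 0 n; rewrite -val_enum_ord sorted_map.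
Qed.

Lemma enum_imset_mono n m (f : 'I_n -> 'I_m) (A : {set 'I_n}) :
  {homo f : i j / (i < j)%N} -> enum (f @: A) = map f (enum A).
Proof.
move=> fm; apply: (inj_map val_inj); apply: (irr_sorted_eq ltn_trans ltnn).
- exact: sorted_enum.
- rewrite -map_comp sorted_map.
  by have := sorted_enum A; rewrite sorted_map; apply: sub_sorted => i j /=; exact: fm.
- move=> k; apply/mapP/mapP => -[i]; rewrite ?mem_enum.
    by move=> /imsetP[j jA ->] ->; exists (f j) => //; rewrite map_f // mem_enum.
  by move=> /mapP[j]; rewrite mem_enum => jA -> ->; exists (f j) => //; rewrite mem_enum imset_f.
Qed.

Lemma map_enum_val n (A : {set 'I_n}) : [seq enum_val i | i <- enum 'I_#|A|] = enum A.
Proof.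
have [->|/set0Pn[a _]] := eqVneq A set0.
  by rewrite enum_set0; apply/nilP; rewrite /nilp size_map size_enum_ord cards0.
apply: (@eq_from_nth _ a); first by rewrite size_map size_enum_ord cardE.
move=> i; rewrite size_map size_enum_ord => ilt.
by rewrite (nth_map (Ordinal ilt)) ?size_enum_ord // (enum_val_nth a) nth_enum_ord.
Qed.

Lemma enum_val_homo n (A : {set 'I_n}) : {homo @enum_val _ A : i j / (i < j)%N}.
Proof.
move=> i j ij; have := sorted_enum A; rewrite -map_enum_val -map_comp sorted_map.
rewrite sorted_pairwise; last by move=> ? ? ? /=; exact: ltn_trans.
move=> /(pairwiseP i)/(_ i j); rewrite !inE size_enum_ord !nth_ord_enum; apply=> //.
Qed.

Lemma map_s_chi n (chi : 'I_n -> side) : [seq s_chi chi k | k <- enum 'I_n] =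
  [seq i <- enum 'I_n | Defs.is_left (chi i)] ++ rev [seq i <- enum 'I_n | ~~ Defs.is_left (chi i)].
Proof.
set l := _ ++ _; have sl : size l = n.
  by rewrite size_cat size_rev !size_filter count_predC size_enum_ord.
case: n chi @l sl => [|k] chi l sl.
  by rewrite (size0nil sl); apply: size0nil; rewrite size_map size_enum_ord.
apply: (@eq_from_nth _ ord0); rewrite size_map size_enum_ord // => i ilt.
rewrite (nth_map ord0) ?size_enum_ord // /s_chi -/l.
by rewrite (set_nth_default ord0) ?sl ?ltn_ord // nth_enum_ord.
Qed.

Section SubsetMoments.
Variables (C : numClosedFieldType) (A : starAlgType C) (Phi : A -> C).
Variables (m : nat) (chi : 'I_m -> side) (a : 'I_m -> A).

Local Notation s := (s_chi chi).

Definition block_cumulant (U : {set 'I_m}) : C :=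
  cumulant Phi (fun i : 'I_#|U| => chi (enum_val i)) (fun i : 'I_#|U| => a (enum_val i)).

(* Positions are numbered in the order [s_chi], in which bi-non-crossing partitions
   become non-crossing. *)
Definition pos_cumulant (V : {set 'I_m}) : C := block_cumulant (s @: V).

Lemma map_s_chi_enum (S : {set 'I_m}) :
  [seq s p | p <- enum S] = [seq i <- [seq s p | p <- enum 'I_m] | i \in s @: S].
Proof.
rewrite filter_map; congr map; have -> : enum S = [seq p <- enum 'I_m | p \in S] by rewrite enumT.
by apply: eq_filter => p /=; rewrite mem_imset //; exact: s_chi_inj.
Qed.

Lemma filter_enum_val (T : {set 'I_m}) (b : pred 'I_m) :
  [seq enum_val i | i <- [seq i <- enum 'I_#|T| | b (enum_val i)]] =
  [seq i <- [seq i <- enum 'I_m | b i] | i \in T].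
Proof.
rewrite -[LHS](filter_map (@enum_val _ T) b) map_enum_val.
have -> : enum T = [seq p <- enum 'I_m | p \in T] by rewrite enumT.
by rewrite -!filter_predI; apply: eq_filter => p /=; rewrite [b p && _]andbC.
Qed.

Lemma map_s_chi_val (T : {set 'I_m}) :
  [seq enum_val (s_chi (fun i : 'I_#|T| => chi (enum_val i)) j) | j <- enum 'I_#|T|] =
  [seq i <- [seq s p | p <- enum 'I_m] | i \in T].
Proof.
rewrite [LHS](map_comp enum_val) !map_s_chi map_cat filter_cat map_rev filter_rev.
by rewrite (filter_enum_val T (fun i => Defs.is_left (chi i)))
  (filter_enum_val T (fun i => ~~ Defs.is_left (chi i))).
Qed.

Variable S : {set 'I_m}.
Local Notation T := (s @: S).
Local Notation chi' := (fun i : 'I_#|T| => chi (enum_val i)).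
Local Notation a' := (fun i : 'I_#|T| => a (enum_val i)).

Lemma card_T : #|T| = #|S|.
Proof. by rewrite card_imset //; exact: s_chi_inj. Qed.

Definition pos_val (j : 'I_#|T|) : 'I_m := enum_val (cast_ord card_T j).

Lemma pos_val_homo : {homo pos_val : i j / (i < j)%N}.
Proof. by move=> i j ij; apply: enum_val_homo. Qed.

Lemma map_cast_ord k n (e : k = n) : [seq cast_ord e j | j <- enum 'I_k] = enum 'I_n.
Proof. by case: n / e; under eq_map do rewrite cast_ord_id; rewrite map_id. Qed.

Lemma map_pos_val : [seq pos_val j | j <- enum 'I_#|T|] = enum S.
Proof. by rewrite -[RHS]map_enum_val -(map_cast_ord card_T); elim: (enum _) => //= j t ->. Qed.

(** Restricting a word to a set of positions commutes with ordering it by [s_chi]. The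
    moment-cumulant formula of a subword can thus be read in the order of the whole word. *)
Lemma enum_val_s_chi j : enum_val (s_chi chi' j) = s (pos_val j).
Proof.
have : [seq enum_val (s_chi chi' j) | j <- enum 'I_#|T|] =
    [seq s (pos_val j) | j <- enum 'I_#|T|].
  by rewrite map_s_chi_val -map_s_chi_enum -map_pos_val -map_comp.
by move=> /eq_in_map E; apply: E; rewrite mem_enum.
Qed.

Lemma pos_val_imset : pos_val @: setT = S.
Proof.
apply/setP => p; rewrite -[RHS]mem_enum -map_pos_val.
apply/imsetP/mapP => -[j _ ->]; exists j => //; exact: mem_enum.
Qed.

Lemma block_cumulant_val (U : {set 'I_#|T|}) :
  cumulant Phi (fun i : 'I_#|U| => chi' (enum_val i)) (fun i : 'I_#|U| => a' (enum_val i)) =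
  block_cumulant (enum_val @: U).
Proof.
have cU : #|U| = #|enum_val @: U : {set 'I_m}| by rewrite [RHS]card_imset //; exact: enum_val_inj.
have E i : enum_val (enum_val i) = enum_val (cast_ord cU i) :> 'I_m.
  have p0 : 'I_m := enum_val (enum_val i).
  rewrite [RHS](enum_val_nth p0) (enum_imset_mono _ (@enum_val_homo _ T)) /=.
  have il : (i < size (enum U))%N by rewrite -cardE.
  by rewrite (nth_map (enum_val i)) // -enum_val_nth.
rewrite /block_cumulant -(cumulant_cast Phi cU (f := cast_ord cU)) //.
congr cumulant; apply/funext => i; by rewrite E.
Qed.

Lemma pos_val_inj : injective pos_val.
Proof. by move=> i j /enum_val_inj/cast_ord_inj. Qed.

Lemma pos_val_preim (W : {set 'I_m}) : W \subset S -> pos_val @: (pos_val @^-1: W) = W.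
Proof.
move=> WS; apply/setP => p; apply/imsetP/idP => [[j]|pW]; first by rewrite inE => jW ->.
have : p \in pos_val @: setT by rewrite pos_val_imset (subsetP WS).
by move=> /imsetP[j _ pj]; exists j; rewrite ?inE -?pj.
Qed.

Lemma nc_pos_val (pi : {set {set 'I_#|T|}}) :
  nc S [set pos_val @: (V : {set _}) | V in pi] = noncrossing pi.
Proof.
have pp : partition [set pos_val @: (V : {set _}) | V in pi] S = partition pi [set: _].
  rewrite -[RHS](imset_partition _ _ pos_val_inj); congr partition.
  exact/esym/pos_val_imset.
apply/(ncP S)/(ncP [set: _]); rewrite pp => -[pP cr]; split=> //.
  move=> V W Vp Wp VW a1 b1 c1 d1 aV bW cV dW ab bc cd.
  apply: (cr (pos_val @: V) (pos_val @: W) _ _ _ (pos_val a1) (pos_val b1) (pos_val c1) (pos_val d1));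
    rewrite ?imset_f //; try exact: pos_val_homo.
  by rewrite (inj_eq (imset_inj pos_val_inj)).
move=> _ _ /imsetP[V Vp ->] /imsetP[W Wp ->]; rewrite (inj_eq (imset_inj pos_val_inj)) => VW.
have mono : {mono pos_val : i j / (i < j)%N}.
  move=> i j; apply/idP/idP; last exact: pos_val_homo.
  apply: contraTT; rewrite -!leqNgt leq_eqVlt => /predU1P[/val_inj ->//|/pos_val_homo/ltnW//].
move=> _ _ _ _ /imsetP[a1 aV ->] /imsetP[b1 bV ->] /imsetP[c1 cV ->] /imsetP[d1 dV ->].
by rewrite !mono; exact: cr Vp Wp VW _ _ _ _ aV bV cV dV.
Qed.

Lemma subset_moment : S != set0 ->
  Phi (\prod_(i < #|T|) a' i) = \sum_(pi | nc S pi) kappa_prod pos_cumulant pi.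
Proof.
move=> S0; have T0 : (0 < #|T|)%N by rewrite card_T card_gt0.
rewrite (@moment_cumulant _ _ _ _ chi') // /BNC big_imset /=; last first.
  by move=> p1 p2 _ _; apply: imset_inj; apply: imset_inj; exact: s_chi_inj.
have inj := imset_inj pos_val_inj.
rewrite [RHS](reindex_onto (fun pi : {set {set 'I_#|T|}} => [set pos_val @: (V : {set _}) | V in pi])
  (fun pi => [set pos_val @^-1: (W : {set _}) | W in pi])) /=; last first.
  move=> pi /ncP[pP _]; rewrite -imset_comp -[RHS]imset_id; apply: eq_in_imset => W Wp /=.
  by rewrite pos_val_preim //; exact: partition_sub pP Wp.
apply: eq_big => [pi|pi _].
  rewrite inE nc_pos_val -imset_comp; set P := (_ == _); have -> : P = true; last by rewrite andbT.
  apply/eqP; rewrite -[RHS]imset_id; apply: eq_imset => V /=.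
  by apply/setP => j; rewrite inE mem_imset //; exact: pos_val_inj.
rewrite /relabel /kappa_prod !big_imset /=.
- apply: eq_bigr => V _; rewrite block_cumulant_val /pos_cumulant -!imset_comp.
  by congr block_cumulant; apply: eq_imset => j /=; exact: enum_val_s_chi.
- by move=> V W _ _ /inj.
- by move=> V W _ _ /(imset_inj (@s_chi_inj _ _)).
Qed.
End SubsetMoments.

(** * Sided words and alternating pieces *)

(* The first component is [true] for x and [false] for y, the second is [true]
   for the adjoint. *)
Notation letter := (bool * bool)%type.

Section LetterWords.
Implicit Types (w z : seq letter) (zs : seq (seq letter)).

Definition sided w := sorted (fun l l' : letter => l'.1 ==> l.1) w.

Definition alt w := Defs.alternating (map snd w).

Definition head_e w := head false (map snd w).
Definition last_e w := last false (map snd w).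

(* Consecutive elements of P_{i,j} share an index: the last exponent of a piece is
   the first exponent of the next one. *)
Definition chained zs := sorted (fun z z' => last_e z == head_e z') zs.

(** Sidedness of the concatenation unites the alternatives (a) and (b): the letters of x come first,
    and at most one piece has letters of both kinds. *)
Definition good_pieces zs :=
  [&& all (fun z => (z != [::]) && alt z) zs, chained zs & sided (flatten zs)].

Lemma side_trans : transitive (fun l l' : letter => l'.1 ==> l.1).
Proof. by case=> [[] ?] [[] ?] [[] ?]. Qed.

Lemma sided_subseq w w' : subseq w w' -> sided w' -> sided w.
Proof. by move=> ww'; apply: subseq_sorted ww'; exact: side_trans. Qed.

Lemma sided_cat_split w : sided w -> w = [seq l <- w | l.1] ++ [seq l <- w | ~~ l.1].
Proof.
rewrite /sided; elim: w => //= -[[] e] w IH /= wP.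
  by rewrite -IH //; exact: path_sorted wP.
have -> : [seq l <- w | l.1] = [::].
  have := order_path_min side_trans wP.
  by elim: (w) => //= -[[] d] v IHv /= // /IHv.
rewrite /=; congr (_ :: _); have := order_path_min side_trans wP.
by elim: (w) => //= -[[] d] v IHv /=// /IHv <-.
Qed.

Lemma sided_pairwise w : sided w = pairwise (fun l l' : letter => l'.1 ==> l.1) w.
Proof. by rewrite /sided sorted_pairwise //; exact: side_trans. Qed.

Lemma sided_cat u v : all fst u -> all (fun l : letter => ~~ l.1) v -> sided (u ++ v).
Proof.
move=> /allP uT /allP vF; rewrite sided_pairwise pairwise_cat; apply/and3P; split.
- by apply/allrelP => a b /uT -> _; rewrite implybT.
- elim: u uT => //= a u IH uT; rewrite IH ?andbT; last by move=> b bu; rewrite uT ?inE ?bu ?orbT.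
  by apply/allP => b _; rewrite (uT a) ?mem_head // implybT.
- elim: v vF => //= a v IH vF; rewrite IH ?andbT; last by move=> b bv; rewrite vF ?inE ?bv ?orbT.
  by apply/allP => b bv; move: (vF b); rewrite inE bv orbT => /(_ isT) /negPf ->.
Qed.

Lemma alt_last z : z != [::] -> alt z -> last_e z = head_e z (+) ~~ odd (size z).
Proof.
case: z => // -[b e] z _; rewrite /alt /last_e /head_e /=; elim: z b e => [|[b' e'] z IH] b e /=.
  by rewrite addbF.
by move=> /andP[ee' /IH] -> //; case: (odd (size z)) e e' ee' => [] [] [].
Qed.

(** Cut between any two letters with equal exponents: the pieces alternate, and the equality at each
    cut is chaining. *)
Lemma split_pieces w : w != [::] -> exists zs,
  [/\ flatten zs = w, all (fun z => (z != [::]) && alt z) zs & chained zs].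
Proof.
elim: w => // -[b e] [_ _|l w IH _]; first by exists [:: [:: (b, e)]].
have [[|z zs] [fl al ch]] := IH isT; first by [].
case: z fl al ch => [//|l' z] fl al ch; have [ll _] : l' = l /\ True by case: fl.
have [el|el] := eqVneq e l.2.
  exists ([:: (b, e)] :: (l' :: z) :: zs); split; first by rewrite /= -fl.
    by [].
  by rewrite -[chained _]/((e == l'.2) && chained ((l' :: z) :: zs)) ch ll el eqxx.
exists (((b, e) :: l' :: z) :: zs); split; first by rewrite /= -fl.
  by move: al; rewrite /= /alt /Defs.alternating /= ll => /andP[-> ->]; rewrite el.
by case: zs ch {fl al}.
Qed.
End LetterWords.

Section Evaluation.
Variables (C : numClosedFieldType) (A : starAlgType C).

Definition lev (x y : A) (l : letter) := expo (if l.1 then x else y) l.2.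
Definition wev (x y : A) (w : seq letter) := \prod_(l <- w) lev x y l.

(** Words of odd length belong to P_{1,1} or P_{2,2}, where no mean is subtracted. *)
Definition piece_mean (phi : A -> C) (x y : A) (z : seq letter) : C :=
  if odd (size z) then 0 else phi (wev x y z).

(** Statement (2) without indices: they are recovered from the first and last exponents of the
    pieces. *)
Definition pieces_vanish (phi : A -> C) (x y : A) :=
  forall zs, zs != [::] -> good_pieces zs ->
    phi (\prod_(z <- zs) (wev x y z - (piece_mean phi x y z)%:A)) = 0.

Lemma wev_cat x y w w' : wev x y (w ++ w') = wev x y w * wev x y w'.
Proof. by rewrite /wev big_cat. Qed.

Lemma wev_cons x y l w : wev x y (l :: w) = lev x y l * wev x y w.
Proof. by rewrite /wev big_cons. Qed.

Lemma wev_nil x y : wev x y [::] = 1.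
Proof. by rewrite /wev big_nil. Qed.
End Evaluation.

Section Presentations.

Definition letters (p : presentation) : seq letter :=
  [seq (true, e) | e <- p.1] ++ [seq (false, e) | e <- p.2].

Definition pres (z : seq letter) : presentation :=
  ([seq l.2 | l <- z & l.1], [seq l.2 | l <- z & ~~ l.1]).

Lemma pres_letters z : sided z -> letters (pres z) = z.
Proof.
move=> /sided_cat_split zE; rewrite [RHS]zE /letters /pres /=; congr (_ ++ _).
  by rewrite -map_comp; elim: (z) => //= -[[] e] v /= ->.
by rewrite -map_comp; elim: (z) => //= -[[] e] v /= ->.
Qed.

Lemma snd_letters p : map snd (letters p) = p.1 ++ p.2.
Proof. by rewrite /letters map_cat -!map_comp !map_id. Qed.

Definition index_of_sign (e : bool) : nat := if e then 1 else 2.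

(** For an alternating word, the first exponent and the parity of the length amount to the first and
    last exponents; the index [i] codes the first one and [j] the last. *)
Lemma in_P_piece i j p : in_P i j p =
  [&& letters p != [::], alt (letters p), i == index_of_sign (head_e (letters p))
    & j == index_of_sign (last_e (letters p))].
Proof.
have sz : size (letters p) = size (p.1 ++ p.2) by rewrite -snd_letters size_map.
rewrite /in_P /alt /head_e snd_letters; case al: (Defs.alternating _); last by rewrite andbF.
have [z0|zn] := eqVneq (letters p) [::].
  have -> : p.1 ++ p.2 = [::] by apply/nilP; rewrite /nilp -sz z0.
  by case: i j => [|[|[|i]]] [|[|[|j]]].
rewrite alt_last // -/(alt _); last by rewrite /alt snd_letters.
rewrite /head_e snd_letters sz; move: zn; rewrite -size_eq0 sz size_eq0.
case: (p.1 ++ p.2) => // e w _ /=.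
by case: i j => [|[|[|i]]] [|[|[|j]]] //=; case: e; case: w => [|e' w] //=; case: odd.
Qed.

Variables (C : numClosedFieldType) (A : starAlgType C) (phi : A -> C) (x y : A).

Lemma word_elt_letters p : word_elt x y p = wev x y (letters p).
Proof. by rewrite /word_elt /wev /letters big_cat !big_map. Qed.

Lemma P_elt_letters i j p : in_P i j p ->
  P_elt phi x y i j p = wev x y (letters p) - (piece_mean phi x y (letters p))%:A.
Proof.
rewrite in_P_piece /P_elt word_elt_letters => /and4P[zn za /eqP -> /eqP ->].
rewrite alt_last // /piece_mean; case: odd; case: (head_e _) => //=; by rewrite scale0r subr0.
Qed.
End Presentations.

Section SidedLetters.
Definition left_letters (w : seq (side * bool)) : seq letter :=
  [seq (true, c.2) | c <- w & Defs.is_left c.1].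

(** Reversed because right multiplication is an anti-representation: R(a)R(b) multiplies by ba on
    the right. This is also the order in which [s_chi] lists the right letters. *)
Definition right_letters (w : seq (side * bool)) : seq letter :=
  rev [seq (false, c.2) | c <- w & ~~ Defs.is_left c.1].

Definition sided_letters w := left_letters w ++ right_letters w.

Lemma sided_letters_sided w : sided (sided_letters w).
Proof.
apply: sided_cat; rewrite /left_letters /right_letters ?all_rev.
  by elim: w => //= c w IH; case: ifP.
by elim: w => //= c w IH; case: ifP.
Qed.

Lemma sided_letters_surj w : sided w -> exists w', sided_letters w' = w.
Proof.
move=> sd; pose l := [seq l <- w | l.1]; pose r := [seq l <- w | ~~ l.1].
exists ([seq (left_side, c.2) | c <- l] ++ rev [seq (right_side, c.2) | c <- r]).
rewrite /sided_letters /left_letters /right_letters [RHS](sided_cat_split sd) -/l -/r !filter_cat !map_cat rev_cat.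
rewrite !filter_rev !map_rev revK.
have El : [seq (true, c.2) | c <- [seq c <- [seq (left_side, c.2) | c <- l] | Defs.is_left c.1]] = l.
  rewrite /l; elim: (w) => //= -[[] e] v IH //=; by rewrite IH.
have Er : [seq (false, c.2) | c <- [seq c <- [seq (right_side, c.2) | c <- r] | ~~ Defs.is_left c.1]] = r.
  rewrite /r; elim: (w) => //= -[[] e] v IH //=; by rewrite IH.
have -> : [seq c <- [seq (right_side, c.2) | c <- r] | Defs.is_left c.1] = [::].
  by elim: (r).
have -> : [seq c <- [seq (left_side, c.2) | c <- l] | ~~ Defs.is_left c.1] = [::].
  by elim: (l).
by rewrite El Er cats0 /= cats0.
Qed.
End SidedLetters.

(** * Cumulants and products of centred pieces *)

Section EvenPieces.
Variables (m : nat) (e : 'I_m -> bool) (pi : {set {set 'I_m}}).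
Implicit Types (t : seq 'I_m) (ts : seq (seq 'I_m)) (V : {set 'I_m}).

Definition even_alternating V := ~~ odd #|V| && Defs.alternating [seq e p | p <- enum V].

Definition piece_index ts p := find (fun t : seq 'I_m => p \in t) ts.

Lemma sorted_piece_index ts : uniq (flatten ts) ->
  all (fun t => (t != [::]) && Defs.alternating [seq e p | p <- t]) ts ->
  sorted (fun t t' => last false [seq e p | p <- t] == head false [seq e p | p <- t']) ts ->
  sorted (piece_rel e (piece_index ts)) (flatten ts) /\
  sorted (fun p p' => piece_index ts p <= piece_index ts p')%N (flatten ts).
Proof.
elim: ts => // t ts IH; rewrite [flatten _]/(t ++ flatten ts) cat_uniq => /and3P[ut /hasPn disj uts].
rewrite [all _ _]/= => /andP[/andP[t0 at_] ats] ch.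
have [s1 s2] := IH uts ats (path_sorted ch).
set q := piece_index (t :: ts).
have q0 p : p \in t -> q p = 0 by move=> pt; rewrite /q /piece_index /= pt.
have q1 p : p \in flatten ts -> q p = (piece_index ts p).+1.
  by move=> pt; rewrite /q /piece_index /= (negPf (disj p pt)).
clearbody q; have inF : all (mem (flatten ts)) (flatten ts) by apply/allP.
have {}s1 : sorted (piece_rel e q) (flatten ts).
  apply: (sub_in_sorted _ inF s1) => p p' pt p't.
  by rewrite /piece_rel !q1 // eqSS.
have {}s2 : sorted (fun p p' => q p <= q p')%N (flatten ts).
  by apply: (sub_in_sorted _ inF s2) => p p' pt p't; rewrite !q1.
have inT : all (mem t) t by apply/allP.
have t1 : sorted (piece_rel e q) t.
  move: at_; rewrite /Defs.alternating sorted_map; apply: sub_in_sorted inT => p p' pt p't /= ee.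
  by rewrite /piece_rel ee !q0 ?eqxx.
have t2 : sorted (fun p p' => q p <= q p')%N t.
  apply: (@sub_in_sorted _ (mem t) (fun p p' => true)) inT _ => [p p' pt p't _|].
    by rewrite !q0.
  by case: (t) => //= p t'; elim: t' p => //=.
case: t t0 at_ ch q0 t1 t2 {inT ut disj} => // p t _ _ ch q0 t1 t2.
case: ts ats ch {uts inF IH} q1 s1 s2 => [|[|p' t'] ts] //.
  by move=> _ _ _ _ _; rewrite -/(cat t [::]) cats0.
move=> _ /= /andP[ee _] q1 s1 s2; rewrite -/(cat t (p' :: t' ++ flatten ts)).
rewrite /= in t1 t2 s1 s2 *; rewrite !cat_path t1 t2 /= s1 s2 !andbT.
have ql := q0 _ (mem_last p t); rewrite ql; split=> //.
rewrite /piece_rel ql q1 ?mem_head //; move: ee; rewrite (last_map e t p) => /eqP ->.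
by rewrite eqxx.
Qed.

Lemma piece_index_nth ts k p : uniq (flatten ts) -> (k < size ts)%N ->
  p \in nth [::] ts k -> piece_index ts p = k.
Proof.
elim: ts k => // t ts IH [|k] /=; first by rewrite /piece_index /= => _ _ ->.
rewrite cat_uniq => /and3P[_ /hasPn disj uts] kts pk; rewrite /piece_index /=.
have pf : p \in flatten ts by apply/flattenP; exists (nth [::] ts k); rewrite ?mem_nth.
by rewrite (negPf (disj p pf)); congr _.+1; exact: IH.
Qed.

Lemma mem_subseq_flatten ts t : t \in ts -> subseq t (flatten ts).
Proof.
elim: ts => // t' ts IH; rewrite inE => /predU1P[->|/IH sub]; first exact: prefix_subseq.
exact: subseq_trans sub (suffix_subseq _ _).
Qed.

Hypothesis ncpi : nc [set: _] pi.
Hypothesis good : forall V, V \in pi -> even_alternating V.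

Lemma pblock_noncrossing : noncrossing_seq (pblock pi) (enum 'I_m).
Proof.
have [pP cr] := ncP _ _ ncpi; have cov : cover pi = [set: _] by case/and3P: pP => /eqP.
move=> p1 p2 p3 p4 sub e13 e24.
have := sorted_enum [set: 'I_m]; rewrite enum_setT -enumT => srt.
have {}sub : subseq (map val [:: p1; p2; p3; p4]) (map val (enum 'I_m)) by exact: map_subseq.
have /and4P[l12 l23 l34 _] : sorted ltn (map val [:: p1; p2; p3; p4]).
  exact: subseq_sorted ltn_trans _ _ sub srt.
apply/eqP; apply/negPn/negP => ne.
have inb p : p \in pblock pi p by rewrite mem_pblock cov.
have bp p : pblock pi p \in pi by rewrite pblock_mem ?cov.
apply: (cr _ _ (bp p1) (bp p2) ne p1 p2 p3 p4) => //; first by rewrite e13.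
by rewrite e24.
Qed.

Lemma class_pblock l : ~~ odd (size (class (pblock pi) l (enum 'I_m))) &&
  sorted (fun p p' => e p != e p') (class (pblock pi) l (enum 'I_m)).
Proof.
have [pP _] := ncP _ _ ncpi; have /and3P[/eqP cov tr _] := pP.
have [lp|lp] := boolP (l \in pi); last first.
  rewrite class_nil // => p _; apply: contraNneq lp => <-.
  by rewrite pblock_mem ?cov.
have -> : class (pblock pi) l (enum 'I_m) = enum l.
  rewrite /class [RHS](_ : _ = [seq p <- enum 'I_m | p \in l]); last by rewrite enumT.
  apply: eq_filter => p; apply/eqP/idP => [<-|]; first by rewrite mem_pblock cov.
  exact: def_pblock.
by have := good lp; rewrite /even_alternating /Defs.alternating sorted_map cardE.
Qed.

(** The blocks serve as labels in [saturated_piece]. The piece found is a union of even blocks,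
    hence even. *)
Lemma saturated_even_piece ts : (0 < m)%N -> flatten ts = enum 'I_m ->
  all (fun t => (t != [::]) && Defs.alternating [seq e p | p <- t]) ts ->
  sorted (fun t t' => last false [seq e p | p <- t] == head false [seq e p | p <- t']) ts ->
  exists2 t, t \in ts & ~~ odd (size t) && sat [set p in t] pi.
Proof.
move=> m0 fl al ch; have uf : uniq (flatten ts) by rewrite fl enum_uniq.
have [s1 s2] := sorted_piece_index uf al ch; rewrite fl in s1 s2.
have en0 : enum 'I_m != [::] by rewrite -size_eq0 size_enum_ord -lt0n.
have [p0 _ p0P] := saturated_piece en0 s1 s2 pblock_noncrossing class_pblock.
have hp p : has (fun t : seq 'I_m => p \in t) ts.
  by apply/hasP; apply/flattenP; rewrite fl mem_enum.
pose t := nth [::] ts (piece_index ts p0).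
have tts : t \in ts by rewrite mem_nth // -has_find.
have inq p : (p \in t) = (piece_index ts p == piece_index ts p0).
  apply/idP/eqP => [pt|pq]; last by rewrite /t -pq; exact: (nth_find [::] (hp p)).
  by apply: piece_index_nth; rewrite // -has_find.
have [pP _] := ncP _ _ ncpi; have /and3P[/eqP cov tr _] := pP.
have st : sat [set p in t] pi.
  apply/forall_inP => V Vp; case: (pickP [pred p in V | p \in t]) => [p /andP[pV pt]|none].
    apply/orP; left; apply/subsetP => p' p'V; rewrite inE inq.
    apply/eqP/(p0P p); rewrite ?mem_enum //; first by apply/eqP; rewrite -inq.
    by rewrite (def_pblock tr Vp pV) (def_pblock tr Vp p'V).
  apply/orP; right; rewrite -setI_eq0; apply/eqP/setP => p; rewrite !inE.
  exact: none.
exists t => //; rewrite st andbT.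
have ut : uniq t by apply: subseq_uniq uf; exact: mem_subseq_flatten.
have -> : size t = #|[set p in t]| by rewrite cardsE; apply/esym/card_uniqP.
rewrite (card_partition (partition_restr (subsetT _) pP st)).
elim/big_ind: _ => // [a b|V]; first by rewrite oddD => /negPf -> /negPf ->.
by rewrite inE => /andP[Vp _]; have /andP[] := good Vp.
Qed.
End EvenPieces.

Section GoodWords.

Definition good_word m (chi : 'I_m -> side) (eps : 'I_m -> bool) : bool :=
  ~~ odd m && Defs.alternating [seq eps (s_chi chi j) | j <- enum 'I_m].

Lemma is_left_s_chi m (chi : 'I_m -> side) j : Defs.is_left (chi (s_chi chi j)) =
  (j < size [seq i <- enum 'I_m | Defs.is_left (chi i)])%N.
Proof.
rewrite /s_chi nth_cat; set l := [seq i <- _ | Defs.is_left _].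
have szl : (size l + size (rev [seq i <- enum 'I_m | ~~ Defs.is_left (chi i)]) = m)%N.
  by rewrite size_rev !size_filter count_predC size_enum_ord.
case: ifP => jl; first by have := mem_nth j jl; rewrite mem_filter => /andP[].
have : (j - size l < size (rev [seq i <- enum 'I_m | ~~ Defs.is_left (chi i)]))%N.
  by rewrite ltn_subLR ?szl // leqNgt jl.
by move=> /(mem_nth j); rewrite mem_rev mem_filter => /andP[/negPf].
Qed.

(** In the order [s_chi] the left letters come first, so [k] is their number. *)
Lemma good_wordP m (chi : 'I_m -> side) (eps : 'I_m -> bool) :
  (~~ odd m /\ exists k (omega : m.-tuple bool), [/\ (k <= m)%N, Defs.alternating omega &
     forall j : 'I_m, (chi (s_chi chi j), eps (s_chi chi j)) =
       (if (j < k)%N then left_side else right_side, tnth omega j)]) <->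
  good_word chi eps.
Proof.
split=> [[om [k [omega [_ al E]]]]|/andP[om al]].
  rewrite /good_word om; move: al; rewrite -{1}(map_tnth_enum omega).
  by under eq_map => j do have -> : tnth omega j = eps (s_chi chi j) by have [_ ->] := E j.
split=> //; exists (size [seq i <- enum 'I_m | Defs.is_left (chi i)]).
exists [tuple eps (s_chi chi j) | j < m]; split=> //.
  by rewrite -[leqRHS](size_enum_ord m) size_filter count_size.
by move=> j; rewrite tnth_mktuple -is_left_s_chi; case: (chi _).
Qed.

Lemma sided_letters_enum m (chi : 'I_m -> side) (eps : 'I_m -> bool) :
  sided_letters [seq (chi i, eps i) | i <- enum 'I_m] =
  [seq (Defs.is_left (chi (s_chi chi p)), eps (s_chi chi p)) | p <- enum 'I_m].
Proof.
rewrite [RHS](map_comp (fun i => (Defs.is_left (chi i), eps i)) (s_chi chi)) map_s_chi map_cat.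
rewrite /sided_letters /left_letters /right_letters !(filter_map (fun i => (chi i, eps i))).
rewrite -!map_comp map_rev; congr (_ ++ rev _).
  by apply/eq_in_map => i; rewrite mem_filter => /andP[/= ->].
by apply/eq_in_map => i; rewrite mem_filter => /andP[/= /negPf ->].
Qed.
End GoodWords.

(** * Centred moments as sums over partitions *)

Section CentredMoments.
Variables (C : numClosedFieldType) (A B : starAlgType C) (phi : {scalar A}) (Phi : B -> C).
Variables (x y : A) (X Y : B).
Hypothesis phi1 : phi 1 = 1.
Hypothesis momentE : forall w,
  Phi (\prod_(c <- w) pair_letter X Y c) = phi (wev x y (sided_letters w)).

Section Word.
Variables (m : nat) (chi : 'I_m -> side) (eps : 'I_m -> bool).
Implicit Types (t P : seq 'I_m) (ts : seq (seq 'I_m)) (S V : {set 'I_m}).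

Definition pos_letter p : letter := (Defs.is_left (chi (s_chi chi p)), eps (s_chi chi p)).

Local Notation kap := (pos_cumulant Phi chi (fun i => pair_letter X Y (chi i, eps i))).
Local Notation ev t := (wev x y (map pos_letter t)).

Lemma good_block V :
  good_word (fun i : 'I_#|s_chi chi @: V| => chi (enum_val i))
            (fun i : 'I_#|s_chi chi @: V| => eps (enum_val i)) =
  even_alternating (fun p => eps (s_chi chi p)) V.
Proof.
rewrite /good_word /even_alternating; congr (~~ odd _ && Defs.alternating _); first exact: card_T.
by rewrite -(map_pos_val chi V) -map_comp; apply: eq_map => j /=; rewrite enum_val_s_chi.
Qed.

Lemma sorted_enum_set t : sorted ltn (map val t) -> enum [set p in t] = t.
Proof.
move=> srt; apply: (inj_map val_inj).
apply: (irr_sorted_eq ltn_trans ltnn _ srt); first exact: sorted_enum.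
move=> k; apply/mapP/mapP => -[p]; rewrite ?mem_enum ?inE => pt ->; exists p => //.
by rewrite mem_enum inE.
Qed.

Lemma nc_set0 (pi : {set {set 'I_m}}) : nc set0 pi = (pi == set0).
Proof.
apply/ncP/eqP => [[pP _]|->].
  apply/setP => V; rewrite in_set0; apply/negP => Vp.
  have [a aV] := block_inhabited pP Vp.
  by have := subsetP (partition_sub pP Vp) a aV; rewrite in_set0.
split; last by move=> V W; rewrite inE.
apply/and3P; split; rewrite ?inE //; first by rewrite /cover big_set0.
by apply/trivIsetP => V W; rewrite inE.
Qed.

Lemma moment_sum t : sorted ltn (map val t) ->
  phi (ev t) = \sum_(pi | nc [set p in t] pi) kappa_prod kap pi.
Proof.
move=> srt; have [->|tn] := eqVneq t [::].
  rewrite wev_nil phi1 (big_pred1 set0) /kappa_prod ?big_set0 // => pi.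
  by rewrite /= -nc_set0; congr nc; apply/setP => p; rewrite !inE.
have S0 : [set p in t] != set0.
  by apply/set0Pn; case: t tn srt => // p t _ _; exists p; rewrite inE mem_head.
rewrite -(subset_moment Phi chi _ S0); set T := s_chi chi @: _.
rewrite -(big_map (fun i : 'I_#|T| => (chi (enum_val i), eps (enum_val i))) xpredT
  (pair_letter X Y)) momentE; congr (phi (wev x y _)).
rewrite -[index_enum _]enumT sided_letters_enum -{1}(sorted_enum_set srt).
rewrite -(map_pos_val chi) -map_comp; apply: eq_map => j /=.
by rewrite enum_val_s_chi.
Qed.

(** The indicator that no even piece in [ts] is a union of blocks of [pi]. *)
Definition unsat_weight ts (pi : {set {set 'I_m}}) : C :=
  \prod_(t <- ts) (if odd (size t) then 1 else (~~ sat [set p in t] pi)%:R).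

Lemma convex_in_cat P t u : sorted ltn (map val (P ++ t ++ u)) ->
  [disjoint [set p in t] & [set p in P ++ u]] /\ convex_in [set p in t] [set p in P ++ u].
Proof.
rewrite (sorted_pairwise ltn_trans) !map_cat !pairwise_cat !allrel_catr.
move=> /and3P[/andP[/allrelP Pt _] _ /and3P[/allrelP tu _ _]].
have {}Pt a b : a \in P -> b \in t -> (a < b)%N by move=> aP bt; apply: Pt; apply: map_f.
have {}tu a b : a \in t -> b \in u -> (a < b)%N by move=> aP bt; apply: tu; apply: map_f.
split.
  rewrite -setI_eq0; apply/eqP/setP => p; rewrite !inE mem_cat; apply/negP => /andP[pt /orP[pP|pu]].
    by have := Pt _ _ pP pt; rewrite ltnn.
  by have := tu _ _ pt pu; rewrite ltnn.
move=> a b c; rewrite !inE mem_cat => at_ /orP[bP|bu] ct ab bc.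
  by have := ltn_trans ab (Pt _ _ bP at_); rewrite ltnn.
by have := ltn_trans bc (tu _ _ ct bu); rewrite ltnn.
Qed.

(* Subtracting the mean of an even piece removes the partitions saturated by it. *)
Lemma centred_moment P ts : sorted ltn (map val (P ++ flatten ts)) ->
  phi (ev P * \prod_(t <- ts) (ev t - (piece_mean phi x y (map pos_letter t))%:A)) =
  \sum_(pi | nc [set p in P ++ flatten ts] pi) kappa_prod kap pi * unsat_weight ts pi.
Proof.
elim: ts P => [|t ts IH] P srt.
  rewrite /= cats0 in srt *; rewrite big_nil mulr1.
  by rewrite moment_sum //; apply: eq_bigr => pi _; rewrite /unsat_weight big_nil mulr1.
rewrite [flatten _]/(t ++ flatten ts) in srt *.
(* The word [t] joins the uncentred prefix [P], whereas its mean removes [t]; the induction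
   hypothesis applies to both terms. *)
rewrite big_cons mulrA mulrBr mulrBl -wev_cat -map_cat raddfB /= IH -?catA //.
rewrite -scalerAr mulr1 -scalerAl scalarZ IH; last first.
  apply: subseq_sorted ltn_trans _ _ _ srt; apply/map_subseq/cat_subseq => //.
  exact: suffix_subseq.
rewrite /piece_mean size_map; case: ifP => odt.
  rewrite mul0r subr0; apply: eq_bigr => pi _; congr (_ * _).
  by rewrite /unsat_weight big_cons odt mul1r.
have [dj cv] := convex_in_cat srt.
rewrite moment_sum; last first.
  by move: srt; rewrite !map_cat => /cat_sorted2[_ /cat_sorted2[]].
(* The product of the two sums runs over the partitions saturated by the interval [t], and cancels
   exactly those terms of the first sum. *)
rewrite -(nc_sum_split _ _ dj cv).
have -> : [set p in t] :|: [set p in P ++ flatten ts] = [set p in P ++ t ++ flatten ts].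
  by apply/setP => p; rewrite !inE !mem_cat orbCA.
rewrite [X in _ - X]big_mkcondr -sumrB; apply: eq_bigr => pi npi.
rewrite [unsat_weight (_ :: _) _]/unsat_weight big_cons odt -/(unsat_weight ts pi).
case: ifP => st; last by rewrite subr0 mul1r.
rewrite mul0r mulr0; apply/eqP; rewrite subr_eq0; apply/eqP; congr (_ * _).
rewrite /unsat_weight; apply: eq_big_seq => u uts; case: ifP => // _; congr (~~ _)%:R.
apply/esym/(sat_restr dj _ st).
  have [pP _] := ncP _ _ npi; rewrite (_ : _ :|: _ = [set p in P ++ t ++ flatten ts]) //.
  by apply/setP => p; rewrite !inE !mem_cat orbCA.
apply/subsetP => p; rewrite !inE mem_cat => pu; apply/orP; right.
by apply/flattenP; exists u.
Qed.

End Word.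
End CentredMoments.

(** * R-diagonality and the vanishing of centred products *)

Section Equivalence.
Variables (C : numClosedFieldType) (A B : starAlgType C) (phi : {scalar A}) (Phi : B -> C).
Variables (x y : A) (X Y : B).
Hypothesis phi1 : phi 1 = 1.
Hypothesis momentE : forall w,
  Phi (\prod_(c <- w) pair_letter X Y c) = phi (wev x y (sided_letters w)).

Section Pieces.
Variables (m : nat) (chi : 'I_m -> side) (eps : 'I_m -> bool) (zs : seq (seq letter)).
Hypothesis m0 : (0 < m)%N.
Hypothesis zsE : flatten zs = map (pos_letter chi eps) (enum 'I_m).
Hypothesis zs_good : good_pieces zs.

Local Notation kap := (pos_cumulant Phi chi (fun i => pair_letter X Y (chi i, eps i))).
Local Notation good := (even_alternating (fun p => eps (s_chi chi p))).

Definition pos_pieces := reshape (shape zs) (enum 'I_m).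

Lemma flatten_pos_pieces : flatten pos_pieces = enum 'I_m.
Proof.
by apply: reshapeKr; rewrite -size_flatten zsE size_map.
Qed.

Lemma map_pos_pieces : [seq map (pos_letter chi eps) t | t <- pos_pieces] = zs.
Proof. by rewrite map_reshape -zsE flattenK. Qed.

Lemma pos_pieces_sum :
  phi (\prod_(z <- zs) (wev x y z - (piece_mean phi x y z)%:A)) =
  \sum_(pi | nc [set: _] pi) kappa_prod kap pi * unsat_weight C pos_pieces pi.
Proof.
rewrite -[in LHS]map_pos_pieces big_map.
have := @centred_moment _ _ _ phi Phi x y X Y phi1 momentE _ chi eps [::] pos_pieces.
rewrite /= wev_nil mul1r flatten_pos_pieces => -> //.
  by apply: eq_bigl => pi; congr nc; apply/setP => p; rewrite !inE mem_enum.
by rewrite val_enum_ord iota_ltn_sorted.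
Qed.

Lemma map_pos_letter_snd t :
  map snd (map (pos_letter chi eps) t) = [seq eps (s_chi chi p) | p <- t].
Proof. by rewrite -map_comp. Qed.

Lemma pos_pieces_alt : all (fun t => (t != [::]) &&
  Defs.alternating [seq eps (s_chi chi p) | p <- t]) pos_pieces.
Proof.
have /and3P[al _ _] := zs_good; move: al; rewrite -{1}map_pos_pieces all_map.
apply: sub_all => t /=; rewrite /alt map_pos_letter_snd => /andP[t0 ->].
by rewrite andbT; apply: contraNneq t0 => ->.
Qed.

Lemma pos_pieces_chained : sorted (fun t t' =>
  last false [seq eps (s_chi chi p) | p <- t] ==
  head false [seq eps (s_chi chi p) | p <- t']) pos_pieces.
Proof.
have /and3P[_ ch _] := zs_good; move: ch; rewrite /chained -{1}map_pos_pieces sorted_map.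
by apply: sub_sorted => t t' /=; rewrite /last_e /head_e !map_pos_letter_snd.
Qed.

Lemma good_partition_weight pi : nc [set: _] pi -> (forall V, V \in pi -> good V) ->
  unsat_weight C pos_pieces pi = 0.
Proof.
move=> npi gpi.
have [t tts /andP[/negPf et st]] := saturated_even_piece npi gpi m0 flatten_pos_pieces
  pos_pieces_alt pos_pieces_chained.
by rewrite /unsat_weight (big_rem t) //= et st mul0r.
Qed.

(** The whole set fits into an even piece only if that piece is the entire word, which would then be
    even and alternating. *)
Lemma one_block_weight : ~~ good_word chi eps -> unsat_weight C pos_pieces [set [set: _]] = 1.
Proof.
move=> bad; rewrite /unsat_weight big1_seq // => t /= tts; case: ifP => // et.
suff -> : sat [set p in t] [set [set: _]] = false by [].
apply: contraNF bad => /forall_inP/(_ [set: _]); rewrite inE eqxx => /(_ isT).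
have := allP pos_pieces_alt t tts => /andP[t0 ta].
have -> : [disjoint [set: 'I_m] & [set p in t]] = false.
  rewrite -setI_eq0 setTI; apply/negbTE/set0Pn.
  by case: (t) t0 => // p t' _; exists p; rewrite inE mem_head.
rewrite orbF => /subsetP sub; have tE : t = enum 'I_m.
  have st := mem_subseq_flatten tts; rewrite flatten_pos_pieces in st.
  apply/eqP; rewrite -(size_subseq_leqif st) size_enum_ord.
  have := size_subseq st; rewrite size_enum_ord eqn_leq => -> /=.
  rewrite -[leqLHS](card_ord m) -cardsT.
  apply: leq_trans (card_size t); apply: subset_leq_card.
  by apply/subsetP => p /sub; rewrite inE.
by rewrite /good_word -tE ta andbT -(size_enum_ord m) -tE et.
Qed.
End Pieces.

Lemma block_cumulant_setT m (chi : 'I_m -> side) (eps : 'I_m -> bool) :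
  pos_cumulant Phi chi (fun i => pair_letter X Y (chi i, eps i)) [set: _] =
  cumulant Phi chi (fun i => pair_letter X Y (chi i, eps i)).
Proof.
have -> : pos_cumulant Phi chi (fun i => pair_letter X Y (chi i, eps i)) [set: _] =
    block_cumulant Phi chi (fun i => pair_letter X Y (chi i, eps i)) [set: _].
  congr block_cumulant; apply/eqP; rewrite eqEcard subsetT card_imset //=.
  exact: s_chi_inj.
rewrite /block_cumulant.
apply: (@cumulant_cast _ _ Phi _ _ _ enum_val chi (fun i => pair_letter X Y (chi i, eps i))).
  by rewrite cardsT card_ord.
move=> i; have ilt : (i < m)%N by case: i => i /=; rewrite cardsT card_ord.
by rewrite (enum_val_nth (Ordinal ilt)) enum_setT -enumT nth_enum_ord.
Qed.

Lemma R_diagonal_pieces : R_diagonal Phi X Y -> pieces_vanish phi x y.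
Proof.
move=> rd zs zs0 zsg.
have {}rd m (chi : 'I_m -> side) eps : ~~ good_word chi eps ->
    cumulant Phi chi (fun i => pair_letter X Y (chi i, eps i)) = 0.
  by move=> bad; apply: rd => /good_wordP; rewrite (negPf bad).
have /and3P[al _ sd] := zsg; have [w wE] := sided_letters_surj sd.
pose m := size w; pose chi i := (tnth (in_tuple w) i).1; pose eps i := (tnth (in_tuple w) i).2.
have zsE : flatten zs = map (pos_letter chi eps) (enum 'I_m).
  rewrite -wE -sided_letters_enum; congr sided_letters.
  rewrite -[LHS]/(val (in_tuple w)) -[LHS]map_tnth_enum; apply: eq_map => i.
  by rewrite -surjective_pairing.
have m0 : (0 < m)%N.
  rewrite -(size_enum_ord m) -(size_map (pos_letter chi eps)) -zsE.
  by case: (zs) zs0 al => // -[|? ?].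
rewrite (pos_pieces_sum zsE); apply: big1 => pi npi.
have [/forall_inP gpi|] := boolP [forall V in pi, even_alternating (fun p => eps (s_chi chi p)) V].
  by rewrite (good_partition_weight m0 zsE zsg npi gpi) mulr0.
rewrite negb_forall_in => /exists_inP[V Vp bad].
rewrite /kappa_prod (bigD1 V) //= [pos_cumulant _ _ _ V]rd ?mul0r //.
by rewrite good_block.
Qed.

Lemma pieces_R_diagonal : pieces_vanish phi x y -> R_diagonal Phi X Y.
Proof.
move=> pv m chi eps nd; have {nd} : ~~ good_word chi eps by apply/negP => /good_wordP.
elim/ltn_ind: m chi eps => m IH chi eps bad.
case: (posnP m) => [m0|m0]; first by case: m m0 {IH} chi eps bad.
set w := map (pos_letter chi eps) (enum 'I_m).
have w0 : w != [::] by rewrite -size_eq0 size_map size_enum_ord -lt0n.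
have [zs [zsE al ch]] := split_pieces w0.
have zsg : good_pieces zs.
  by apply/and3P; split; rewrite // zsE /w -sided_letters_enum sided_letters_sided.
have zs0 : zs != [::] by apply: contraNneq w0 => zs0; rewrite -zsE zs0.
have := pv _ zs0 zsg; rewrite (pos_pieces_sum zsE) (bigD1 [set [set: _]]) /=; last first.
  apply/(ncP [set: _]); split; last by move=> V W; rewrite !inE => /eqP -> /eqP ->; rewrite eqxx.
  apply/and3P; split; first by rewrite /cover big_set1.
    by apply/trivIsetP => V W; rewrite !inE => /eqP-> /eqP->; rewrite eqxx.
  by rewrite inE eq_sym -card_gt0 cardsT card_ord.
rewrite (one_block_weight zsE zsg bad) mulr1 /kappa_prod big_set1 block_cumulant_setT.
rewrite big1 ?addr0 // => pi /andP[npi piT].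
have [/forall_inP gpi|] := boolP [forall V in pi, even_alternating (fun p => eps (s_chi chi p)) V].
  by rewrite (good_partition_weight m0 zsE zsg npi gpi) mulr0.
rewrite negb_forall_in => /exists_inP[V Vp badV].
rewrite (bigD1 V) //= [pos_cumulant _ _ _ V]IH ?mul0r //.
  rewrite card_T; have [pP _] := ncP _ _ npi; exact: partition_block_card pP piT Vp.
by rewrite good_block.
Qed.
End Equivalence.

From mathcomp Require Import complex.
From mathcomp Require Import all_classical all_reals all_analysis.
From mathcomp Require Import ring lra.

Import numFieldNormedType.Exports.

Local Open Scope classical_set_scope.
Local Open Scope ring_scope.

(** * Completion of a pre-Hilbert space *)

(** The scalar core of the Cauchy-Schwarz inequality: the hypothesis is that [u + c v] has
    nonnegative square length, with [z] the inner product of [u] and [v]. The case [b = 0] occurs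
    because forms may be degenerate. *)
Lemma discriminant_le (C : numClosedFieldType) (a b z : C) :
  0 <= b -> (forall c, 0 <= a + c^* * z + c * z^* + `|c| ^+ 2 * b) ->
  `|z| ^+ 2 <= a * b.
Proof.
move=> b0 H; have a0 : 0 <= a.
  by have := H 0; rewrite conjC0 normr0 expr0n /= !mul0r !addr0.
have [bz|bn] := eqVneq b 0.
  subst b; rewrite mulr0; apply/negP => /negP zn.
  have z0 : 0 < `|z| ^+ 2.
    by rewrite lt_def exprn_ge0 // andbT; apply: contra zn => /eqP->.
  (* With [b = 0] nothing quadratic in [c] remains; this multiple of [z] brings the expression down
     to [- (a + 2)], which is negative. *)
  have t0 : 0 <= (a + 1) / `|z| ^+ 2 by rewrite divr_ge0 ?(ltW z0) // addr_ge0.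
  have := H (- ((a + 1) / `|z| ^+ 2) * z).
  rewrite rmorphM rmorphN /= (geC0_conj t0) mulr0 addr0.
  rewrite -[_ * z^* * z]mulrA [z^* * z]mulrC -[_ * z * z^*]mulrA -!normCK.
  rewrite !mulNr divfK ?gt_eqF // => h.
  have : a + - (a + 1) + - (a + 1) < 0.
    have -> : a + - (a + 1) + - (a + 1) = - (a + 2) by ring.
    by rewrite oppr_lt0 ltr_wpDl.
  by move=> /(le_lt_trans h); rewrite ltxx.
have bp : 0 < b by rewrite lt_def bn.
(* The minimiser of the quadratic expression in [c]. *)
have := H (- b^-1 * z).
have bi : 0 <= b^-1 by rewrite invr_ge0.
rewrite normrM normrN (ger0_norm bi) rmorphM rmorphN /= (geC0_conj bi).
rewrite -[_ * z^* * z]mulrA [z^* * z]mulrC -[_ * z * z^*]mulrA -!normCK.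
set Z := `|z| ^+ 2 => h.
have {}h : 0 <= a - b^-1 * Z.
  apply: le_trans h _; rewrite exprMn -/Z.
  by rewrite le_eqVlt; apply/orP; left; apply/eqP; field.
by move: h; rewrite subr_ge0 mulrC ler_pdivrMr.
Qed.

Section ComplexLimits.
Variable R : realType.
Local Notation C := R[i].

Lemma eps_eq0 (a M : C) : 0 <= a -> 0 <= M ->
  (forall e, 0 < e -> e <= 1 -> a <= M * e) -> a = 0.
Proof.
move=> a0 M0 H; apply/eqP; apply/negP => /negP an.
have ap : 0 < a by rewrite lt_def an.
have M1 : 0 < M + 1 by rewrite ltr_wpDl.
have a1 : 0 < a + 1 by rewrite ltr_wpDl.
have Ma : 0 < (M + 1) * (a + 1) by rewrite mulr_gt0.
have le1 : a / ((M + 1) * (a + 1)) <= 1.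
  rewrite ler_pdivrMr // mul1r mulrDl mul1r -[leLHS]add0r.
  by rewrite lerD ?mulr_ge0 ?(ltW a1) // lerDl.
have := H (a / ((M + 1) * (a + 1))) (divr_gt0 ap Ma) le1.
rewrite mulrA ler_pdivlMr // [M * a]mulrC ler_pM2l // mulrDl mul1r mulrDr mulr1.
rewrite -addrA addrCA gerDl => h.
have : M * a + (a + 1) <= 0 by [].
by move=> /(lt_le_trans (ltr_wpDl (mulr_ge0 M0 a0) a1)); rewrite ltxx.
Qed.

Lemma eps_eq (a b M : C) :
  0 <= M -> (forall e, 0 < e -> e <= 1 -> `|a - b| <= M * e) -> a = b.
Proof. by move=> M0 H; apply/subr0_eq/normr0_eq0; apply: eps_eq0 H. Qed.

Lemma eps_le (a b M : C) : a \is Num.real -> b \is Num.real ->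
  0 <= M -> (forall e, 0 < e -> e <= 1 -> a <= b + M * e) -> a <= b.
Proof.
move=> ar br M0 H; rewrite real_leNgt //; apply/negP => ab.
have ab0 : 0 < a - b by rewrite subr_gt0.
suff ab' : a - b = 0 by rewrite ab' ltxx in ab0.
by apply: eps_eq0 (ltW ab0) M0 _ => e e0 e1; rewrite lerBlDl H.
Qed.

Lemma eps_ge0 (a M : C) : 0 <= M ->
  (forall e, 0 < e -> e <= 1 -> exists2 q, 0 <= q & `|a - q| <= M * e) -> 0 <= a.
Proof.
move=> M0 H; have ar : a \is Num.real.
  rewrite CrealE; apply/eqP; apply: (@eps_eq _ _ (M * 2)); first by rewrite mulr_ge0.
  move=> e e0 e1; have [q q0 aq] := H e e0 e1.
  have -> : a^* - a = (a - q)^* - (a - q).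
    by rewrite rmorphB /= (geC0_conj q0); ring.
  rewrite (le_trans (ler_normB _ _)) // norm_conjC.
  by rewrite mulrAC mulr_natr mulr2n lerD.
apply: (@eps_le _ _ M) => // e e0 e1; have [q q0 aq] := H e e0 e1.
have {}aq : `|q - a| <= M * e by rewrite distrC.
have qa : q - a <= M * e.
  by apply: le_trans aq; apply: real_ler_norm; rewrite realB // ger0_real.
by rewrite (le_trans q0) // -lerBlDl.
Qed.

(** [P e c] reads: [c] is within [e] of the value sought. That value is the supremum of the lower
    bounds [c - e]. *)
Let real_limit (P : R -> R -> Prop) :
  (forall e, 0 < e -> exists c, P e c) ->
  (forall e e' c c', 0 < e -> 0 < e' -> P e c -> P e' c' -> `|c - c'| <= e + e') ->
  exists c, forall e c', 0 < e -> P e c' -> `|c' - c| <= e.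
Proof.
move=> ex cau.
pose S := [set r | exists e c, [/\ 0 < e, P e c & r = c - e]].
have [c1 Pc1] := ex 1 ltr01.
have ub e c : 0 < e -> P e c -> ubound S (c + e).
  move=> e0 Pc _ [e' [c' [e'0 Pc' ->]]]; have := cau _ _ _ _ e'0 e0 Pc' Pc.
  by rewrite ler_distl => /andP[_]; lra.
exists (sup S) => e c e0 Pc; rewrite ler_distl; apply/andP; split.
  rewrite lerBlDr; apply: ge_sup; last exact: ub.
  by exists (c1 - 1), 1, c1.
rewrite -lerBlDr.
apply: ub_le_sup; first by exists (c + e); exact: ub.
by exists e, c.
Qed.

Lemma complex_limit (P : C -> C -> Prop) :
  (forall e, 0 < e -> exists c, P e c) ->
  (forall e e' c c', 0 < e -> 0 < e' -> P e c -> P e' c' -> `|c - c'| <= e + e') ->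
  exists c, forall e c', 0 < e -> P e c' -> `|c' - c| <= e.
Proof.
move=> ex cau.
have lim (f : C -> R) : {morph f : z w / z - w} -> (forall z, `|f z|%:C%C <= `|z|) ->
    exists r, forall e c', 0 < e -> P e%:C%C c' -> `|f c' - r| <= e.
  move=> fB fle; have [| |r rP] := @real_limit (fun e r => exists2 c, P e%:C%C c & r = f c).
  - by move=> e e0; have [|c Pc] := ex e%:C%C; [rewrite ltcR | exists (f c), c].
  - move=> e e' _ _ e0 e'0 [c Pc ->] [c' Pc' ->].
    rewrite -fB -lecR (le_trans (fle _)) // rmorphD /=.
    by apply: (cau _ _ _ _ _ _ Pc Pc'); rewrite ltcR.
  by exists r => e c' e0 Pc'; apply: rP => //; exists c'.
have reB : {morph @complex.Re R : z w / z - w} by case=> a b [c d].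
have imB : {morph @complex.Im R : z w / z - w} by case=> a b [c d].
have [r rP] := lim (@complex.Re R) reB (@normc_ge_Re R).
have imle (z : C) : `|complex.Im z|%:C%C <= `|z|.
  by rewrite normc_def lecR -sqrtr_sqr ler_wsqrtr // lerDr sqr_ge0.
have [i iP] := lim (@complex.Im R) imB imle.
exists (r +i* i)%C => e c e0 Pc.
have er : e \is Num.real by rewrite gtr0_real.
apply: (@eps_le _ _ 3%:R) => // e' e'0 _.
have e'E : e' = (complex.Re e')%:C%C by rewrite RRe_real // gtr0_real.
have e'r : 0 < complex.Re e' by rewrite -ltcR -e'E.
have [c' Pc'] := ex _ e'0.
have cc' := cau _ _ _ _ e0 e'0 Pc Pc'.
rewrite (_ : c - _ = c - c' + (c' - (r +i* i)%C)); last by rewrite addrA subrK.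
have Pc'' := Pc'; rewrite e'E in Pc''.
have h : `|c' - (r +i* i)%C| <= e' + e'.
  case: (c') (rP _ _ e'r Pc'') (iP _ _ e'r Pc'') => /= a b ra ib.
  have -> : (a +i* b)%C - (r +i* i)%C = (a - r)%:C%C + 'i%C * (b - i)%:C%C.
    by apply/eqP; rewrite eq_complex /=; apply/andP; split; apply/eqP; ring.
  have ni : `|'i%C : C| = 1 by rewrite normc_def /= expr0n expr1n add0r sqrtr1.
  have nreal (x : R) : `|x%:C%C| = `|x|%:C%C.
    by rewrite normc_def /= expr0n addr0 sqrtr_sqr.
  rewrite (le_trans (ler_normD _ _)) // normrM ni mul1r !nreal.
  by rewrite e'E lerD // lecR.
have -> : e + 3%:R * e' = (e + e') + (e' + e') by ring.
by rewrite (le_trans (ler_normD _ _)) // lerD.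
Qed.

End ComplexLimits.

(** Weaker than a space with an inner product, so that formal sums of words with a degenerate form
    are an instance; the completion identifies vectors that have the same inner products. *)
Record preHilbert (R : realType) := PreHilbert {
  pre_sort :> Type;
  pre_add : pre_sort -> pre_sort -> pre_sort;
  pre_scale : R[i] -> pre_sort -> pre_sort;
  pre_unit : pre_sort;
  sform : pre_sort -> pre_sort -> R[i];
  sformDl : forall u v w, sform (pre_add u v) w = sform u w + sform v w;
  sformZl : forall c u w, sform (pre_scale c u) w = c * sform u w;
  sformC : forall u v, sform u v = (sform v u)^*;
  sform_ge0 : forall u, 0 <= sform u u;
  sform_unit : sform pre_unit pre_unit != 0
}.

Section Completion.
Variables (R : realType) (E : preHilbert R).
Local Notation C := R[i].
Local Notation "u ++ v" := (pre_add u v).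
Local Notation "c ** u" := (pre_scale c u) (at level 40).
Implicit Types (u v w : E) (c e : C).

Lemma sformDr u v w : sform u (v ++ w) = sform u v + sform u w.
Proof. by rewrite sformC sformDl rmorphD /= -!sformC. Qed.

Lemma sformZr c u w : sform u (c ** w) = c^* * sform u w.
Proof. by rewrite sformC sformZl rmorphM /= -sformC. Qed.

Definition seminorm v : C := sqrtC (sform v v).

Lemma seminorm_ge0 v : 0 <= seminorm v.
Proof. by rewrite sqrtC_ge0 sform_ge0. Qed.

Lemma sqr_seminorm v : seminorm v ^+ 2 = sform v v.
Proof. exact: sqrtCK. Qed.

Lemma sform_CauchySchwarz u v : `|sform u v| <= seminorm u * seminorm v.
Proof.
rewrite -(@ler_pXn2r _ 2) ?nnegrE ?mulr_ge0 ?seminorm_ge0 // exprMn !sqr_seminorm.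
apply: discriminant_le => [|c]; first exact: sform_ge0.
have := sform_ge0 (u ++ c ** v).
rewrite !sformDl !sformDr !sformZl !sformZr normCK -(sformC v u).
by congr (_ <= _); ring.
Qed.

Definition approximates (f : E -> C) v e := forall w, `|f w - sform v w| <= e * seminorm w.

(* A vector f of the completion is encoded by the function [fun w => <f, w>]. *)
Definition completion_pred : {pred E -> C^o} :=
  fun f => `[< forall e, 0 < e -> exists v, approximates f v e >].

Lemma completion_predP (f : E -> C^o) :
  reflect (forall e, 0 < e -> exists v, approximates f v e) (f \in completion_pred).
Proof. exact: asboolP. Qed.

Lemma approxD f g u v e d : approximates f u e -> approximates g v d ->
  approximates (fun w => f w + g w) (u ++ v) (e + d).
Proof.
move=> fu gv w; rewrite sformDl opprD addrACA mulrDl.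
by rewrite (le_trans (ler_normD _ _)) // lerD.
Qed.

Lemma approxZ f u e c : approximates f u e -> approximates (fun w => c * f w) (c ** u) (`|c| * e).
Proof. by move=> fu w; rewrite sformZl -mulrBr normrM -mulrA ler_wpM2l. Qed.

Lemma approx_form v e : 0 < e -> approximates (sform v) v e.
Proof. by move=> e0 w; rewrite subrr normr0 mulr_ge0 ?(ltW e0) ?seminorm_ge0. Qed.

Lemma completion_submod : submod_closed completion_pred.
Proof.
split.
  apply/completion_predP => e e0; exists (0 ** pre_unit E) => w.
  by rewrite sformZl mul0r subrr normr0 mulr_ge0 ?(ltW e0) ?seminorm_ge0.
move=> c f g /completion_predP fK /completion_predP gK; apply/completion_predP => e e0.
have c0 : 0 < `|c| + 1 by rewrite ltr_wpDl.
have d0 : 0 < e / 2 / (`|c| + 1) by rewrite !divr_gt0.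
have [u fu] := fK _ d0; have [v gv] := gK _ (divr_gt0 e0 (ltr0n _ 2)).
exists (c ** u ++ v) => w; have := approxD (approxZ c fu) gv w.
move=> /le_trans -> //; rewrite ler_wpM2r ?seminorm_ge0 //.
rewrite [leRHS]splitr lerD // mulrA ler_pdivrMr // mulrC ler_wpM2l ?lerDl //.
by rewrite ltW ?divr_gt0.
Qed.
HB.instance Definition _ :=
  GRing.isSubmodClosed.Build C (E -> C^o) completion_pred completion_submod.

Record completion := Completion {
  completion_fun : E -> C^o;
  _ : completion_fun \in completion_pred
}.
HB.instance Definition _ := [isSub for completion_fun].
HB.instance Definition _ := [Choice of completion by <:].
HB.instance Definition _ := [SubChoice_isSubLmodule of completion by <:].
Definition completion_app (f : completion) (v : E) : C := completion_fun f v.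
Coercion completion_app : completion >-> Funclass.

Implicit Types f g h : completion.

Lemma completion_ext f g : (forall w, f w = g w) -> f = g.
Proof. by move=> fg; apply/val_inj/funext. Qed.

Lemma completionP f e : 0 < e -> exists v, approximates f v e.
Proof. by have /completion_predP := valP f; apply. Qed.

Lemma mk_completion (f : E -> C) :
  (forall e, 0 < e -> exists v, approximates f v e) -> {g : completion | g =1 f :> (E -> C)}.
Proof. by move=> /completion_predP fK; exists (Completion fK). Qed.

Definition bounded_by (f : E -> C) M := 0 <= M /\ forall w, `|f w| <= M * seminorm w.

Lemma approx_bounded (f : E -> C) v e :
  0 <= e -> approximates f v e -> bounded_by f (seminorm v + e).
Proof.
move=> e0 fv; split=> [|w]; first by rewrite addr_ge0 ?seminorm_ge0.
rewrite -[f w](subrK (sform v w)) addrC mulrDl.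
by rewrite (le_trans (ler_normD _ _)) // lerD // sform_CauchySchwarz.
Qed.

Lemma completion_bounded f : exists M, bounded_by f M.
Proof.
have [v fv] := completionP f ltr01.
by exists (seminorm v + 1); exact: approx_bounded.
Qed.

Lemma completionD f u v : f (u ++ v) = f u + f v.
Proof.
apply: (@eps_eq _ _ _ (seminorm (u ++ v) + seminorm u + seminorm v)).
  by rewrite !addr_ge0 ?seminorm_ge0.
move=> e e0 _; have [z fz] := completionP f e0.
rewrite [X in `|X|](_ : _ = (f (u ++ v) - sform z (u ++ v)) + - (f u - sform z u)
    + - (f v - sform z v)); last by rewrite sformDr; ring.
rewrite [leRHS]mulrC !mulrDr (le_trans (ler_normD _ _)) // lerD ?normrN //.
by rewrite (le_trans (ler_normD _ _)) // lerD ?normrN.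
Qed.

Lemma completionZ f c u : f (c ** u) = c^* * f u.
Proof.
apply: (@eps_eq _ _ _ (seminorm (c ** u) + `|c| * seminorm u)).
  by rewrite !addr_ge0 ?mulr_ge0 ?seminorm_ge0.
move=> e e0 _; have [z fz] := completionP f e0.
rewrite [X in `|X|](_ : _ = (f (c ** u) - sform z (c ** u)) + - (c^* * (f u - sform z u)));
  last by rewrite sformZr; ring.
rewrite [leRHS]mulrC [leRHS]mulrDr (le_trans (ler_normD _ _)) // lerD //.
by rewrite normrN normrM norm_conjC mulrCA ler_wpM2l.
Qed.

Lemma seminormB_approx f u v d e : 0 < d -> 0 < e ->
  approximates f u d -> approximates f v e -> seminorm (u ++ (- 1) ** v) <= d + e.
Proof.
move=> d0 e0 fu fv; set z := u ++ _.
have : sform z z <= (d + e) * seminorm z.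
  rewrite -[sform z z]ger0_norm ?sform_ge0 // {1}/z sformDl sformZl mulN1r.
  rewrite (_ : _ - _ = (f z - sform v z) - (f z - sform u z)); last by ring.
  by rewrite (le_trans (ler_normB _ _)) // addrC mulrDl lerD.
rewrite -sqr_seminorm expr2; have [->|zn] := eqVneq (seminorm z) 0.
  by move=> _; rewrite addr_ge0 ?ltW.
by rewrite ler_pM2r // lt_def zn seminorm_ge0.
Qed.

(** The inner product is the limit of [f v] as [v] approximates [g]. Boundedness of [f] makes these
    values Cauchy and gives the linear rate [M]. *)
Lemma inner_ex f g : exists c, exists2 M, 0 <= M &
  forall e v, 0 < e -> approximates g v e -> `|f v - c| <= M * e.
Proof.
have [M [M0 fM]] := completion_bounded f.
have M1 : 0 < M + 1 by rewrite ltr_wpDl.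
have fB u v : f u - f v = f (u ++ (- 1) ** v).
  by rewrite completionD completionZ rmorphN1 mulN1r.
pose P e c := exists v, approximates g v (e / (M + 1)) /\ c = f v.
have [| |c cP] := @complex_limit _ P.
- move=> e e0; have [v gv] := completionP g (divr_gt0 e0 M1).
  by exists (f v), v.
- move=> e e' _ _ e0 e'0 [u [gu ->]] [v [gv ->]]; rewrite fB (le_trans (fM _)) //.
  have := seminormB_approx (divr_gt0 e0 M1) (divr_gt0 e'0 M1) gu gv.
  rewrite -mulrDl ler_pdivlMr // mulrDr mulr1 => h.
  by rewrite mulrC (le_trans _ h) // lerDl seminorm_ge0.
exists c, (M + 1); first exact: ltW.
move=> e v e0 gv; apply: cP; first by rewrite mulr_gt0.
by exists v; split=> //; rewrite mulrC mulKf ?gt_eqF.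
Qed.

Definition completion_inner f g : C := projT1 (cid (inner_ex f g)).
Local Notation "'[ f , g ]" := (completion_inner f g).

Lemma completion_innerP f g : exists2 M, 0 <= M &
  forall e v, 0 < e -> approximates g v e -> `|f v - '[f, g]| <= M * e.
Proof. exact: projT2 (cid (inner_ex f g)). Qed.

Lemma seminorm_approx (f : E -> C) v e M :
  0 <= e -> bounded_by f M -> approximates f v e -> seminorm v <= M + e.
Proof.
move=> e0 [M0 fM] fv; have [->|zn] := eqVneq (seminorm v) 0; first by rewrite addr_ge0.
have : sform v v <= (M + e) * seminorm v.
  rewrite -[sform v v]ger0_norm ?sform_ge0 //.
  rewrite [X in `|X|](_ : _ = f v - (f v - sform v v)); last by ring.
  by rewrite (le_trans (ler_normB _ _)) // mulrDl lerD.
by rewrite -sqr_seminorm expr2 ler_pM2r // lt_def zn seminorm_ge0.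
Qed.

Lemma completion_innerC f g : '[f, g] = '[g, f]^*.
Proof.
have [M M0 fP] := completion_innerP f g; have [N N0 gP] := completion_innerP g f.
have [K gK] := completion_bounded g; have [L fL] := completion_bounded f.
have [K0 _] := gK; have [L0 _] := fL.
apply: (@eps_eq _ _ _ (M + (K + 1) + (L + 1) + N)); first by rewrite !addr_ge0.
move=> e e0 e1.
have [v fv] := completionP f e0; have [w gw] := completionP g e0.
rewrite [X in `|X|](_ : _ = - (f w - '[f, g]) + (f w - sform v w) +
  - (g v - sform w v)^* + (g v - '[g, f])^*); last by rewrite !rmorphB /= -(sformC v w); ring.
have nK : seminorm w <= K + 1.
  by rewrite (le_trans (seminorm_approx (ltW e0) gK gw)) // lerD.
have nL : seminorm v <= L + 1.
  by rewrite (le_trans (seminorm_approx (ltW e0) fL fv)) // lerD.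
rewrite mulrDl (le_trans (ler_normD _ _)) // lerD //.
  rewrite mulrDl (le_trans (ler_normD _ _)) // lerD //.
    rewrite mulrDl (le_trans (ler_normD _ _)) // lerD //.
      by rewrite normrN fP.
    by rewrite (le_trans (fv w)) // mulrC ler_wpM2r // ltW.
  by rewrite normrN norm_conjC (le_trans (gw v)) // mulrC ler_wpM2r // ltW.
by rewrite norm_conjC gP.
Qed.

Lemma completion_inner_linear h : linear_for *%R (completion_inner ^~ h).
Proof.
move=> c f g; have [M M0 fP] := completion_innerP f h.
have [N N0 gP] := completion_innerP g h.
have [K K0 fgP] := completion_innerP (c *: f + g) h.
apply: (@eps_eq _ _ _ (K + (`|c| * M + N))); first by rewrite !addr_ge0 ?mulr_ge0.
move=> e e0 _; have [v hv] := completionP h e0.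
have fgE : (c *: f + g) v = c * f v + g v by [].
rewrite [X in `|X|](_ : _ = - ((c *: f + g) v - '[c *: f + g, h]) +
  (c * (f v - '[f, h]) + (g v - '[g, h]))); last by rewrite fgE; ring.
rewrite !mulrDl (le_trans (ler_normD _ _)) // lerD ?normrN ?fgP //.
by rewrite (le_trans (ler_normD _ _)) // lerD ?gP // normrM -mulrA ler_wpM2l ?fP.
Qed.

Lemma completion_inner_ge0 f : 0 <= '[f, f].
Proof.
have [M M0 fP] := completion_innerP f f; have [K fK] := completion_bounded f.
have [K0 _] := fK.
apply: (@eps_ge0 _ _ (M + (K + 1))); first by rewrite !addr_ge0.
move=> e e0 e1; have [v fv] := completionP f e0.
have nK : seminorm v <= K + 1.
  by rewrite (le_trans (seminorm_approx (ltW e0) fK fv)) // lerD.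
exists (sform v v); first exact: sform_ge0.
rewrite [X in `|X|](_ : _ = - (f v - '[f, f]) + (f v - sform v v)); last by ring.
rewrite mulrDl (le_trans (ler_normD _ _)) // lerD ?normrN ?fP //.
by rewrite (le_trans (fv v)) // mulrC ler_wpM2r // ltW.
Qed.

Lemma embed_subproof v e : 0 < e -> exists w, approximates (sform v) w e.
Proof. by move=> e0; exists v; exact: approx_form. Qed.

Definition embed v : completion := projT1 (mk_completion (embed_subproof v)).

Lemma embedE v w : embed v w = sform v w.
Proof. exact: (projT2 (mk_completion (embed_subproof v))). Qed.

Lemma approx_embed v e : 0 < e -> approximates (embed v) v e.
Proof. by move=> e0 w; rewrite embedE; exact: approx_form. Qed.

Lemma completion_inner_embed f v : '[f, embed v] = f v.
Proof.
have [M M0 fP] := completion_innerP f (embed v).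
by apply/esym/(eps_eq M0) => e e0 _; apply: fP (approx_embed _ _).
Qed.

Lemma completion_inner_bound f M : bounded_by f M -> '[f, f] <= M ^+ 2.
Proof.
move=> fM; have [M0 fMw] := fM; have [N N0 fP] := completion_innerP f f.
apply: (@eps_le _ _ _ (M + N)); rewrite ?ger0_real ?exprn_ge0 ?addr_ge0 //.
  exact: completion_inner_ge0.
move=> e e0 _; have [v fv] := completionP f e0.
rewrite -['[f, f]]ger0_norm ?completion_inner_ge0 //.
rewrite [X in `|X|](_ : _ = f v - (f v - '[f, f])); last by ring.
rewrite (le_trans (ler_normB _ _)) // mulrDl addrA lerD ?fP // expr2 -mulrDr.
by rewrite (le_trans (fMw v)) // ler_wpM2l // (seminorm_approx (ltW e0) fM fv).
Qed.

Lemma completion_CauchySchwarz f g : `|'[f, g]| ^+ 2 <= '[f, f] * '[g, g].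
Proof.
apply: discriminant_le => [|c]; first exact: completion_inner_ge0.
have := completion_inner_ge0 (c *: g + f).
rewrite !completion_inner_linear ![in '[_, c *: g + f]]completion_innerC.
rewrite !completion_inner_linear !rmorphD !rmorphM /= -!completion_innerC normCK.
by rewrite (completion_innerC g f); congr (_ <= _); ring.
Qed.
End Completion.

Section CompletionHilbert.
Variables (R : realType) (E : preHilbert R).
Local Notation C := R[i].
Local Notation K := (completion E).
Implicit Types (u v w : E) (c e : C) (f g h : K).
Local Notation "'[ f , g ]" := (completion_inner f g).

Definition completion_norm f : C := sqrtC '[f, f].

Lemma completion_norm_ge0 f : 0 <= completion_norm f.
Proof. by rewrite sqrtC_ge0 completion_inner_ge0. Qed.

Lemma completion_normK f : completion_norm f ^+ 2 = '[f, f].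
Proof. exact: sqrtCK. Qed.

Lemma inner_le_norm f g : `|'[f, g]| <= completion_norm f * completion_norm g.
Proof.
rewrite -(@ler_pXn2r _ 2) ?nnegrE ?mulr_ge0 ?completion_norm_ge0 //.
by rewrite exprMn !completion_normK completion_CauchySchwarz.
Qed.

Lemma completion_innerDl f g h : '[f + g, h] = '[f, h] + '[g, h].
Proof. by have := completion_inner_linear h 1 f g; rewrite scale1r mul1r. Qed.

Lemma completion_inner0l h : '[0, h] = 0.
Proof. by apply: (@addrI _ '[0, h]); rewrite -completion_innerDl !addr0. Qed.

Lemma completion_innerZl c f h : '[c *: f, h] = c * '[f, h].
Proof.
by rewrite -[c *: f]addr0 completion_inner_linear completion_inner0l addr0.
Qed.

Lemma completion_innerDr f g h : '[f, g + h] = '[f, g] + '[f, h].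
Proof. by rewrite completion_innerC completion_innerDl rmorphD /= -!completion_innerC. Qed.

Lemma completion_innerZr c f h : '[f, c *: h] = c^* * '[f, h].
Proof. by rewrite completion_innerC completion_innerZl rmorphM /= -completion_innerC. Qed.

Lemma completion_normD f g :
  completion_norm (f + g) <= completion_norm f + completion_norm g.
Proof.
rewrite -(@ler_pXn2r _ 2) ?nnegrE ?addr_ge0 ?completion_norm_ge0 //.
rewrite sqrrD !completion_normK completion_innerDl !completion_innerDr.
rewrite addrA lerD2r -!addrA lerD2l (completion_innerC g f).
have h := inner_le_norm f g; set z := '[f, g] in h *.
have zr : z + z^* \is Num.real by rewrite CrealE rmorphD /= conjCK addrC.
rewrite (le_trans (real_ler_norm zr)) // (le_trans (ler_normD _ _)) //.
by rewrite norm_conjC mulr2n lerD.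
Qed.

Lemma completion_normZ c f : completion_norm (c *: f) = `|c| * completion_norm f.
Proof.
apply: (@pexpIrn _ 2); rewrite ?nnegrE ?mulr_ge0 ?completion_norm_ge0 //.
rewrite exprMn !completion_normK completion_innerZl completion_innerZr.
by rewrite mulrA normCK.
Qed.

Lemma completion_bounded_norm f : bounded_by f (completion_norm f).
Proof.
split=> [|w]; first exact: completion_norm_ge0.
rewrite -completion_inner_embed (le_trans (inner_le_norm _ _)) //.
by rewrite {2}/completion_norm completion_inner_embed embedE.
Qed.

Lemma completion_norm_eq0 f : completion_norm f = 0 -> f = 0.
Proof.
move=> f0; apply: completion_ext => w; apply/normr0_eq0/eqP.
have [_ /(_ w)] := completion_bounded_norm f.
by rewrite f0 mul0r normr_le0 => /eqP ->; rewrite normr0.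
Qed.

HB.instance Definition _ :=
  Lmodule_isNormed.Build C K completion_normD completion_normZ completion_norm_eq0.

Lemma bounded_by_norm f M : bounded_by f M -> `|f| <= M.
Proof.
move=> fM; have [M0 _] := fM.
rewrite -(@ler_pXn2r _ 2) ?nnegrE // [leLHS]completion_normK.
exact: completion_inner_bound.
Qed.

Lemma norm_completion_app f w : `|f w| <= `|f| * seminorm w.
Proof. by have [_] := completion_bounded_norm f; apply. Qed.

Lemma completion_appP c f g w : (c *: f + g : K) w = c * f w + g w.
Proof. by []. Qed.

Lemma completion_appB f g w : (f - g : K) w = f w - g w.
Proof. by []. Qed.

Lemma approx_norm f v e : 0 <= e -> approximates f v e -> `|f - embed v| <= e.
Proof.
move=> e0 fv; apply: bounded_by_norm; split=> // w.
by rewrite completion_appB embedE.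
Qed.

(** The values at each [w] converge at a rate proportional to [seminorm w], so the pointwise limit
    inherits its approximations from a nearby [x]. *)
Lemma completion_complete (F : set_system K) :
  ProperFilter F -> cauchy F -> cvg F.
Proof.
move=> FF /cauchyP Fc.
pose P w e c := exists x d, [/\ 0 < d, F (ball (x : K) d), d * seminorm w <= e & c = x w].
have lim w : exists c, forall x d, 0 < d -> F (ball (x : K) d) ->
    `|x w - c| <= d * seminorm w.
  have N0 := seminorm_ge0 w.
  have N1 : 0 < seminorm w + 1 by rewrite ltr_wpDl.
  have [| |c cP] := @complex_limit _ (P w).
  - move=> e e0; have [x Fx] := Fc _ (divr_gt0 e0 N1).
    exists (x w), x, (e / (seminorm w + 1)); split; rewrite ?divr_gt0 //.
    by rewrite mulrAC ler_pdivrMr // ler_wpM2l ?(ltW e0) // lerDl.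
  - move=> e e' _ _ e0 e'0 [x [d [d0 Fx de ->]]] [x' [d' [d'0 Fx' de' ->]]].
    have [y [xy x'y]] := filter_ex (filterI Fx Fx').
    rewrite (_ : x w - x' w = (x - y) w - (x' - y) w); last first.
      by rewrite !completion_appB; ring.
    rewrite (le_trans (ler_normB _ _)) // lerD // (le_trans (norm_completion_app _ _)) //.
      by rewrite (le_trans _ de) // ler_wpM2r // ltW //; move: xy; rewrite -ball_normE.
    by rewrite (le_trans _ de') // ler_wpM2r // ltW //; move: x'y; rewrite -ball_normE.
  exists c => x d d0 Fx.
  apply: (@eps_le _ _ _ 1); rewrite ?ger0_real ?mulr_ge0 ?(ltW d0) //.
  move=> e e0 _; rewrite mul1r; apply: cP; first by rewrite ltr_wpDl // mulr_ge0 ?(ltW d0).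
  by exists x, d; split=> //; rewrite lerDl ltW.
pose f0 w := projT1 (cid (lim w)).
have f0P w := projT2 (cid (lim w)).
have [|f fE] := @mk_completion _ _ f0.
  move=> e e0; have e2 : 0 < e / 2 by rewrite divr_gt0.
  have [x Fx] := Fc _ e2; have [v xv] := completionP x e2.
  exists v => w; rewrite (_ : _ - _ = - (x w - f0 w) + (x w - sform v w)); last by ring.
  rewrite [e]splitr mulrDl (le_trans (ler_normD _ _)) // lerD // normrN.
  exact: f0P Fx.
apply/cvg_ex; exists f; apply/cvgrPdist_lt => e e0.
have e2 : 0 < e / 2 by rewrite divr_gt0.
have [x Fx] := Fc _ e2; apply: filterS (Fx) => y xy.
have xf : `|f - x| <= e / 2.
  apply: bounded_by_norm; split=> [|w]; first exact: ltW.
  by rewrite completion_appB fE distrC; exact: f0P e2 Fx.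
rewrite (_ : f - y = (f - x) + (x - y)); last by rewrite addrA subrK.
rewrite (le_lt_trans (ler_normD _ _)) // [e]splitr ler_ltD //.
Qed.

HB.instance Definition _ := Uniform_isComplete.Build K completion_complete.

Let inner_bilinear : bilinear_for *%R (Num.conj \; *%R) (@completion_inner R E).
Proof.
split=> [h c f g|f c g h]; first exact: completion_inner_linear.
by rewrite completion_innerDr completion_innerZr.
Qed.
HB.instance Definition _ := @bilinear_isBilinear.Build _ _ _ _ _ _
  (@completion_inner R E) inner_bilinear.
Let inner_herm f g : '[f, g] = (-1) ^+ false * Num.conj '[g, f].
Proof. by rewrite expr0 mul1r completion_innerC. Qed.
HB.instance Definition _ := isHermitianSesquilinear.Build _ _ _ _
  (@completion_inner R E) inner_herm.
Let inner_gt0 f : f != 0 -> 0 < '[f, f].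
Proof.
move=> f0; rewrite lt_def completion_inner_ge0 andbT; apply: contra f0 => /eqP h.
by apply/eqP/completion_norm_eq0; rewrite /completion_norm h sqrtC0.
Qed.
HB.instance Definition _ := isDotProduct.Build _ _ (@completion_inner R E) inner_gt0.

Lemma completion_neq0 : exists f, f != 0.
Proof.
exists (embed (pre_unit E)); apply/eqP => /(congr1 (fun f : K => f (pre_unit E))).
by rewrite embedE => /eqP; apply/negP; exact: sform_unit.
Qed.

Definition completion_hilbert : hilbert R :=
  @Hilbert R K (@completion_inner R E) (fun f => completion_normK f) completion_neq0.
End CompletionHilbert.

(** * Extending adjointable maps to bounded operators *)

Section AdjointableMaps.
Variables (R : realType) (E : preHilbert R).
Local Notation C := R[i].
Local Notation K := (completion_hilbert E).

Record adjointable := Adjointable {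
  adj_fun :> E -> E;
  adj_adj : E -> E;
  adj_bound : C;
  adj_bound_ge0 : 0 <= adj_bound;
  adj_funP : forall v w, sform (adj_fun v) w = sform v (adj_adj w);
  adj_fun_bounded : forall v, seminorm (adj_fun v) <= adj_bound * seminorm v;
  adj_adj_bounded : forall v, seminorm (adj_adj v) <= adj_bound * seminorm v
}.

Lemma adj_adjP (T : adjointable) v w : sform (adj_adj T v) w = sform v (T w).
Proof. by rewrite sformC -adj_funP -sformC. Qed.

Definition adjointable_adj (T : adjointable) : adjointable :=
  Adjointable (adj_bound_ge0 T) (adj_adjP T) (@adj_adj_bounded T) (@adj_fun_bounded T).

Lemma adj_precomp (T : adjointable) (f : completion E) e : 0 < e ->
  exists v, approximates (fun w => f (adj_adj T w)) v e.
Proof.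
move=> e0; have M0 := adj_bound_ge0 T.
have M1 : 0 < adj_bound T + 1 by rewrite ltr_wpDl.
have [v fv] := completionP f (divr_gt0 e0 M1).
exists (T v) => w; rewrite adj_funP (le_trans (fv _)) //.
rewrite mulrAC ler_pdivrMr // -mulrA ler_wpM2l ?(ltW e0) //.
rewrite (le_trans (adj_adj_bounded T w)) // mulrDr mulr1 mulrC lerDl.
exact: seminorm_ge0.
Qed.

(** Extension by duality: the value at [w] is that of [f] at the adjoint applied to [w]. This
    respects null vectors and makes linearity immediate. *)
Definition ext_fun (T : adjointable) (f : K) : K :=
  projT1 (mk_completion (@adj_precomp T f)).

Lemma ext_funE (T : adjointable) (f : K) w :
  (ext_fun T f : completion E) w = (f : completion E) (adj_adj T w).
Proof. exact: (projT2 (mk_completion (@adj_precomp T f))). Qed.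

Lemma ext_fun_linear (T : adjointable) : linear (ext_fun T).
Proof. by move=> c f g; apply: completion_ext => w; rewrite !(ext_funE, completion_appP). Qed.

Lemma ext_fun_bounded (T : adjointable) : bounded_op (ext_fun T).
Proof.
exists (adj_bound T) => f; apply: bounded_by_norm; split=> [|w].
  by rewrite mulr_ge0 ?adj_bound_ge0.
rewrite ext_funE (le_trans (norm_completion_app _ _)) // [_ * `|f|]mulrC -mulrA ler_wpM2l //.
exact: adj_adj_bounded.
Qed.

Lemma ext_funP (T : adjointable) (f g : K) :
  inner K (ext_fun T f) g = inner K f (ext_fun (adjointable_adj T) g).
Proof.
have [M M0 fP] := completion_innerP (ext_fun T f) g.
have [N N0 gP] := completion_innerP f (ext_fun (adjointable_adj T) g).
have T0 := adj_bound_ge0 T.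
have T1 : 0 < adj_bound T + 1 by rewrite ltr_wpDl.
apply: (@eps_eq _ _ _ (M + N * (adj_bound T + 1))).
  by rewrite addr_ge0 // mulr_ge0 // ltW.
move=> e e0 _; have [v gv] := completionP g e0.
have gv' : approximates (ext_fun (adjointable_adj T) g) (adj_adj T v) (e * (adj_bound T + 1)).
  move=> w; rewrite ext_funE adj_adjP (le_trans (gv _)) // -mulrA ler_wpM2l ?(ltW e0) //.
  by rewrite (le_trans (adj_fun_bounded T w)) // mulrDl mul1r lerDl seminorm_ge0.
rewrite (_ : _ - _ = - ((ext_fun T f : completion E) v - inner K (ext_fun T f) g) +
  ((f : completion E) (adj_adj T v) - inner K f (ext_fun (adjointable_adj T) g)));
  last by rewrite ext_funE; ring.
rewrite mulrDl (le_trans (ler_normD _ _)) // lerD // ?normrN ?fP //.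
by rewrite -mulrA [_ * e]mulrC gP // mulr_gt0.
Qed.

Definition ext (T : adjointable) : bop K :=
  BOp (ext_fun_linear T) (ext_fun_bounded T)
    (ext_fun_linear (adjointable_adj T)) (ext_fun_bounded (adjointable_adj T))
    (ext_funP T).

Lemma ext_embed (T : adjointable) v : ext T (embed v) = embed (T v).
Proof.
by apply: completion_ext => w; rewrite [LHS]ext_funE !embedE adj_funP.
Qed.

Lemma star_ext (T : adjointable) : star (ext T) = ext (adjointable_adj T).
Proof. exact: bop_ext. Qed.

Lemma inner_embed (f : K) v : inner K f (embed v) = (f : completion E) v.
Proof. exact: completion_inner_embed. Qed.

Lemma embed_sep (f g : K) :
  (forall v, inner K f (embed v) = inner K g (embed v)) -> f = g.
Proof. by move=> fg; apply: completion_ext => v; rewrite -!inner_embed. Qed.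

Lemma bop_ext_embed (S T : bop K) : (forall v, S (embed v) = T (embed v)) -> S = T.
Proof.
move=> ST; apply: bop_ext => f; apply: inner_inj => g.
rewrite innerC [RHS]innerC !bop_adjP; congr (inner K f _)^*.
by apply: embed_sep => v; rewrite !bop_adjP' ST.
Qed.

Lemma embed_dense (f : K) e : 0 < e -> exists v, `|f - embed v| < e.
Proof.
move=> e0; have e2 : 0 < e / 2 by rewrite divr_gt0.
have [v fv] := completionP f e2; exists v.
rewrite (le_lt_trans (approx_norm (ltW e2) fv)) // [ltRHS]splitr ltrDl //.
Qed.
End AdjointableMaps.

(** * Positive kernels and Schur's product theorem *)

Section PositiveKernels.
Variables (C : numClosedFieldType).
Implicit Types X Y : Type.

Definition kform X (k : X -> X -> C) (v w : seq (C * X)) : C :=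
  \sum_(p <- v) \sum_(q <- w) p.1 * q.1^* * k p.2 q.2.

Definition hermitian_kernel X (k : X -> X -> C) := forall x y, k x y = (k y x)^*.

Definition psd_kernel X (k : X -> X -> C) := forall v, 0 <= kform k v v.

Lemma psd_kernel_comp X Y (f : X -> Y) k : psd_kernel k -> psd_kernel (fun x y => k (f x) (f y)).
Proof.
move=> kP v; have := kP [seq (p.1, f p.2) | p <- v].
rewrite /kform big_map; under eq_bigr do rewrite big_map /=.
by [].
Qed.

(** Spectral decomposition of the Gram matrix of the points listed in [v]; [a r r] is an
    eigenvalue. *)
Lemma psd_kernel_factor X (k : X -> X -> C) (v : seq (C * X)) :
  hermitian_kernel k -> psd_kernel k ->
  exists2 a : 'I_(size v) -> 'I_(size v) -> C,
    forall r, 0 <= a r r &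
    exists U : 'M[C]_(size v), forall i j : 'I_(size v),
      k (tnth (in_tuple v) i).2 (tnth (in_tuple v) j).2 = \sum_r (U r i)^* * a r r * U r j.
Proof.
move=> kh kp; set n := size v; pose x i := (tnth (in_tuple v) i).2.
pose G : 'M[C]_n := \matrix_(i, j) k (x i) (x j).
have Gh : G \is hermsymmx.
  apply/is_hermitianmxP; rewrite expr0 scale1r.
  by apply/matrixP => i j; rewrite !mxE kh.
have /orthomx_spectralP GE := hermitian_normalmx Gh.
set U := spectralmx G in GE; set d := spectral_diag G in GE.
have Uu : U \is unitarymx := spectral_unitarymx G.
rewrite invmx_unitary // in GE.
(* Each eigenvalue is the form evaluated at a row of the diagonalising unitary, hence
   nonnegative. *)
have dE r : d 0 r = \sum_i \sum_j U r i * (U r j)^* * G i j.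
  have : ((U *m G) *m map_mx Num.conj (trmx U)) r r = d 0 r.
    rewrite GE !mulmxA (unitarymxP Uu) mul1mx -mulmxA (unitarymxP Uu) mulmx1.
    by rewrite mxE eqxx.
  move<-; rewrite mxE; under eq_bigr do rewrite !mxE mulr_suml.
  rewrite exchange_big; apply: eq_bigr => i _; apply: eq_bigr => j _.
  by rewrite -mulrA [_ * _^*]mulrC mulrA.
exists (fun r _ => d 0 r).
  move=> r; rewrite dE; have := kp [seq (U r i, x i) | i <- enum 'I_n].
  rewrite /kform big_map big_enum; under eq_bigr do rewrite big_map big_enum /=.
  by congr (_ <= _); apply: eq_bigr => i _; apply: eq_bigr => j _; rewrite mxE.
exists U => i j; have := congr1 (fun M : 'M[C]_n => M i j) GE.
rewrite !mxE => ->; apply: eq_bigr => r _; rewrite mul_mx_diag !mxE.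
by [].
Qed.

(** Once [k] is diagonalised, the form of the product is a combination, with the eigenvalues as
    coefficients, of forms of [l] at rescaled vectors. *)
Lemma psd_kernelM X (k l : X -> X -> C) : hermitian_kernel k ->
  psd_kernel k -> psd_kernel l -> psd_kernel (fun x y => k x y * l x y).
Proof.
move=> kh kp lp v; have [a a0 [U UE]] := psd_kernel_factor v kh kp.
rewrite /kform big_tnth; under eq_bigr do rewrite big_tnth.
have -> : \sum_(i < size v) \sum_(j < size v)
    (tnth (in_tuple v) i).1 * (tnth (in_tuple v) j).1^* *
    (k (tnth (in_tuple v) i).2 (tnth (in_tuple v) j).2 *
     l (tnth (in_tuple v) i).2 (tnth (in_tuple v) j).2) =
  \sum_r a r r * kform l [seq ((tnth (in_tuple v) i).1 * (U r i)^*,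
      (tnth (in_tuple v) i).2) | i <- enum 'I_(size v)]
    [seq ((tnth (in_tuple v) i).1 * (U r i)^*,
      (tnth (in_tuple v) i).2) | i <- enum 'I_(size v)].
  rewrite /kform; under [RHS]eq_bigr do rewrite big_map big_enum mulr_sumr.
  rewrite [RHS]exchange_big; apply: eq_bigr => i _.
  under [RHS]eq_bigr do rewrite big_map big_enum mulr_sumr.
  rewrite [RHS]exchange_big; apply: eq_bigr => j _ /=.
  rewrite UE mulr_suml mulr_sumr; apply: eq_bigr => r _.
  rewrite rmorphM /= conjCK. ring.
by apply: sumr_ge0 => r _; rewrite mulr_ge0.
Qed.

Lemma psd_kernel_eq (X : eqType) : @psd_kernel X (fun x y => (x == y)%:R).
Proof.
move=> v; have -> : kform (fun x y : X => (x == y)%:R) v v =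
    \sum_(z <- undup (map snd v)) `|\sum_(p <- v | p.2 == z) p.1| ^+ 2.
  have E z : `|\sum_(p <- v | p.2 == z) p.1| ^+ 2 =
      \sum_(p <- v | p.2 == z) \sum_(q <- v) p.1 * q.1^* * (p.2 == q.2)%:R.
    rewrite normCK rmorph_sum mulr_suml /=; apply: eq_bigr => p /eqP <-.
    rewrite mulr_sumr big_mkcond; apply: eq_bigr => q _.
    by rewrite eq_sym; case: eqP; rewrite ?mulr1 ?mulr0.
  under [RHS]eq_bigr do rewrite E.
  rewrite (exchange_big_dep xpredT) //= /kform; apply: eq_big_seq => p pv.
  rewrite (big_rem p.2) /=; last by rewrite mem_undup map_f.
  rewrite eqxx [X in _ = _ + X]big_seq_cond [X in _ = _ + X]big_pred0 ?addr0 // => z.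
  rewrite mem_rem_uniq ?undup_uniq // inE; by case: (eqVneq p.2 z) => _; rewrite ?andbF.
by apply: sumr_ge0 => z _; rewrite exprn_ge0.
Qed.
End PositiveKernels.

(** * The pre-Hilbert space of a positive kernel *)

Section KernelSpace.
Variables (R : realType) (X : Type) (k : X -> X -> R[i]) (x0 : X).
Hypotheses (kh : hermitian_kernel k) (kp : psd_kernel k) (k0 : k x0 x0 != 0).
Local Notation C := R[i].
Implicit Types (u v w : seq (C * X)) (c : C).

Definition fscale c v : seq (C * X) := [seq (c * p.1, p.2) | p <- v].

Definition delta (x : X) : seq (C * X) := [:: (1, x)].

Lemma kform_cat u v w : kform k (u ++ v) w = kform k u w + kform k v w.
Proof. by rewrite /kform big_cat. Qed.

Lemma kform_scale c u w : kform k (fscale c u) w = c * kform k u w.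
Proof.
rewrite /kform big_map mulr_sumr; apply: eq_bigr => p _.
by rewrite mulr_sumr; apply: eq_bigr => q _; rewrite !mulrA.
Qed.

Lemma kform_herm u v : kform k u v = (kform k v u)^*.
Proof.
rewrite /kform exchange_big rmorph_sum; apply: eq_bigr => p _ /=.
rewrite rmorph_sum; apply: eq_bigr => q _ /=.
by rewrite !rmorphM /= conjCK -kh; ring.
Qed.

Lemma kform_unit : kform k (delta x0) (delta x0) != 0.
Proof. by rewrite /kform !big_seq1 conjC1 !mul1r. Qed.

Definition kernel_space : preHilbert R :=
  PreHilbert kform_cat kform_scale kform_herm kp kform_unit.

Local Notation E := kernel_space.

Definition flin (T : X -> seq (C * X)) v : seq (C * X) :=
  flatten [seq fscale p.1 (T p.2) | p <- v].

Lemma kform_flin T v w : kform k (flin T v) w = \sum_(p <- v) p.1 * kform k (T p.2) w.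
Proof.
rewrite /flin; elim: v => [|p v IH]; first by rewrite /kform !big_nil.
by rewrite /= kform_cat kform_scale IH big_cons.
Qed.

Lemma kform_flin_flin T T' v w :
  kform k (flin T' (flin T v)) w = \sum_(p <- v) p.1 * kform k (flin T' (T p.2)) w.
Proof.
rewrite kform_flin big_flatten big_map; apply: eq_bigr => p _.
by rewrite big_map kform_flin mulr_sumr; apply: eq_bigr => t _; rewrite mulrA.
Qed.

Lemma kform_flinr T v w : kform k w (flin T v) = \sum_(p <- v) p.1^* * kform k w (T p.2).
Proof.
rewrite kform_herm kform_flin rmorph_sum; apply: eq_bigr => p _.
by rewrite rmorphM /= -kform_herm.
Qed.

Lemma kform_basisl v w : kform k v w = \sum_(p <- v) p.1 * kform k (delta p.2) w.
Proof.
rewrite /kform; apply: eq_bigr => p _; rewrite big_seq1 mulr_sumr.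
by apply: eq_bigr => q _; rewrite mul1r mulrA.
Qed.

Lemma kform_basisr v w : kform k v w = \sum_(q <- w) q.1^* * kform k v (delta q.2).
Proof.
rewrite kform_herm kform_basisl rmorph_sum; apply: eq_bigr => p _.
by rewrite rmorphM /= -kform_herm.
Qed.

Lemma flin_adj T T' :
  (forall x y, kform k (T x) (delta y) = kform k (delta x) (T' y)) ->
  forall v w, kform k (flin T v) w = kform k v (flin T' w).
Proof.
move=> TT' v w; rewrite kform_flin [RHS]kform_basisl; apply: eq_bigr => p _.
congr (_ * _); rewrite kform_basisr kform_flinr; apply: eq_bigr => q _.
by rewrite TT'.
Qed.

Lemma embed_flin T (v : E) :
  embed (flin T v : E) = \sum_(p <- v) p.1 *: embed (T p.2 : E) :> completion E.
Proof.
apply: completion_ext => w; rewrite embedE /= kform_flin.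
elim: v => [|p v IH]; first by rewrite !big_nil.
by rewrite !big_cons IH completion_appP embedE.
Qed.

Lemma embed_sum (v : E) :
  embed v = \sum_(p <- v) p.1 *: embed (delta p.2 : E) :> completion E.
Proof.
apply: completion_ext => w; rewrite embedE /= kform_basisl.
elim: v => [|p v IH]; first by rewrite !big_nil.
by rewrite !big_cons IH completion_appP embedE.
Qed.

Lemma embed_cat (v w : E) : embed (v ++ w : E) = embed v + embed w :> completion E.
Proof. by rewrite embed_sum big_cat -!embed_sum. Qed.

Lemma embed_scale c (v : E) : embed (fscale c v : E) = c *: embed v :> completion E.
Proof.
rewrite embed_sum big_map [embed v]embed_sum scaler_sumr.
by apply: eq_bigr => p _; rewrite scalerA.
Qed.

Lemma embed_delta_ext x x' : (forall y, k x y = k x' y) ->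
  embed (delta x : E) = embed (delta x' : E) :> completion E.
Proof.
move=> xx'; apply: completion_ext => w; rewrite !embedE /= /kform !big_seq1.
by apply: eq_bigr => q _; rewrite xx'.
Qed.
End KernelSpace.

(** * Words in an algebra and a free Haar unitary *)

(** The part of [(A, phi)] on which the word construction rests; [ta_bound a] bounds the squared
    norm of left multiplication by [a]. *)
Record tracialAlgebra (R : realType) := TracialAlgebra {
  ta_alg :> starAlgType R[i];
  ta_tr : {scalar ta_alg};
  ta_bound : ta_alg -> R[i];
  ta_tr1 : ta_tr 1 = 1;
  ta_tr_ge0 : forall a, 0 <= ta_tr (star a * a);
  ta_tr_star : forall a, ta_tr (star a) = (ta_tr a)^*;
  ta_trC : forall a b, ta_tr (a * b) = ta_tr (b * a);
  ta_bound_ge0 : forall a, 0 <= ta_bound a;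
  ta_boundP : forall a b,
    ta_tr (star (a * b) * (a * b)) <= ta_bound a * ta_tr (star b * b)
}.

Section Words.
Variables (R : realType) (A : tracialAlgebra R).
Local Notation C := R[i].
Local Notation phi := (ta_tr A).

Definition ip (a b : A) : C := phi (star b * a).

Lemma ipC : hermitian_kernel ip.
Proof. by move=> a b; rewrite /ip -ta_tr_star starM starK. Qed.

Lemma ipDl a b c : ip (a + b) c = ip a c + ip b c.
Proof. by rewrite /ip mulrDr linearD. Qed.

Lemma ipZl (z : C) a c : ip (z *: a) c = z * ip a c.
Proof. by rewrite /ip -scalerAr linearZ. Qed.

Lemma ipBl a b c : ip (a - b) c = ip a c - ip b c.
Proof. by rewrite /ip mulrBr linearB. Qed.

Lemma ipZr (z : C) a c : ip a (z *: c) = z^* * ip a c.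
Proof. by rewrite /ip starZ -scalerAl linearZ. Qed.

Lemma ipBr a b c : ip c (a - b) = ip c a - ip c b.
Proof. by rewrite /ip starB mulrBl linearB. Qed.

Lemma ip1r a : ip a 1 = phi a.
Proof. by rewrite /ip star1 mul1r. Qed.

Lemma ip1l a : ip 1 a = (phi a)^*.
Proof. by rewrite ipC ip1r. Qed.

Lemma ip_mull a b c : ip (a * b) c = ip b (star a * c).
Proof. by rewrite /ip starM starK mulrA. Qed.

Lemma kform_ip (v : seq (C * A)) : kform ip v v =
  phi (star (\sum_(p <- v) p.1 *: p.2) * \sum_(p <- v) p.1 *: p.2).
Proof.
rewrite mulr_sumr linear_sum; apply: eq_bigr => p _.
rewrite star_sum mulr_suml linear_sum; apply: eq_bigr => q _ /=.
have -> : star (q.1 *: q.2) * (p.1 *: p.2) = (p.1 * q.1^*) *: (star q.2 * p.2).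
  by rewrite starZ -scalerAr -scalerAl scalerA.
by rewrite scalarZ.
Qed.

Lemma ip_psd : psd_kernel ip.
Proof. by move=> v; rewrite kform_ip ta_tr_ge0. Qed.

(* In a word, [a] preceded by u^e and followed by u^f is centred when f = - e,
   where freeness requires it. *)
Definition cen (e : bool) (a : A) (r : seq (bool * A)) : A :=
  if r is (f, _) :: _ then if f == e then a else a - (phi a)%:A else a.

(** The inner product that a free Haar unitary would give: words with different exponents are
    orthogonal, and otherwise the inner products of the centred letters multiply. *)
Fixpoint kr (r s : seq (bool * A)) : C :=
  match r, s with
  | [::], [::] => 1
  | (e, a) :: r', (f, b) :: s' =>
      (e == f)%:R * ip (cen e a r') (cen f b s') * kr r' s'
  | _, _ => 0
  end.

(* [(a0, [:: (e1, a1); ...; (en, an)])] stands for a0 u^e1 a1 ... u^en an, with the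
   inner letters centred by [cen]; [true] is the exponent 1 and [false] is -1. *)
Definition word := (A * seq (bool * A))%type.

Definition kw (x y : word) : C := ip x.1 y.1 * kr x.2 y.2.

Lemma krC : hermitian_kernel kr.
Proof.
elim=> [|[e a] r IH] [|[f b] s] /=; rewrite ?conjC0 ?conjC1 //.
by rewrite !rmorphM /= -ipC -IH eq_sym conjC_nat.
Qed.

Let head_sign (r : seq (bool * A)) : option bool := omap fst (ohead r).
Let head_elt (r : seq (bool * A)) : A := if r is (e, a) :: r' then cen e a r' else 1.

(* [kr] is a pointwise product over layers of positive kernels, so that Schur's
   theorem applies. *)
Fixpoint krn n (r s : seq (bool * A)) : C :=
  if n is n'.+1 then
    (head_sign r == head_sign s)%:R * (ip (head_elt r) (head_elt s) *
      krn n' (behead r) (behead s))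
  else 1.

Let krn_psd n : psd_kernel (krn n).
Proof.
elim: n => [|n IH] /=.
  by move=> v; rewrite (_ : kform _ v v = kform (fun a b => ip ((fun _ => 1) a) ((fun _ => 1) b)) v v)
    ?(psd_kernel_comp (fun _ : seq (bool * A) => 1) ip_psd) // /kform;
    under [RHS]eq_bigr do under eq_bigr do rewrite ip1r ta_tr1.
apply: psd_kernelM.
- by move=> r s; rewrite eq_sym conjC_nat.
- exact: (psd_kernel_comp head_sign (@psd_kernel_eq C _)).
apply: (psd_kernelM (k := fun r s => ip (head_elt r) (head_elt s))).
- by move=> r s; exact: ipC.
- exact: psd_kernel_comp ip_psd.
- exact: psd_kernel_comp IH.
Qed.

Let krnE n r s : (size r <= n)%N -> (size s <= n)%N -> krn n r s = kr r s.
Proof.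
elim: n r s => [|n IH] [|[e a] r] [|[f b] s] //=.
- by move=> _ _; rewrite ip1r ta_tr1 !mul1r (IH [::] [::]).
- by rewrite mul0r.
- by rewrite mul0r.
by rewrite !ltnS => rn sn; rewrite IH // mulrA -[Some e == _]/(e == f).
Qed.

Lemma kr_psd : psd_kernel kr.
Proof.
move=> v; pose n := \max_(p <- v) size p.2.
suff -> : kform kr v v = kform (krn n) v v by exact: krn_psd.
rewrite /kform !big_seq; apply: eq_bigr => p pv; rewrite !big_seq.
apply: eq_bigr => q qv; congr (_ * _); rewrite krnE //.
  by rewrite /n (big_rem p) //= leq_maxl.
by rewrite /n (big_rem q) //= leq_maxl.
Qed.

Lemma kwC : hermitian_kernel kw.
Proof. by move=> x y; rewrite /kw rmorphM /= -ipC -krC. Qed.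

Lemma kw_psd : psd_kernel kw.
Proof.
apply: psd_kernelM.
- by move=> x y; exact: ipC.
- exact: psd_kernel_comp ip_psd.
- exact: psd_kernel_comp kr_psd.
Qed.

Definition empty_word : word := (1, [::]).

Lemma kw_empty : kw empty_word empty_word != 0.
Proof. by rewrite /kw /= ip1r ta_tr1 mulr1 oner_neq0. Qed.

Definition word_space : preHilbert R := kernel_space kwC kw_psd kw_empty.
End Words.

(** * The actions of u and of the algebra on words *)

Section WordOperators.
Variables (R : realType) (A : tracialAlgebra R).
Local Notation C := R[i].
Local Notation phi := (ta_tr A).
Local Notation word := (word A).
Local Notation E := (word_space A).
Local Notation K := (completion_hilbert E).
Local Notation kf := (kform (@kw R A)).
Local Notation dl := (@delta R _).

Lemma phi_cst (c : C) : phi c%:A = c.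
Proof. by rewrite scalarZ ta_tr1 mulr1. Qed.

Lemma phi_centered (a : A) : phi (a - (phi a)%:A) = 0.
Proof. by rewrite linearB /= phi_cst subrr. Qed.

Lemma cen_nil e (a : A) : cen e a [::] = a. Proof. by []. Qed.

Lemma cen_same e (a b : A) r : cen e a ((e, b) :: r) = a.
Proof. by rewrite /= eqxx. Qed.

Lemma cen_neq e f (a b : A) r : f != e -> cen e a ((f, b) :: r) = a - (phi a)%:A.
Proof. by rewrite /= => /negPf ->. Qed.

Lemma cen_idem e f (a b c : A) r s :
  cen e (cen e a ((f, b) :: r)) ((f, c) :: s) = cen e a ((f, b) :: r).
Proof.
by rewrite /=; case: (f == e); rewrite ?phi_centered ?scale0r ?subr0.
Qed.

(** Where [kr r s] is nonzero, either both letters are centred or neither is. In the first case one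
    centring suffices, scalars being orthogonal to centred elements. *)
Lemma kr_cenr e (a b : A) r s :
  ip (cen e a r) (cen e b s) * kr r s = ip (cen e a r) b * kr r s.
Proof.
case: r s => [|[f a1] r] [|[g b1] s] //=; rewrite ?mulr0 //.
case: (f =P g) => [<-|_]; last by rewrite !mul0r !mulr0.
case: ifP => // _; congr (_ * _).
by rewrite ipBr ipZr ip1r phi_centered mulr0 subr0.
Qed.

Lemma kr_cenl e (a b : A) r s :
  ip (cen e a r) (cen e b s) * kr r s = ip a (cen e b s) * kr r s.
Proof.
by apply: (can_inj (@conjCK _)); rewrite !rmorphM /= -!ipC -!krC kr_cenr.
Qed.

(** Left multiplication by u^e. If the next exponent is opposite to [e], the first term stands for
    the centred letter, and the mean of the letter lets the two powers cancel. *)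
Definition Uw (e : bool) (x : word) : seq (C * word) :=
  (1, (1, (e, x.1) :: x.2)) ::
  (if x.2 is (f, a) :: r then
     if f == e then [::] else [:: (phi x.1, (cen f a r, r))]
   else [::]).

Definition Lw (a : A) (x : word) : seq (C * word) := dl (a * x.1, x.2).

Lemma kform_dl x y : kf (dl x) (dl y) = kw x y.
Proof. by rewrite /kform !big_seq1 conjC1 !mul1r. Qed.

Lemma Uw_adj e x y : kf (Uw e x) (dl y) = kf (dl x) (Uw (~~ e) y).
Proof.
case: x y => [a r] [b s].
have UE e' a' r' v : kf v (Uw e' (a', r')) = kf v (dl (1, (e', a') :: r')) +
    (if r' is (f, a1) :: r1 then
      if f == e' then 0 else (phi a')^* * kf v (dl (cen f a1 r1, r1)) else 0).
  rewrite (kform_basisr (@kwC R A)) big_cons /= conjC1 mul1r; congr (_ + _).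
  case: r' => [|[f a1] r1]; first by rewrite big_nil.
  by case: ifP => _; rewrite ?big_nil ?big_seq1.
rewrite (kform_herm (@kwC R A)) !UE rmorphD /= -(kform_herm (@kwC R A)) !kform_dl.
rewrite addrC; congr (_ + _).
  rewrite /kw /= ip1r; case: r => [|[f a1] r1]; first by rewrite conjC0 mulr0.
  case: e f => [] [] /=; rewrite ?conjC0 ?mul0r ?mulr0 // mul1r.
    by rewrite rmorphM /= conjCK -(kform_herm (@kwC R A)) kform_dl /kw /= kr_cenr.
  by rewrite rmorphM /= conjCK -(kform_herm (@kwC R A)) kform_dl /kw /= kr_cenr.
rewrite /kw /= ip1l; case: s => [|[g b1] s1]; first by rewrite mulr0.
case: e g => [] [] /=; rewrite ?mul0r ?mulr0 // mul1r.
  by rewrite kform_dl /kw /= kr_cenl.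
by rewrite kform_dl /kw /= kr_cenl.
Qed.

Lemma UwK e x y : kf (flin (Uw (~~ e)) (Uw e x)) (dl y) = kw x y.
Proof.
case: x y => [a r] [b s].
have UE e' a' r' v : kf (Uw e' (a', r')) v = kf (dl (1, (e', a') :: r')) v +
    (if r' is (f, a1) :: r1 then
      if f == e' then 0 else phi a' * kf (dl (cen f a1 r1, r1)) v else 0).
  rewrite kform_basisl big_cons /= mul1r; congr (_ + _).
  case: r' => [|[f a1] r1]; first by rewrite big_nil.
  by case: ifP => _; rewrite ?big_nil ?big_seq1.
(* The letter 1 between opposite exponents is centred to 0, so such a word is null. *)
have null c t : kf (dl (1, (~~ e, 1) :: (e, c) :: t)) (dl (b, s)) = 0.
  rewrite kform_dl /kw; case: s => [|[g b1] s1] /=; first by rewrite mulr0.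
  have -> : (e == ~~ e) = false by case: e.
  by rewrite /= ta_tr1 scale1r subrr /ip mulr0 linear0 mulr0 mul0r mulr0.
rewrite kform_flin big_cons UE null add0r mul1r.
have -> : (e == ~~ e) = false by case: (e).
rewrite ta_tr1 mul1r kform_dl /=.
case: r => [|[f a1] r1]; first by rewrite big_nil addr0.
case: (f =P e) => [->|/eqP fe].
  by rewrite big_nil addr0 cen_same.
have -> : f = ~~ e by case: (e) (f) fe => [] [].
rewrite big_seq1 UE /= kform_dl.
(* After one cancellation the exposed letter is already centred if an opposite exponent follows; a
   second cancellation has coefficient 0. *)
have -> : (if r1 is (f0, a2) :: r2 then if f0 == ~~ e then 0 else
    phi (cen (~~ e) a1 r1) * kf (dl (cen f0 a2 r2, r2)) (dl (b, s)) else 0) = 0.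
  case: r1 => [//|[g a2] r2]; case: eqP => // /eqP ge.
  by rewrite cen_neq // phi_centered mul0r.
have ne : ~~ e != e by case: (e).
rewrite addr0 /kw /= (negPf ne) ipBl ipZl mulrBl.
case: s {null} => [|[g b1] s1]; first by rewrite !mulr0 subrr add0r.
have -> : cen (~~ e) (cen (~~ e) a1 r1) r1 = cen (~~ e) a1 r1.
  by case: r1 => [|[h a2] r2]; rewrite ?cen_idem.
by rewrite mulrA subrK.
Qed.

Lemma Lw_adj a x y : kf (Lw a x) (dl y) = kf (dl x) (Lw (star a) y).
Proof. by rewrite !kform_dl /kw ip_mull. Qed.

Lemma flin_UwK e v w : kf (flin (Uw (~~ e)) (flin (Uw e) v)) w = kf v w.
Proof.
rewrite kform_basisr 1?[RHS]kform_basisr; try exact: kwC.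
apply: eq_bigr => q _; congr (_ * _).
rewrite kform_flin_flin [RHS]kform_basisl; apply: eq_bigr => p _.
by rewrite UwK kform_dl.
Qed.

Lemma flin_Uw_isometric e v : kf (flin (Uw e) v) (flin (Uw e) v) = kf v v.
Proof.
rewrite (flin_adj (@kwC R A) (@Uw_adj e)) (kform_herm (@kwC R A)) flin_UwK.
by rewrite -(kform_herm (@kwC R A)).
Qed.

Lemma flin_Lw a v : flin (Lw a) v = [seq (p.1 * 1, (a * p.2.1, p.2.2)) | p <- v].
Proof. by rewrite /flin; elim: v => //= p v ->. Qed.

(** The bound on the algebra says that [d] is a positive kernel. Only the first letter changes, so
    Schur's theorem with [kr] carries the bound over to words. *)
Lemma Lw_bounded a v :
  kf (flin (Lw a) v) (flin (Lw a) v) <= ta_bound a * kf v v.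
Proof.
pose d (b c : A) := ta_bound a * ip b c - ip (a * b) (a * c).
have dp : psd_kernel d.
  move=> w; have -> : kform d w w = ta_bound a * kform (@ip R A) w w -
      kform (@ip R A) [seq (p.1, a * p.2) | p <- w] [seq (p.1, a * p.2) | p <- w].
    rewrite /kform big_map mulr_sumr -sumrB; apply: eq_bigr => p _.
    rewrite big_map mulr_sumr -sumrB; apply: eq_bigr => q _.
    by rewrite /d mulrBr mulrCA.
  rewrite !kform_ip big_map /= subr_ge0.
  under [X in phi (star X * _)]eq_bigr do rewrite scalerAr.
  under [X in phi (_ * X)]eq_bigr do rewrite scalerAr.
  by rewrite -mulr_sumr ta_boundP.
have dh : hermitian_kernel d.
  move=> b c; rewrite /d rmorphB rmorphM /= -!ipC.
  by rewrite geC0_conj // ta_bound_ge0.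
have := psd_kernelM (k := fun x y : word => d x.1 y.1) (l := fun x y => kr x.2 y.2)
  (fun x y => dh x.1 y.1) (psd_kernel_comp fst dp) (psd_kernel_comp snd (@kr_psd R A)) v.
rewrite -[kf _ _ <= _]subr_ge0; congr (_ <= _); rewrite flin_Lw /kform big_map mulr_sumr -sumrB.
apply: eq_bigr => p _; rewrite big_map mulr_sumr -sumrB; apply: eq_bigr => q _ /=.
by rewrite /d /kw /= !mulr1; ring.
Qed.

Lemma seminorm_Uw e (v : E) : seminorm (flin (Uw e) v : E) = seminorm v.
Proof. by rewrite /seminorm /= flin_Uw_isometric. Qed.

Lemma seminorm_Lw a (v : E) :
  seminorm (flin (Lw a) v : E) <= sqrtC (ta_bound a) * seminorm v.
Proof.
rewrite /seminorm -sqrtCM ?nnegrE ?ta_bound_ge0 ?sform_ge0 //.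
by rewrite ler_sqrtC ?nnegrE ?mulr_ge0 ?ta_bound_ge0 ?sform_ge0 // Lw_bounded.
Qed.

Definition Uadj (e : bool) : adjointable E.
Proof.
refine (@Adjointable R E (flin (Uw e)) (flin (Uw (~~ e))) 1 ler01 _ _ _).
- exact: (flin_adj (@kwC R A) (@Uw_adj e)).
- by move=> v; rewrite seminorm_Uw mul1r.
- by move=> v; rewrite seminorm_Uw mul1r.
Defined.

Definition Ladj (a : A) : adjointable E.
Proof.
refine (@Adjointable R E (flin (Lw a)) (flin (Lw (star a)))
  (sqrtC (ta_bound a) + sqrtC (ta_bound (star a))) _ _ _ _).
- by rewrite addr_ge0 ?sqrtC_ge0 ?ta_bound_ge0.
- exact: (flin_adj (@kwC R A) (@Lw_adj a)).
- move=> v; rewrite (le_trans (seminorm_Lw _ _)) // ler_wpM2r ?seminorm_ge0 //.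
  by rewrite lerDl sqrtC_ge0 ta_bound_ge0.
- move=> v; rewrite (le_trans (seminorm_Lw _ _)) // ler_wpM2r ?seminorm_ge0 //.
  by rewrite lerDr sqrtC_ge0 ta_bound_ge0.
Defined.

Definition ket (x : word) : K := embed (dl x : E).

Lemma embedS (v : E) : embed v = \sum_(p <- v) p.1 *: ket p.2 :> K.
Proof. exact: embed_sum. Qed.

Lemma ket_sep (S T : bop K) : (forall x, S (ket x) = T (ket x)) -> S = T.
Proof.
move=> ST; apply: bop_ext_embed => v; rewrite embedS.
by elim/big_rec: _ => [|p w _ IH]; rewrite ?bop0 // !bopP IH ST.
Qed.

Definition Uop e : bop K := ext (Uadj e).
Definition Lop a : bop K := ext (Ladj a).

Lemma Uop_embed e (v : E) : Uop e (embed v) = embed (flin (Uw e) v : E).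
Proof. exact: ext_embed. Qed.

Lemma Lop_embed a (v : E) : Lop a (embed v) = embed (flin (Lw a) v : E).
Proof. exact: ext_embed. Qed.

Lemma Lop_ket a x : Lop a (ket x) = ket (a * x.1, x.2).
Proof.
rewrite /Lop /ket ext_embed /= [LHS]embed_sum flin_Lw big_seq1 /= mulr1.
by rewrite scale1r.
Qed.

Lemma Uop_ket e a r : Uop e (ket (a, r)) = ket (1, (e, a) :: r) +
  (if r is (f, b) :: s then if f == e then 0 else phi a *: ket (cen f b s, s) else 0).
Proof.
rewrite /Uop /ket ext_embed /= [LHS]embed_flin big_seq1 scale1r embed_sum big_cons /=.
rewrite scale1r; congr (_ + _).
case: r => [|[f b] s]; first by rewrite big_nil.
by case: ifP => _; rewrite ?big_nil ?big_seq1.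
Qed.

Lemma star_Uop e : star (Uop e) = Uop (~~ e).
Proof.
rewrite /Uop star_ext; apply: bop_ext_embed => v; rewrite !ext_embed; congr embed.
Qed.

Lemma star_Lop a : star (Lop a) = Lop (star a).
Proof. by rewrite /Lop star_ext; apply: bop_ext_embed => v; rewrite !ext_embed. Qed.

Lemma UopK e : Uop (~~ e) * Uop e = 1.
Proof.
apply: bop_ext_embed => v; rewrite -[LHS]/(Uop (~~ e) (Uop e (embed v))) /Uop !ext_embed.
by apply: completion_ext => w; rewrite !embedE /= flin_UwK.
Qed.

Lemma ket_ext x x' : (forall y, kw x y = kw x' y) -> ket x = ket x'.
Proof. exact: embed_delta_ext. Qed.

Lemma ket_linear (c : C) a b r : ket (c *: a + b, r) = c *: ket (a, r) + ket (b, r).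
Proof.
apply: completion_ext => w; rewrite completion_appP !embedE /= /kform !big_seq1.
rewrite mulr_sumr -big_split; apply: eq_bigr => q _ /=.
by rewrite /kw /= ipDl ipZl; ring.
Qed.

Lemma ket_cen a e b r : ket (a, (e, cen e b r) :: r) = ket (a, (e, b) :: r).
Proof.
apply: ket_ext => -[a' [|[e' b'] r']] //=; rewrite /kw /=.
by case: r => [|[f c] r]; rewrite ?cen_idem.
Qed.

Lemma LopM a b : Lop (a * b) = Lop a * Lop b.
Proof. apply: ket_sep => x; rewrite -[RHS]/(Lop a (Lop b (ket x))) !Lop_ket.
by rewrite mulrA. Qed.

Lemma Lop1 : Lop 1 = 1.
Proof. by apply: ket_sep => -[a r]; rewrite Lop_ket mul1r. Qed.

Lemma Lop_linear (c : C) a b : Lop (c *: a + b) = c *: Lop a + Lop b.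
Proof.
apply: ket_sep => x; rewrite -[RHS]/(c *: Lop a (ket x) + Lop b (ket x)) !Lop_ket.
by rewrite mulrDl -scalerAl ket_linear.
Qed.
End WordOperators.

Opaque Uop Lop.

Lemma bop_linE (R : realType) (H : hilbert R) (c : R[i]) (S T : bop H) v :
  (c *: S + T) v = c *: S v + T v.
Proof. by []. Qed.

Lemma bop_mulE (R : realType) (H : hilbert R) (S T : bop H) v : (S * T) v = S (T v).
Proof. by []. Qed.

(** * The von Neumann algebra of a cyclic trace vector *)

Record cyclicTrace (R : realType) := CyclicTrace {
  ct_space :> hilbert R;
  ct_alg : bop ct_space -> Prop;
  ct_vec : ct_space;
  ct_lin : forall c S T, ct_alg S -> ct_alg T -> ct_alg (c *: S + T);
  ct_mul : forall S T, ct_alg S -> ct_alg T -> ct_alg (S * T);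
  ct_star : forall T, ct_alg T -> ct_alg (star T);
  ct_one : ct_alg 1;
  ct_unit : inner ct_space ct_vec ct_vec = 1;
  ct_cyclic : forall (f : ct_space) (e : R[i]), 0 < e ->
    exists2 T, ct_alg T & `|f - T ct_vec| < e;
  ct_trace : forall S T, ct_alg S -> ct_alg T ->
    inner ct_space ((S * T) ct_vec) ct_vec = inner ct_space ((T * S) ct_vec) ct_vec
}.

Section HilbertFacts.
Variables (R : realType) (H : hilbert R).
Local Notation C := R[i].

Lemma innerDl (f g h : H) : inner H (f + g) h = inner H f h + inner H g h.
Proof. exact: linearDl. Qed.

Lemma innerZl (c : C) (f h : H) : inner H (c *: f) h = c * inner H f h.
Proof. exact: linearZl_LR. Qed.

Lemma innerBl (f g h : H) : inner H (f - g) h = inner H f h - inner H g h.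
Proof. exact: linearBl. Qed.

Lemma innerDr (f g h : H) : inner H h (f + g) = inner H h f + inner H h g.
Proof. exact: linearDr. Qed.

Lemma innerZr (c : C) (f h : H) : inner H h (c *: f) = c^* * inner H h f.
Proof. exact: linearZr_LR. Qed.

Lemma innerBr (f g h : H) : inner H h (f - g) = inner H h f - inner H h g.
Proof. exact: linearBr. Qed.

Lemma hilbert_CauchySchwarz (f g : H) : `|inner H f g| <= `|f| * `|g|.
Proof.
rewrite -(@ler_pXn2r _ 2) ?nnegrE ?mulr_ge0 // exprMn !innerE.
apply: discriminant_le => [|c]; first by rewrite -innerE exprn_ge0.
have : 0 <= inner H (f + c *: g) (f + c *: g) by rewrite -innerE exprn_ge0.
rewrite innerDl !innerDr !innerZl !innerZr (innerC g f) normCK.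
by congr (_ <= _); ring.
Qed.

Lemma hilbert_norm_eq (f g : H) : inner H f f = inner H g g -> `|f| = `|g|.
Proof. by rewrite -!innerE => /eqP; rewrite eqrXn2 // => /eqP. Qed.
End HilbertFacts.

Section ModularConjugation.
Variables (R : realType) (D : cyclicTrace R).
Local Notation C := R[i].
Local Notation H := (ct_space D).
Local Notation M := (@ct_alg R D).
Local Notation O := (ct_vec D).
Local Notation "<< f , g >>" := (inner H f g).
Implicit Types (f g v : H) (S T : bop H).

Lemma bop_star_adj S f g : << S f, g >> = << f, star S g >>.
Proof. exact: bop_adjP. Qed.

Lemma ct_sub S T : M S -> M T -> M (S - T).
Proof. by move=> Sm Tm; rewrite addrC -scaleN1r; exact: ct_lin. Qed.

Lemma bop_subE S T f : (S - T) f = S f - T f.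
Proof. by rewrite -[in RHS]scaleN1r. Qed.

Lemma ct_inner_star S T : M S -> M T -> << S O, T O >> = << star T O, star S O >>.
Proof.
move=> Sm Tm; have := ct_trace (ct_star Tm) Sm.
by rewrite !bop_mulE (bop_star_adj (star T)) (bop_star_adj S (star T O)) starK.
Qed.

Lemma ct_norm_star T : M T -> `|star T O| = `|T O|.
Proof. by move=> Tm; apply: hilbert_norm_eq; rewrite -ct_inner_star. Qed.

Lemma ct_sep f g : (forall S, M S -> << f, S O >> = << g, S O >>) -> f = g.
Proof.
move=> fg; apply/eqP; rewrite -subr_eq0 -normr_eq0 -sqrf_eq0 innerE; apply/eqP.
apply: (@eps_eq _ _ _ `|f - g|) => // e e0 _; have [S Sm Se] := ct_cyclic (f - g) e0.
rewrite subr0 [X in `|X|](_ : _ = << f - g, (f - g) - S O >>).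
  by rewrite (le_trans (hilbert_CauchySchwarz _ _)) // ler_wpM2l // ltW.
by rewrite innerBr [X in _ = _ - X]innerBl (fg S Sm) subrr subr0.
Qed.

(** The values [star T O] as [T O] tends to [f]; the limit of this filter will be [modJ f]. *)
Definition conj_filter f : set_system H :=
  [set X | exists2 e : C, 0 < e & forall T, M T -> `|f - T O| < e -> X (star T O)].

Lemma conj_filter_proper f : ProperFilter (conj_filter f).
Proof.
split.
  by move=> [e e0 He]; have [T Tm Te] := ct_cyclic f e0; exact: He Tm Te.
split.
- by exists 1.
- move=> X Y [d d0 dX] [e e0 eY].
  have [de|de] := real_leP (gtr0_real d0) (gtr0_real e0).
    exists d => // T Tm Td; split; first exact: dX.
    by apply: eY => //; exact: lt_le_trans de.
  exists e => // T Tm Te; split; last exact: eY.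
  by apply: dX => //; exact: lt_trans de.
- by move=> X Y XY [d d0 dX]; exists d => // T Tm Td; apply/XY/dX.
Qed.

(** By the trace property [T O] and [star T O] have equal norms, so the densely defined map between
    them is isometric and the filter is Cauchy. *)
Lemma conj_ex f : exists g, forall T, M T -> `|g - star T O| <= `|f - T O|.
Proof.
have FF := conj_filter_proper f.
have : cauchy (conj_filter f).
  apply/cauchyP => e e0; have e2 : 0 < e / 2 by rewrite divr_gt0.
  have [S Sm Se] := ct_cyclic f e2; exists (star S O), (e / 2) => // T Tm Te.
  rewrite -ball_normE; suff h : `|star S O - star T O| < e by exact: h.
  rewrite -bop_subE -starB ct_norm_star; last exact: ct_sub.
  rewrite bop_subE (_ : _ - _ = (f - T O) - (f - S O)).
    by rewrite [ltRHS]splitr (le_lt_trans (ler_normB _ _)) // ltrD.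
  by rewrite [RHS]addrC opprB addrA subrK.
move=> /cauchy_cvg /cvg_ex [g] gP; exists g => T Tm.
apply: (@eps_le _ _ _ 2); rewrite ?normr_real // => e e0 _.
have [d d0 dP] := gP _ (nbhsx_ballx g e e0).
have [d' [d'0 d'd d'e]] : exists d', [/\ 0 < d', d' <= d & d' <= e].
  have [de|de] := real_leP (gtr0_real d0) (gtr0_real e0); first by exists d.
  by exists e; rewrite (ltW de).
have [S Sm Se] := ct_cyclic f d'0.
have gS : `|g - star S O| < e.
  by have := dP S Sm (lt_le_trans Se d'd); rewrite -ball_normE.
rewrite (_ : g - _ = (g - star S O) + (star S O - star T O)); last by rewrite addrA subrK.
rewrite (le_trans (ler_normD _ _)) // -bop_subE -starB ct_norm_star; last exact: ct_sub.
rewrite bop_subE (_ : S O - T O = (f - T O) - (f - S O)); last first.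
  by rewrite [RHS]addrC opprB addrA subrK.
have -> : `|f - T O| + 2 * e = e + (`|f - T O| + e) by ring.
rewrite lerD ?(ltW gS) // (le_trans (ler_normB _ _)) // lerD //.
by rewrite ltW // (lt_le_trans Se).
Qed.

(* The antiunitary J with J (T O) = T^* O for T in M. *)
Definition modJ f : H := projT1 (cid (conj_ex f)).
Local Notation J := modJ.

Lemma modJ_dist f T : M T -> `|J f - star T O| <= `|f - T O|.
Proof. exact: (projT2 (cid (conj_ex f))). Qed.

Lemma modJ_alg T : M T -> J (T O) = star T O.
Proof.
move=> Tm; apply/eqP; rewrite -subr_eq0 -normr_le0.
by rewrite (le_trans (modJ_dist _ Tm)) // subrr normr0.
Qed.

Lemma modJ_vec : J O = O.
Proof.
by have := modJ_alg (ct_one D); rewrite star1.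
Qed.

Lemma modJ_innerM f S : M S -> << J f, S O >> = << star S O, f >>.
Proof.
move=> Sm; apply: (@eps_eq _ _ _ (`|S O| + `|star S O|)); first exact: addr_ge0.
move=> e e0 _; have [T Tm Te] := ct_cyclic f e0.
have eq2 : << star T O, S O >> = << star S O, T O >>.
  by have := ct_inner_star (ct_star Tm) Sm; rewrite starK.
rewrite (_ : _ - _ = << J f - star T O, S O >> - << star S O, f - T O >>); last first.
  by rewrite innerBl innerBr eq2; ring.
rewrite mulrDl (le_trans (ler_normB _ _)) // lerD //.
  rewrite (le_trans (hilbert_CauchySchwarz _ _)) // mulrC ler_wpM2l //.
  by rewrite (le_trans (modJ_dist _ Tm)) // ltW.
by rewrite (le_trans (hilbert_CauchySchwarz _ _)) // ler_wpM2l // ltW.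
Qed.

Lemma modJ_inner f g : << J f, J g >> = << g, f >>.
Proof.
apply: (@eps_eq _ _ _ (`|J f| + `|f|)); first exact: addr_ge0.
move=> e e0 _; have [T Tm Te] := ct_cyclic g e0.
have JT : << J f, star T O >> = << T O, f >>.
  by rewrite (modJ_innerM _ (ct_star Tm)) starK.
rewrite (_ : _ - _ = << J f, J g - star T O >> - << g - T O, f >>); last first.
  by rewrite innerBl innerBr JT; ring.
rewrite mulrDl (le_trans (ler_normB _ _)) // lerD //.
  rewrite (le_trans (hilbert_CauchySchwarz _ _)) // ler_wpM2l //.
  by rewrite (le_trans (modJ_dist _ Tm)) // ltW.
by rewrite (le_trans (hilbert_CauchySchwarz _ _)) // mulrC ler_wpM2l // ltW.
Qed.

Lemma modJK f : J (J f) = f.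
Proof.
apply: ct_sep => S Sm; rewrite modJ_innerM // innerC modJ_innerM; last exact: ct_star.
by rewrite starK -innerC.
Qed.

Lemma modJ_innerl f g : << J f, g >> = << J g, f >>.
Proof. by rewrite -[in LHS](modJK g) modJ_inner. Qed.

Lemma modJ_linear (c : C) f g : J (c *: f + g) = c^* *: J f + J g.
Proof.
apply: ct_sep => S Sm; rewrite innerDl innerZl !modJ_innerM //.
by rewrite innerDr innerZr.
Qed.

Lemma modJ_norm f : `|J f| = `|f|.
Proof. by apply: hilbert_norm_eq; rewrite modJ_inner. Qed.

Lemma conjJ_linear S : linear (fun f => J (S (J f))).
Proof. by move=> c f g; rewrite modJ_linear bopP modJ_linear conjCK. Qed.

Lemma conjJ_bounded S : bounded_op (fun f => J (S (J f))).
Proof.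
have [B SB] := bop_bounded S; exists B => f.
by rewrite modJ_norm (le_trans (SB _)) // modJ_norm.
Qed.

Lemma conjJP S f g : << J (S (J f)), g >> = << f, J (star S (J g)) >>.
Proof.
by rewrite modJ_innerl innerC bop_star_adj [RHS]innerC [in RHS]modJ_innerl.
Qed.

Definition conjJ S : bop H :=
  BOp (conjJ_linear S) (conjJ_bounded S) (conjJ_linear (star S)) (conjJ_bounded (star S))
    (conjJP S).

Lemma star_conjJ S : star (conjJ S) = conjJ (star S).
Proof. exact: bop_ext. Qed.

Lemma conjJE S f : conjJ S f = J (S (J f)). Proof. by []. Qed.

(* The commutant of J M J. It contains M, and O is separating and cyclic for it. *)
Definition ct_vn_pred : {pred bop H} :=
  fun T => `[< forall S, M S -> conjJ S * T = T * conjJ S >].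

Lemma ct_vn_predP T :
  reflect (forall S, M S -> conjJ S * T = T * conjJ S) (T \in ct_vn_pred).
Proof. exact: asboolP. Qed.

Lemma modJ_bop S T : M S -> M T -> J (S (T O)) = star T (star S O).
Proof.
move=> Sm Tm; rewrite -bop_mulE modJ_alg; last exact: ct_mul.
by rewrite starM bop_mulE.
Qed.

Lemma ct_alg_ext S T : (forall P, M P -> S (P O) = T (P O)) -> S = T.
Proof.
move=> ST; apply: bop_ext => f; apply: inner_inj => g.
rewrite innerC [RHS]innerC !bop_star_adj; congr (_^*); congr (inner H f _).
by apply: ct_sep => P Pm; rewrite !bop_star_adj !starK ST.
Qed.

(** On the dense vectors [P O], [conjJ S] is right multiplication by [star S], which commutes with
    left multiplication by [T]. *)
Lemma ct_alg_vn T : M T -> T \in ct_vn_pred.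
Proof.
move=> Tm; apply/ct_vn_predP => S Sm; apply: ct_alg_ext => P Pm.
rewrite !bop_mulE !conjJE modJ_bop // modJ_alg //.
have Ps := ct_star Pm; have Ts := ct_star Tm; have Ss := ct_star Sm.
rewrite -!bop_mulE modJ_alg; last by apply: ct_mul => //; exact: ct_mul.
by rewrite modJ_alg ?starM ?starK ?mulrA //; exact: ct_mul.
Qed.

(** This extends [modJ_alg] from [M] to the commutant of J M J, where the trace property then
    follows from the antiunitarity of J. The proof tests against [S O], written as an element of J M
    J applied to [O]. *)
Lemma ct_vn_star_vec T : T \in ct_vn_pred -> star T O = J (T O).
Proof.
move=> /ct_vn_predP TB; apply: ct_sep => S Sm.
have Ss := ct_star Sm.
have SO : S O = conjJ (star S) O by rewrite conjJE modJ_vec modJ_alg // starK.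
rewrite {1}SO bop_star_adj starK -bop_mulE -TB // bop_mulE conjJE.
by rewrite innerC modJ_innerl modJ_vec -innerC bop_star_adj starK.
Qed.

(** [O] is cyclic for J M J, hence separating for its commutant. *)
Lemma ct_vn_sep T : T \in ct_vn_pred -> T O = 0 -> T = 0.
Proof.
move=> /ct_vn_predP TB TO; apply: ct_alg_ext => S Sm.
have SO : S O = conjJ (star S) O.
  by rewrite conjJE modJ_vec modJ_alg ?starK //; exact: ct_star.
by rewrite SO -bop_mulE -TB ?bop_mulE ?TO ?bop0 //; exact: ct_star.
Qed.

Lemma ct_vn_subalg : subalg_closed ct_vn_pred.
Proof.
split.
- by apply/ct_vn_predP => S _; rewrite mulr1 mul1r.
- move=> c S T /ct_vn_predP SB /ct_vn_predP TB; apply/ct_vn_predP => P Pm.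
  by rewrite mulrDr mulrDl -scalerAr -scalerAl SB ?TB.
- move=> S T /ct_vn_predP SB /ct_vn_predP TB; apply/ct_vn_predP => P Pm.
  by rewrite mulrA SB // -mulrA TB // mulrA.
Qed.
HB.instance Definition _ :=
  GRing.isSubalgClosed.Build C (bop H) ct_vn_pred ct_vn_subalg.

Lemma ct_vn_star T : T \in ct_vn_pred -> star T \in ct_vn_pred.
Proof.
move=> /ct_vn_predP TB; apply/ct_vn_predP => S Sm.
have := TB _ (ct_star Sm); rewrite -star_conjJ => /(congr1 star).
by rewrite !starM starK => ->.
Qed.

Record ct_vn := CtVn { ct_vn_val :> bop H; _ : ct_vn_val \in ct_vn_pred }.
HB.instance Definition _ := [isSub for ct_vn_val].
HB.instance Definition _ := [Choice of ct_vn by <:].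
HB.instance Definition _ := [SubChoice_isSubAlgebra of ct_vn by <:].

Lemma ct_vnP (T : ct_vn) : (T : bop H) \in ct_vn_pred.
Proof. exact: valP T. Qed.

Definition ct_vn_starfun (T : ct_vn) : ct_vn := CtVn (ct_vn_star (ct_vnP T)).

Let starfunK : involutive ct_vn_starfun.
Proof. by move=> T; apply: val_inj; exact: starK. Qed.
Let starfunD : {morph ct_vn_starfun : S T / S + T}.
Proof. by move=> S T; apply: val_inj; exact: starD. Qed.
Let starfunZ (c : C) (T : ct_vn) : ct_vn_starfun (c *: T) = c^* *: ct_vn_starfun T.
Proof. by apply: val_inj; exact: starZ. Qed.
Let starfunM (S T : ct_vn) : ct_vn_starfun (S * T) = ct_vn_starfun T * ct_vn_starfun S.
Proof. by apply: val_inj; exact: starM. Qed.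
HB.instance Definition _ := hasStar.Build C ct_vn starfunK starfunD starfunZ starfunM.

Lemma ct_vn_range : range (ct_vn_val : ct_vn -> bop H) = commutant [set conjJ S | S in M].
Proof.
apply/seteqP; split=> T.
  by move=> [U _ <-] _ [S Sm <-]; have /ct_vn_predP := ct_vnP U; exact.
move=> TB; have TP : T \in ct_vn_pred by apply/ct_vn_predP => S Sm; apply: TB; exists S.
by exists (CtVn TP).
Qed.

(** A commutant equals its own bicommutant; for this reason the von Neumann algebra is introduced as
    a commutant. *)
Lemma commutant3 (X : set (bop H)) : commutant (commutant (commutant X)) = commutant X.
Proof.
apply/seteqP; split=> T TX S SX; last by rewrite SX.
by apply: TX => U UX; rewrite UX.
Qed.

Definition ct_rep (T : ct_vn) : bop H := ct_vn_val T.

Let ct_rep_linear : linear ct_rep.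
Proof. by []. Qed.
HB.instance Definition _ := GRing.isLinear.Build C ct_vn (bop H) *:%R ct_rep ct_rep_linear.
Let ct_rep_monoid : monoid_morphism ct_rep.
Proof. by []. Qed.
HB.instance Definition _ := GRing.isMonoidMorphism.Build ct_vn (bop H) ct_rep ct_rep_monoid.

Lemma ct_vn_bicommutant :
  commutant (commutant (range ct_rep)) = range ct_rep.
Proof. by rewrite [range _]ct_vn_range commutant3. Qed.

Definition ct_vnAlgebra : vnAlgebra R :=
  @VNAlgebra R ct_vn H ct_rep (fun=> erefl) val_inj ct_vn_bicommutant.

Definition ct_state (T : ct_vnAlgebra) : C := << (T : ct_vn) O, O >>.

Lemma ct_state_scalar : scalar ct_state.
Proof. by move=> c S T; rewrite /ct_state innerDl innerZl. Qed.
HB.instance Definition _ := GRing.isLinear.Build C ct_vnAlgebra C *%R ct_state ct_state_scalar.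

Definition ct_psi : {scalar ct_vnAlgebra} := ct_state.

Lemma ct_psiE (T : ct_vn) : ct_psi T = << T O, O >>. Proof. by []. Qed.

Lemma ct_tracial : tracial ct_psi.
Proof.
move=> S T; rewrite !ct_psiE.
have mulE (U W : ct_vn) : (U * W : ct_vn) O = U (W O) by [].
rewrite !mulE (bop_star_adj _ ((T : ct_vn) O)) (bop_star_adj _ ((S : ct_vn) O)).
rewrite !ct_vn_star_vec ?ct_vnP //.
by rewrite -[in LHS](modJK ((T : ct_vn) O)) modJ_inner.
Qed.

Lemma ct_normal : normal ct_psi.
Proof.
move=> E a _ lim e e0; have [d0 Ed0 dP] := lim O e e0; exists d0 => // d Ed dd0.
have -> : ct_psi d - ct_psi a = << (d : ct_vn) O - (a : ct_vn) O, O >>.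
  by rewrite innerBl.
apply: le_lt_trans (hilbert_CauchySchwarz _ _) _.
have O1 : `|O| = 1.
  by apply/eqP; rewrite -(@eqrXn2 _ 2) // expr1n innerE ct_unit.
by rewrite O1 mulr1; exact: dP.
Qed.

Lemma ct_faithful_state : faithful_normal_tracial_state ct_psi.
Proof.
split.
- split; first exact: ct_unit.
  move=> T; rewrite ct_psiE -[(star T * T : ct_vn) O]/(star (ct_rep T) ((T : ct_vn) O)).
  by rewrite bop_star_adj starK -innerE exprn_ge0.
- move=> T; rewrite ct_psiE -[(star T * T : ct_vn) O]/(star (ct_rep T) ((T : ct_vn) O)).
  rewrite bop_star_adj starK -innerE => /eqP; rewrite sqrf_eq0 normr_eq0 => /eqP TO.
  by apply: val_inj; exact: ct_vn_sep (ct_vnP T) TO.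
- exact: ct_normal.
- exact: ct_tracial.
Qed.

Definition ct_L2vec (T : ct_vnAlgebra) : H := (T : ct_vn) O.

Lemma ct_L2vec_linear : linear ct_L2vec.
Proof. by []. Qed.
HB.instance Definition _ := GRing.isLinear.Build C ct_vnAlgebra H *:%R ct_L2vec ct_L2vec_linear.

Lemma ct_L2inner (a b : ct_vnAlgebra) :
  << ct_L2vec a, ct_L2vec b >> = ct_psi (star b * a).
Proof.
rewrite ct_psiE -[(star b * a : ct_vn) O]/(star (ct_rep b) ((a : ct_vn) O)).
by rewrite bop_star_adj starK.
Qed.

Lemma ct_L2dense : dense (range ct_L2vec).
Proof.
move=> U [f Uf] oU; have /nbhs_ballP [e e0 eU] := open_nbhs_nbhs (conj oU Uf).
have [S Sm Se] := ct_cyclic f e0; exists (S O); split.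
  by apply: eU; rewrite -ball_normE.
by exists (CtVn (ct_alg_vn Sm)).
Qed.

Definition ct_L2left (T : ct_vnAlgebra) : bop H := (T : ct_vn).
Definition ct_L2right (T : ct_vnAlgebra) : bop H := conjJ (star (ct_rep T)).

Lemma ct_L2leftE (a b : ct_vnAlgebra) : ct_L2left a (ct_L2vec b) = ct_L2vec (a * b).
Proof. by []. Qed.

Lemma ct_L2rightE (a b : ct_vnAlgebra) : ct_L2right a (ct_L2vec b) = ct_L2vec (b * a).
Proof.
rewrite /ct_L2right /ct_L2vec conjJE -ct_vn_star_vec ?ct_vnP //.
rewrite -bop_mulE -starM -[star (_ * _)]/(star (val ((b : ct_vn) * (a : ct_vn)))).
by rewrite ct_vn_star_vec ?modJK // -[val _]/(ct_vn_val (b * a : ct_vn)) ct_vnP.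
Qed.

Definition ct_L2 : L2space ct_psi :=
  @L2Space R ct_vnAlgebra ct_psi H ct_L2vec ct_L2inner ct_L2dense
    ct_L2left ct_L2leftE ct_L2right ct_L2rightE.
End ModularConjugation.

(** * The vacuum state on words is a trace *)

Arguments cen : simpl never.
Section WordTrace.
Variables (R : realType) (A : tracialAlgebra R).
Local Notation C := R[i].
Local Notation phi := (ta_tr A).
Local Notation word := (word A).
Local Notation E := (word_space A).
Local Notation K := (completion_hilbert E).
Local Notation dl := (@delta R _).
Local Notation ket := (@ket R A).
Local Notation Uop := (Uop A).
Local Notation Lop := (@Lop R A).

Inductive gen : bop K -> Prop :=
| gen_Lop a : gen (Lop a)
| gen_Uop e : gen (Uop e)
| gen_lin (c : C) S T : gen S -> gen T -> gen (c *: S + T)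
| gen_mul S T : gen S -> gen T -> gen (S * T).

Lemma gen_1 : gen 1.
Proof. by rewrite -(Lop1 A); exact: gen_Lop. Qed.

Lemma gen_star T : gen T -> gen (star T).
Proof.
elim=> [a|e|c S T' _ IS _ IT|S T' _ IS _ IT].
- by rewrite star_Lop; exact: gen_Lop.
- by rewrite star_Uop; exact: gen_Uop.
- by rewrite starD starZ; exact: gen_lin.
- by rewrite starM; exact: gen_mul.
Qed.

Definition vac : K := ket (empty_word A).

Lemma gen_cyclic_ket x : exists2 T, gen T & T vac = ket x.
Proof.
case: x => a r; have [n] := ubnP (size r); elim: n a r => // n IH a [|[e b] r] /= rn.
  by exists (Lop a); [exact: gen_Lop|rewrite /vac Lop_ket /= mulr1].
have [S Sg SE] := IH b r rn.
pose T := Lop a * (Uop e * S); have Tg : gen T.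
  by apply: gen_mul; [exact: gen_Lop|apply: gen_mul => //; exact: gen_Uop].
have TE : T vac = Lop a (Uop e (ket (b, r))) by rewrite -SE.
case: r rn S Sg SE T Tg TE => [|[f c] r] rn S Sg SE T Tg TE.
  by exists T => //; rewrite TE Uop_ket addr0 Lop_ket /= mulr1.
have [fe|fe] := eqVneq f e.
  by exists T => //; rewrite TE Uop_ket fe eqxx addr0 Lop_ket /= mulr1.
(* Opposite exponents: [T vac] exceeds the word by a multiple of a shorter one, which the induction
   hypothesis also reaches. *)
have [|S' S'g S'E] := IH (a * cen f c r) r; first exact: ltnW.
exists ((- phi b) *: S' + T); first exact: gen_lin.
rewrite -[LHS]/((- phi b) *: S' vac + T vac) TE S'E Uop_ket (negPf fe) bopD bopZ.
by rewrite !Lop_ket /= mulr1 addrC scaleNr addrK.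
Qed.

Lemma gen_0 : gen 0.
Proof. by rewrite -[0](addNr 1) -scaleN1r; apply: gen_lin; exact: gen_1. Qed.

Lemma gen_cyclic (v : E) : exists2 T, gen T & T vac = embed v.
Proof.
rewrite embedS; elim/big_rec: _ => [|p f _ [T Tg <-]]; first by exists 0; [exact: gen_0|].
have [S Sg <-] := gen_cyclic_ket p.2.
by exists (p.1 *: S + T); first exact: gen_lin.
Qed.

Lemma embed_flin_flin T T' (v : E) :
  embed (flin T' (flin T v) : E) = \sum_(p <- v) p.1 *: embed (flin T' (T p.2) : E) :> K.
Proof.
apply: completion_ext => w; rewrite embedE /= kform_flin_flin.
elim: v => [|p v IH]; first by rewrite !big_nil.
by rewrite !big_cons IH completion_appP embedE.
Qed.

Lemma bop_sum (T : bop K) I (r : seq I) (c : I -> C) (f : I -> K) :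
  T (\sum_(i <- r) c i *: f i) = \sum_(i <- r) c i *: T (f i).
Proof. by elim/big_rec2: _ => [|i x y _ IH]; rewrite ?bop0 // bopP IH. Qed.

Lemma inner_embedl (v : E) g : inner K (embed v) g = \sum_(p <- v) p.1 * inner K (ket p.2) g.
Proof.
rewrite embedS; elim/big_rec2: _ => [|p x y _ IH]; first exact: linear0l.
by rewrite linearDl /= IH linearZl_LR.
Qed.

Definition vac_state (T : bop K) : C := inner K (T vac) vac.

(* [rho] is right multiplication by [c], known only on formal sums of words: it
   need not a priori be compatible with the null vectors of the form. *)
Lemma right_mult_trace (rho : word -> seq (C * word)) (c : bop K) :
  (forall e x, Uop e (embed (rho x : E)) = embed (flin rho (Uw e x) : E)) ->
  (forall a x, Lop a (embed (rho x : E)) = embed (flin rho (Lw a x) : E)) ->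
  (forall x, inner K (embed (rho x : E)) vac = inner K (ket x) (star c vac)) ->
  c vac = embed (rho (empty_word A) : E) ->
  forall T, gen T -> vac_state (T * c) = vac_state (c * T).
Proof.
move=> rU rL rad rvac.
(* [T] is followed on formal sums: one and the same [v'] represents [T] on [v] and, after [rho], [T]
   on the image of [v] under [rho]. So [T] commutes with [rho] although [rho] is not an operator. *)
have inv T : gen T -> forall v : E, exists v' : E, T (embed v) = embed v' /\
    T (embed (flin rho v : E)) = embed (flin rho v' : E).
  elim=> [a v|e v|d S T' _ IS _ IT v|S T' _ IS _ IT v].
  - exists (flin (Lw a) v); rewrite Lop_embed; split=> //.
    rewrite embed_flin bop_sum embed_flin_flin.
    by apply: eq_bigr => p _; rewrite rL.
  - exists (flin (Uw e) v); rewrite Uop_embed; split=> //.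
    rewrite embed_flin bop_sum embed_flin_flin.
    by apply: eq_bigr => p _; rewrite rU.
  - have [s [s1 s2]] := IS v; have [t [t1 t2]] := IT v.
    exists (fscale d s ++ t : E).
    rewrite !bop_linE s1 t1 s2 t2 embed_cat embed_scale; split=> //.
    rewrite [in RHS]/flin map_cat flatten_cat embed_cat; congr (_ + _).
    rewrite -[flatten _]/(flin rho (fscale d s)) !embed_flin big_map scaler_sumr.
    by apply: eq_bigr => p _; rewrite scalerA.
  - have [t [t1 t2]] := IT v; have [s [s1 s2]] := IS t.
    by exists s; rewrite !bop_mulE t1 t2.
move=> T /inv/(_ (dl (empty_word A))) [v' [vE v'E]].
rewrite /vac_state !bop_mulE rvac.
have -> : embed (rho (empty_word A) : E) = embed (flin rho (dl (empty_word A)) : E) :> K.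
  by rewrite embed_flin big_seq1 scale1r.
rewrite v'E -[T vac]/(T (embed _)) vE embed_flin.
rewrite -[c]starK -[star (star c) _]/(bop_adj (star c) _) bop_adjP' inner_embedl.
transitivity (\sum_(p <- v') p.1 * inner K (embed (rho p.2 : E)) vac).
  elim/big_rec2: _ => [|p x y _ IH]; first exact: linear0l.
  by rewrite linearDl /= -IH linearZl_LR.
by apply: eq_bigr => p _; rewrite rad.
Qed.

(** Right multiplication by u^f. Letters are replaced by their centred versions on the way, because
    a cancellation at the end may remove the exponent that forced the centring. *)
Fixpoint rUr (f : bool) (a : A) (r : seq (bool * A)) : seq (C * word) :=
  if r is (e, b) :: s then
    [seq (p.1, (a, (e, p.2.1) :: p.2.2)) | p <- rUr f (cen e b s) s] ++
    (if s is [::] then if e == f then [::] else [:: (phi b, (a, [::]))] else [::])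
  else [:: (1, (a, [:: (f, 1)]))].

Definition rU f (x : word) := rUr f x.1 x.2.

Fixpoint rLr (c a : A) (r : seq (bool * A)) : word :=
  if r is (e, b) :: s then let y := rLr c (cen e b s) s in (a, (e, y.1) :: y.2)
  else (a * c, [::]).

Definition rL c (x : word) : seq (C * word) := dl (rLr c x.1 x.2).

Lemma embed_dlE x : embed (dl x : E) = ket x. Proof. by []. Qed.

Lemma ket_cen_swap a e b f c d r s :
  ket (a, (e, cen e b ((f, c) :: r)) :: (f, d) :: s) = ket (a, (e, b) :: (f, d) :: s).
Proof. by rewrite -[RHS]ket_cen. Qed.

Lemma flin_dl T x : embed (flin T (dl x) : E) = embed (T x : E) :> K.
Proof. by rewrite embed_flin big_seq1 scale1r. Qed.

Lemma flin_Uw_embed T e a r : embed (flin T (Uw e (a, r)) : E) =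
  embed (T (1, (e, a) :: r) : E) +
  (if r is (f, b) :: s then if f == e then 0 else phi a *: embed (T (cen f b s, s) : E)
   else 0) :> K.
Proof.
rewrite embed_flin big_cons scale1r; congr (_ + _).
case: r => [|[f b] s]; first by rewrite big_nil.
by rewrite /=; case: ifP => _; rewrite ?big_nil ?big_seq1.
Qed.

Lemma rL_Lop c a x : Lop a (embed (rL c x : E)) = embed (flin (rL c) (Lw a x) : E).
Proof.
rewrite flin_dl /rL !embed_dlE Lop_ket; case: x => b [|[e d] r] //=.
by rewrite mulrA.
Qed.

Lemma rL_Uop c e x : Uop e (embed (rL c x : E)) = embed (flin (rL c) (Uw e x) : E).
Proof.
case: x => a r; rewrite flin_Uw_embed /rL !embed_dlE /=.
case: r => [|[f b] r]; first by rewrite /= Uop_ket.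
rewrite [rLr c a _]/= Uop_ket; congr (_ + _).
  by rewrite [rLr _ _ _]/= ket_cen_swap.
case: ifP => // _; congr (_ *: ket _).
case: r => [|[g d] r] //=.
by rewrite cen_idem.
Qed.

Lemma inner_ket x y : inner K (ket x) (ket y) = kw x y.
Proof. by rewrite inner_embed embedE /= kform_dl. Qed.

Lemma rL_adj c x : inner K (embed (rL c x : E)) vac = inner K (ket x) (star (Lop c) vac).
Proof.
rewrite star_Lop Lop_ket embed_dlE !inner_ket; case: x => a [|[e b] r] /=.
  by rewrite /kw /= !mulr1 ip1r /ip starK ta_trC.
by rewrite /kw /= !mulr0.
Qed.

Lemma Lop_trace c T : gen T -> vac_state (T * Lop c) = vac_state (Lop c * T).
Proof.
apply: (right_mult_trace (rL_Uop c) (rL_Lop c) (rL_adj c)).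
by rewrite Lop_ket embed_dlE /= mul1r mulr1.
Qed.

Lemma rU_Lop f a x : Lop a (embed (rU f x : E)) = embed (flin (rU f) (Lw a x) : E).
Proof.
rewrite flin_dl !embedS bop_sum; case: x => b [|[e d] r] //=.
  by rewrite !big_seq1 Lop_ket.
rewrite !big_cat !big_map; congr (_ + _).
  by apply: eq_bigr => p _; rewrite Lop_ket.
case: r => [|_ _]; last by rewrite !big_nil.
by case: ifP => _; rewrite ?big_nil ?big_seq1 // Lop_ket.
Qed.

(* Comparing the two ways of reading [a1], as an inner letter or as the first one. *)
Lemma rUr_cen f e b r : embed (rUr f (cen e b r) r : E) =
  \sum_(p <- rUr f (cen e b r) r) p.1 *: ket (cen e p.2.1 p.2.2, p.2.2) +
  (if r is [::] then if e == f then 0 else phi b *: ket (1, [:: (f, 1)]) else 0) :> K.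
Proof.
rewrite embedS; case: r => [|[g d] r].
  rewrite !big_seq1 !scale1r /= cen_nil; case: (eqVneq e f) => [->|ef].
    by rewrite addr0 cen_same.
  by rewrite addrC -ket_linear cen_neq 1?eq_sym // addrC subrK.
rewrite addr0 [rUr f _ _]/= !big_cat !big_map; congr (_ + _).
  apply: eq_bigr => p _ /=.
  by rewrite cen_idem.
case: r => [|_ _]; last by rewrite !big_nil.
by case: ifP => _; rewrite ?big_nil ?big_seq1.
Qed.

Lemma ket_linear2 (c : C) x e a b :
  ket (x, [:: (e, c *: a + b)]) = c *: ket (x, [:: (e, a)]) + ket (x, [:: (e, b)]).
Proof.
apply: completion_ext => w; rewrite completion_appP !embedE /= /kform !big_seq1.
rewrite mulr_sumr -big_split; apply: eq_bigr => -[q [y s]] _ /=.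
rewrite /kw; case: s => [|[g d] s]; first by rewrite /=; ring.
by rewrite /= !cen_nil ipDl ipZl; ring.
Qed.

Lemma rU_Uop f e x : Uop e (embed (rU f x : E)) = embed (flin (rU f) (Uw e x) : E).
Proof.
case: x => a r; rewrite flin_Uw_embed /rU /=.
case: r => [|[g b] r].
  rewrite [rUr f _ _]/= embed_dlE Uop_ket cen_nil [RHS]addr0 [RHS]embedS big_cons scale1r.
  congr (_ + _); rewrite eq_sym.
  by case: ifP => _; rewrite ?big_nil ?big_seq1.
set F := rUr f (cen g b r) r.
(* The terms in which the last exponent cancels against u^f at this level; there is one only if the
   word has a single exponent, opposite to [f]. *)
pose X := if r is [::] then if g == f then [::] else [:: (phi b, [::])] else [::] : seq (C * seq (bool * A)).
have rE c : rUr f c ((g, b) :: r) = [seq (p.1, (c, (g, p.2.1) :: p.2.2)) | p <- F] ++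
    [seq (p.1, (c, p.2)) | p <- X].
  by rewrite [LHS]/= -/F /X; case: (r) => //; case: ifP.
have XE : \sum_(p <- X) p.1 *: ket (1, [:: (f, 1)]) =
    (if r is [::] then if g == f then 0 else phi b *: ket (1, [:: (f, 1)]) else 0).
  by rewrite /X; case: (r) => [|_ _]; rewrite ?big_nil //; case: ifP => _; rewrite ?big_nil ?big_seq1.
have X0 p : p \in X -> p.2 = [::] /\ g != f.
  rewrite /X; case: (r) => [|//]; case: (eqVneq g f) => // _.
  by rewrite inE => /eqP ->.
rewrite cats0.
rewrite !rE !embedS bop_sum !big_map !big_cat !big_map /=.
under [X in X + _ = _]eq_bigr do rewrite Uop_ket scalerDr.
under [X in _ + X = _]eq_big_seq => p pX.
  rewrite (X0 p pX).1 Uop_ket addr0. over.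
under [X in _ = _ + X + _]eq_big_seq => p pX.
  rewrite (X0 p pX).1. over.
under [X in _ = X + _ + _]eq_bigr do rewrite ket_cen_swap.
rewrite big_split /= -!addrA; congr (_ + _).
case: (eqVneq g e) => [ge|ge].
  rewrite big1 ?add0r; last by move=> p _; rewrite scaler0.
  by rewrite addr0 {1}ge cen_same.
have rc := rUr_cen f g b r; rewrite -/F embedS -XE in rc; rewrite rc cen_neq // scalerDr !scaler_sumr.
rewrite [RHS]addrCA; congr (_ + _).
  by apply: eq_bigr => p _; rewrite !scalerA mulrC.
rewrite -big_split; apply: eq_big_seq => p pX /=.
(* Both differ from [g], and there are only two exponents. *)
have -> : f = e.
  by have [_] := X0 p pX; case: (g) (e) (f) ge => [] [] [].
rewrite scalerA [phi a * _]mulrC -scalerA -scalerDr; congr (_ *: _).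
by rewrite [RHS]addrC -ket_linear2 [_ + (a - _)]addrC subrK.
Qed.

Lemma rU_adj f x : inner K (embed (rU f x : E)) vac = inner K (ket x) (star (Uop f) vac).
Proof.
rewrite star_Uop Uop_ket addr0 inner_ket inner_embedl /rU.
have nil0 a r : r != [::] -> inner K (ket (a, r)) vac = 0.
  by rewrite inner_ket /kw; case: r => // -[? ?] ? _; rewrite mulr0.
case: x => a [|[e b] r]; first by rewrite big_seq1 nil0 // mulr0 /kw mulr0.
rewrite /= big_cat big_map big1 ?add0r; last by move=> p _; rewrite nil0 ?mulr0.
rewrite [LHS]add0r; case: r => [|[g d] r]; last by rewrite big_nil /kw /= !mulr0.
rewrite /kw /= ?cen_nil ip1r.
have [ef|ef] := eqVneq e f.
  by rewrite big_nil ef; case: (f); rewrite !mul0r mulr0.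
rewrite big_seq1 inner_ket /kw /= !ip1r !mulr1.
have -> : e = ~~ f by case: (e) (f) ef => [] [].
by rewrite eqxx mul1r mulrC.
Qed.

Lemma Uop_trace f T : gen T -> vac_state (T * Uop f) = vac_state (Uop f * T).
Proof.
apply: (right_mult_trace (rU_Uop f) (rU_Lop f) (rU_adj f)).
by rewrite Uop_ket addr0 embed_dlE.
Qed.

Lemma vac_state_lin (c : C) S T : vac_state (c *: S + T) = c * vac_state S + vac_state T.
Proof. by rewrite /vac_state bop_linE linearDl linearZl_LR. Qed.

Lemma vac_trace S T : gen S -> gen T -> vac_state (S * T) = vac_state (T * S).
Proof.
move=> Sg Tg; elim: Tg S Sg => [a S Sg|e S Sg|c T1 T2 _ IT _ IT' S Sg|T1 T2 Tg1 IT Tg2 IT' S Sg].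
- exact: Lop_trace.
- exact: Uop_trace.
- by rewrite mulrDr mulrDl -scalerAr -scalerAl !vac_state_lin IT ?IT'.
- by rewrite mulrA IT' ?mulrA ?IT //; apply: gen_mul.
Qed.
End WordTrace.

(** * Adjoining a free Haar unitary *)

Section FreeHaar.
Variables (R : realType) (A : vnAlgebra R) (phi : {scalar A}).
Hypothesis hphi : faithful_normal_tracial_state phi.
Variable V : L2space phi.
Local Notation C := R[i].

Lemma L2_phi_star a : phi (star a) = (phi a)^*.
Proof.
have -> : phi (star a) = inner V (L2vec V 1) (L2vec V a) by rewrite L2_inner mulr1.
by rewrite innerC L2_inner star1 mul1r.
Qed.

Lemma L2_norm a : `|L2vec V a| ^+ 2 = phi (star a * a).
Proof. by rewrite innerE L2_inner. Qed.

Lemma L2_left_bound a : exists2 M : C, 0 <= M &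
  forall b, phi (star (a * b) * (a * b)) <= M * phi (star b * b).
Proof.
have [M M0 MP] := bounded_opP (bop_bounded (L2_left V a)).
exists (M ^+ 2) => [|b]; first exact: exprn_ge0.
rewrite -!L2_norm -exprMn -L2_leftE lerXn2r ?nnegrE ?mulr_ge0 // MP.
Qed.

Lemma vn_trC a b : phi (a * b) = phi (b * a). Proof. by case: hphi => _ _ _. Qed.
Lemma vn_tr1 : phi 1 = 1. Proof. by case: hphi => -[]. Qed.
Lemma vn_tr_ge0 a : 0 <= phi (star a * a). Proof. by case: hphi => -[]. Qed.

Definition vn_bound a : C := s2val (cid2 (L2_left_bound a)).

Definition vn_tracialAlgebra : tracialAlgebra R :=
  @TracialAlgebra R A phi vn_bound vn_tr1 vn_tr_ge0 L2_phi_star vn_trC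
    (fun a => s2valP (cid2 (L2_left_bound a))) (fun a => s2valP' (cid2 (L2_left_bound a))).
Local Notation TA := vn_tracialAlgebra.
Local Notation K := (completion_hilbert (word_space TA)).
Local Notation ket := (@ket R TA).

Lemma word_cyclic (f : K) (e : C) : 0 < e -> exists2 T, gen T & `|f - T (vac TA)| < e.
Proof.
move=> e0; have [v vP] := embed_dense f e0.
by have [T Tg TE] := gen_cyclic v; exists T => //; rewrite TE.
Qed.

Lemma vac_unit : inner K (vac TA) (vac TA) = 1.
Proof. by rewrite inner_ket /kw /= ip1r ta_tr1 mulr1. Qed.

Definition word_cyclicTrace : cyclicTrace R :=
  @CyclicTrace R K (@gen R TA) (vac TA) (@gen_lin R TA) (@gen_mul R TA) (@gen_star R TA)
    (gen_1 TA) vac_unit word_cyclic (@vac_trace R TA).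
Local Notation D := word_cyclicTrace.
Local Notation B := (ct_vnAlgebra D).
Local Notation psi := (ct_psi D).

Definition mk_vn (T : bop K) (Tg : gen T) : ct_vn D := CtVn (ct_alg_vn (D := D) Tg).

Definition haar_j (a : A) : B := mk_vn (gen_Lop (a : TA)).

Let haar_j_linear : linear haar_j.
Proof. by move=> c a b; apply: val_inj; exact: Lop_linear. Qed.
HB.instance Definition _ := GRing.isLinear.Build C A B *:%R haar_j haar_j_linear.
Let haar_j_monoid : monoid_morphism haar_j.
Proof. by split=> [|a b]; apply: val_inj; [exact: Lop1|exact: LopM]. Qed.
HB.instance Definition _ := GRing.isMonoidMorphism.Build A B haar_j haar_j_monoid.

Definition haar_u (e : bool) : B := mk_vn (gen_Uop TA e).

Lemma haar_jE a f : (haar_j a : ct_vn D) f = Lop (a : TA) f. Proof. by []. Qed.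

Lemma haar_j_star a : haar_j (star a) = star (haar_j a).
Proof. by apply: val_inj; rewrite /= -star_Lop. Qed.

Lemma haar_u_star e : star (haar_u e) = haar_u (~~ e).
Proof. by apply: val_inj; rewrite /= -star_Uop. Qed.

Lemma haar_uK e : haar_u (~~ e) * haar_u e = 1.
Proof. by apply: val_inj; exact: UopK. Qed.

Lemma haar_psi_j a : psi (haar_j a) = phi a.
Proof. by rewrite ct_psiE haar_jE Lop_ket /= inner_ket /kw /= mulr1 ip1r mulr1. Qed.

Inductive vspan (P : word TA -> Prop) : K -> Prop :=
| vspan0 : vspan P 0
| vspan_add (c : C) x f : P x -> vspan P f -> vspan P (c *: ket x + f).

Lemma vspanP P (c : C) f g : vspan P f -> vspan P g -> vspan P (c *: f + g).
Proof.
move=> fP gP; elim: fP => [|d x h Px _ IH]; first by rewrite scaler0 add0r.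
by rewrite scalerDr scalerA -addrA; exact: vspan_add.
Qed.

Lemma vspan_ket P x : P x -> vspan P (ket x).
Proof. by move=> Px; rewrite -[ket x]addr0 -[ket x]scale1r; apply: vspan_add => //; exact: vspan0. Qed.

Lemma vspan_bop P Q (T : bop K) f :
  (forall x, P x -> vspan Q (T (ket x))) -> vspan P f -> vspan Q (T f).
Proof.
move=> PQ; elim=> [|c x g Px _ IH]; first by rewrite bop0; exact: vspan0.
by rewrite bopP; apply: vspanP => //; exact: PQ.
Qed.

Lemma vspan_sub P Q f : (forall x, P x -> Q x) -> vspan P f -> vspan Q f.
Proof.
move=> PQ; elim=> [|c x g Px _ IH]; first exact: vspan0.
by apply: vspan_add => //; exact: PQ.
Qed.

(** The types of words in the freeness argument: starting from the vacuum, centred Laurent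
    polynomials in u produce combinations of [u_word]s, and centred elements of the algebra turn
    these into [a_word]s; both types are orthogonal to the vacuum. *)
Definition u_word (x : word TA) := x.1 = 1 /\ x.2 != [::].
Definition a_word (x : word TA) := phi x.1 = 0.
Definition e_word (x : word TA) := x = empty_word TA.

Lemma u_word_orth f : vspan u_word f -> inner K f (vac TA) = 0.
Proof.
elim=> [|c x g [_ x2] _ IH]; first exact: linear0l.
rewrite innerDl innerZl IH inner_ket /kw.
by case: (x.2) x2 => // -[? ?] ? _; rewrite !mulr0 addr0.
Qed.

Lemma a_word_orth f : vspan a_word f -> inner K f (vac TA) = 0.
Proof.
elim=> [|c x g x1 _ IH]; first exact: linear0l.
by rewrite innerDl innerZl IH inner_ket /kw /= ip1r x1 mul0r mulr0 addr0.
Qed.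

Lemma Lop_vspan a f : phi a = 0 ->
  vspan (fun x => u_word x \/ e_word x) f -> vspan a_word (Lop (a : TA) f).
Proof.
move=> a0; apply: vspan_bop => x xP; rewrite Lop_ket; apply: vspan_ket.
by rewrite /a_word /=; case: xP => [[->]|->] /=; rewrite mulr1.
Qed.

Definition ue_word e (x : word TA) := x.1 = 1 /\ exists b s, x.2 = (e, b) :: s.

(** Nothing cancels: at the first application the leading letter is centred or the word is empty,
    and afterwards the leading exponent is already [e]. *)
Lemma Uop_vspan e n f : vspan (fun x => a_word x \/ e_word x) f ->
  vspan (ue_word e) ((haar_u e ^+ n.+1 : ct_vn D) f).
Proof.
move=> fP; have U1 g : (haar_u e ^+ 1 : ct_vn D) g = Uop TA e g by [].
have US m g : (haar_u e ^+ m.+2 : ct_vn D) g = Uop TA e ((haar_u e ^+ m.+1 : ct_vn D) g).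
  by rewrite exprS.
elim: n => [|n IH].
  rewrite U1; apply: vspan_bop fP => -[a r] [a0|[-> ->]]; rewrite Uop_ket; last first.
    by rewrite addr0; apply: vspan_ket; split=> //; exists 1, [::].
  have -> : (if r is (f0, b) :: s then if f0 == e then 0 else
      ta_tr TA a *: ket (cen f0 b s, s) else 0) = 0.
    by case: (r) => [|[g b] s] //; case: ifP => // _; rewrite [ta_tr _ _]a0 scale0r.
  by rewrite addr0; apply: vspan_ket; split=> //; exists a, r.
rewrite US; apply: vspan_bop IH => -[_ _] [/= -> [b [s ->]]].
rewrite Uop_ket eqxx addr0; apply: vspan_ket; split=> //.
by exists 1, ((e, b) :: s).
Qed.

Lemma ue_u_word e x : ue_word e x -> u_word x.
Proof. by move=> [x1 [b [s x2]]]; split=> //; rewrite x2. Qed.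

Lemma e_word_vac : vspan e_word (vac TA). Proof. exact: vspan_ket. Qed.

Lemma haar_moment e n : psi (haar_u e ^+ n.+1) = 0.
Proof.
rewrite ct_psiE; apply: u_word_orth; apply: (vspan_sub (@ue_u_word e)).
by apply/Uop_vspan/(vspan_sub _ e_word_vac); right.
Qed.

(** Laurent polynomials in u, since [haar_u false] is the inverse of [haar_u true]. *)
Inductive laurent : B -> Prop :=
| laurent0 : laurent 0
| laurent_add (c : C) e n T : laurent T -> laurent (c *: haar_u e ^+ n + T).

Lemma laurentP (c : C) S T : laurent S -> laurent T -> laurent (c *: S + T).
Proof.
move=> SP TP; elim: SP => [|d e n P _ IH]; first by rewrite scaler0 add0r.
by rewrite scalerDr scalerA -addrA; exact: laurent_add.
Qed.

Lemma laurentX e n : laurent (haar_u e ^+ n).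
Proof.
rewrite -[_ ^+ _]addr0 -[_ ^+ _]scale1r; apply: laurent_add; exact: laurent0.
Qed.

Lemma laurentXX e f n m : laurent (haar_u e ^+ n * haar_u f ^+ m).
Proof.
have [->|ef] := eqVneq e f; first by rewrite -exprD; exact: laurentX.
have {ef} -> : e = ~~ f by case: e f ef => [] [].
elim: n m => [|n IH] [|m]; rewrite ?mul1r ?mulr1; try exact: laurentX.
rewrite exprSr exprS -mulrA [haar_u (~~ f) * _]mulrA haar_uK mul1r.
exact: IH.
Qed.

Lemma laurent_star_subalgebra : star_subalgebra laurent.
Proof.
split.
- by rewrite -[1](expr0 (haar_u true)); exact: laurentX.
- by move=> c a b; exact: laurentP.
- move=> S T SP TP; elim: SP => [|c e n S' _ IH]; first by rewrite mul0r; exact: laurent0.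
  rewrite mulrDl -scalerAl; apply: laurentP IH.
  elim: TP => [|d f m T' _ IH]; first by rewrite mulr0; exact: laurent0.
  by rewrite mulrDr -scalerAr; apply: laurentP => //; exact: laurentXX.
- move=> T; elim=> [|c e n T' _ IH]; first by rewrite star0; exact: laurent0.
  rewrite starD starZ; apply: laurentP => //.
  have -> : star (haar_u e ^+ n) = haar_u (~~ e) ^+ n; last exact: laurentX.
  elim: n => [|n IHn]; first exact: star1.
  by rewrite exprS starM IHn haar_u_star -exprSr.
Qed.

(** The constant coefficient of a Laurent polynomial is its mean; the other powers send the given
    words to words beginning with a power of u. *)
Lemma laurent_vspan T f : laurent T -> vspan (fun x => a_word x \/ e_word x) f ->
  exists2 g, vspan u_word g & (T : ct_vn D) f = psi T *: f + g.
Proof.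
move=> TP fP; elim: TP => [|c e n T' _ [g gP gE]].
  by exists 0; [exact: vspan0|rewrite linear0 scale0r addr0].
have TE : (c *: haar_u e ^+ n + T' : ct_vn D) f =
  c *: (haar_u e ^+ n : ct_vn D) f + (T' : ct_vn D) f by [].
rewrite TE linearP gE; case: n {TE} => [|n].
  exists g => //; have p1 : psi 1 = 1 by have [[]] := ct_faithful_state D.
  rewrite expr0 p1 -[(1 : ct_vn D) f]/f addrA -scalerDl; congr (_ *: f + _).
  by rewrite mulr1.
exists (c *: (haar_u e ^+ n.+1 : ct_vn D) f + g).
  by apply: vspanP gP; apply: (vspan_sub (@ue_u_word e)); exact: Uop_vspan.
by rewrite haar_moment mulr0 add0r addrCA.
Qed.

Lemma haar_free x y : star_free2 psi [set haar_u true] [set haar_j x; haar_j y].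
Proof.
move=> n i a n0 aP alt.
have aT k : (k < n)%N -> i k = true -> laurent (a k).
  move=> kn ik; have [ak _] := aP k kn; rewrite ik in ak.
  apply: ak; first exact: laurent_star_subalgebra.
  by move=> _ ->; rewrite -[haar_u _]expr1; exact: laurentX.
have aF k : (k < n)%N -> i k = false -> exists b, a k = haar_j b.
  move=> kn ik; have [ak _] := aP k kn; rewrite ik in ak.
  suff [b _ <-] : range haar_j (a k) by exists b.
  apply: ak; last by move=> _ [->|->]; [exists x|exists y].
  split.
  - by exists 1 => //; rewrite rmorph1.
  - by move=> c _ _ [b _ <-] [d _ <-]; exists (c *: b + d) => //; rewrite linearP.
  - by move=> _ _ [b _ <-] [d _ <-]; exists (b * d) => //; rewrite rmorphM.
  - by move=> _ [b _ <-]; exists (star b) => //; rewrite haar_j_star.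
(* [f m] is the tail of the product from the factor [m] on, applied to the vacuum; its type
   alternates with [i m]. *)
pose f m : K := (\prod_(m <= k < n) a k : ct_vn D) (vac TA).
have fn : vspan e_word (f n) by rewrite /f big_geq //; exact: e_word_vac.
have fP d m : (m + d.+1)%N = n -> vspan (if i m then u_word else a_word) (f m).
  elim: d m => [|d IH] m mn.
    have mn' : (m < n)%N by rewrite -mn addn1.
    have -> : f m = (a m : ct_vn D) (f m.+1) by rewrite /f big_ltn.
    have {}fn : vspan e_word (f m.+1) by rewrite -addn1 mn.
    case ik: (i m).
      have [|g gP ->] := laurent_vspan (aT m mn' ik) (f := f m.+1).
        by apply: vspan_sub fn => ? ?; right.
      by rewrite (aP m mn').2 scale0r add0r.
    have [b bE] := aF m mn' ik; rewrite bE haar_jE; apply: Lop_vspan.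
      by rewrite -haar_psi_j -bE (aP m mn').2.
    by apply: vspan_sub fn => ? ?; right.
  have mn' : (m < n)%N by rewrite -mn addnS ltnS leq_addr.
  have -> : f m = (a m : ct_vn D) (f m.+1) by rewrite /f big_ltn.
  have {}IH := IH m.+1; rewrite addSnnS in IH; have {}IH := IH mn.
  have am : i m != i m.+1.
    by apply: alt; rewrite -mn -addSnnS ltnS -[X in (X <= _)%N]addn1 leq_add.
  case ik: (i m).
    have [|g gP ->] := laurent_vspan (aT m mn' ik) (f := f m.+1).
      move: am IH; rewrite ik; case: (i m.+1) => // _.
      by apply: vspan_sub => ? ?; left.
    by rewrite (aP m mn').2 scale0r add0r.
  have [b bE] := aF m mn' ik; rewrite bE haar_jE; apply: Lop_vspan.
    by rewrite -haar_psi_j -bE (aP m mn').2.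
  move: am IH; rewrite ik; case: (i m.+1) => // _.
  by apply: vspan_sub => ? ?; left.
rewrite ct_psiE -/(f 0); have := fP n.-1 0%N; rewrite add0n prednK // => /(_ erefl).
by case: ifP => _; [exact: u_word_orth|exact: a_word_orth].
Qed.

Theorem free_haar_enlargement :
  exists (B : vnAlgebra R) (psi : {scalar B}) (j : {lrmorphism A -> B})
    (W : L2space psi) (u : B),
    [/\ enlargement phi psi j, Haar_unitary psi u &
      forall x y, star_free2 psi [set u] [set j x; j y]].
Proof.
exists B, psi, haar_j, (ct_L2 D), (haar_u true); split; last exact: haar_free.
- split; [exact: ct_faithful_state|exact: haar_j_star|exact: haar_psi_j].
- split.
    by split; rewrite haar_u_star; [exact: haar_uK|exact: (haar_uK false)].
  case=> [[|n]|n] // _; rewrite /upow; first exact: haar_moment.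
  by rewrite haar_u_star haar_moment.
Qed.
End FreeHaar.

(** * Vanishing products and twisted words *)

Section PiecesVanish.
Variables (C : numClosedFieldType) (A : starAlgType C) (phi : A -> C) (x y : A).

Lemma letters_only_x p : only_x p -> all fst (letters p).
Proof. by rewrite /only_x /letters => ->; rewrite cats0 all_map; apply/allP. Qed.

Lemma letters_only_y p : only_y p -> all (fun l : letter => ~~ l.1) (letters p).
Proof. by rewrite /only_y /letters => ->; rewrite all_map; apply/allP. Qed.

Lemma all_flatten_map (T : Type) (a : pred letter) (f : T -> seq letter) s :
  all (fun t => all a (f t)) s -> all a (flatten (map f s)).
Proof. by elim: s => //= t s IH /andP[at_ /IH]; rewrite all_cat at_. Qed.

Lemma pieces_vanishP : pieces_vanish phi x y -> P_products_vanish phi x y.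
Proof.
move=> vanish n i p n2 ip cond.
pose zs := [seq letters (p k) | k <- index_iota 1 n].
have kP k : k \in index_iota 1 n -> (1 <= k < n)%N by rewrite mem_index_iota.
have -> : \prod_(1 <= k < n) P_elt phi x y (i k) (i k.+1) (p k) =
    \prod_(z <- zs) (wev x y z - (piece_mean phi x y z)%:A).
  rewrite /zs big_map; apply: eq_big_seq => k /kP kn.
  exact: P_elt_letters (ip k kn).
apply: vanish.
  by rewrite -size_eq0 size_map size_iota subn_eq0 -ltnNge.
apply/and3P; split.
- rewrite /zs all_map; apply/allP => k /kP kn /=.
  by have := ip k kn; rewrite in_P_piece => /and4P[-> ->].
- have chain m k : (0 < k)%N -> (k + m <= n)%N ->
      chained [seq letters (p k) | k <- iota k m].
    elim: m k => //= m IH k k0 km; have := IH k.+1 isT; rewrite addSnnS => /(_ km).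
    case: m km {IH} => //= m km; rewrite /chained /= => ->; rewrite andbT.
    have kn : (1 <= k < n)%N by rewrite k0 (leq_trans _ km) // -addn1 leq_add.
    have k1n : (1 <= k.+1 < n)%N.
      by rewrite (leq_trans _ km) // addnS addnS !ltnS leq_addr.
    have := ip _ kn; have := ip _ k1n; rewrite !in_P_piece.
    move=> /and4P[_ _ /eqP -> _] /and4P[_ _ _].
    by case: (head_e _); case: (last_e _).
  by rewrite /zs /index_iota chain // subnKC // ltnW.
- have iotaE m : (1 <= m <= n)%N -> index_iota 1 n = index_iota 1 m ++ index_iota m n.
    case/andP=> m1 mn; rewrite /index_iota -{2}(subnKC m1) -iotaD.
    by congr iota; rewrite -{1}(subnKC mn) addnC -addnBA // addnC.
  have xs m : (forall k, (1 <= k < m)%N -> only_x (p k)) ->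
      all fst (flatten [seq letters (p k) | k <- index_iota 1 m]).
    move=> mx; apply: all_flatten_map; apply/allP => k; rewrite mem_index_iota.
    by move=> /mx; exact: letters_only_x.
  have ys m : (forall k, (m <= k < n)%N -> only_y (p k)) ->
      all (fun l : letter => ~~ l.1) (flatten [seq letters (p k) | k <- index_iota m n]).
    move=> my; apply: all_flatten_map; apply/allP => k; rewrite mem_index_iota.
    by move=> /my; exact: letters_only_y.
  have n1 : n.-1.+1 = n by rewrite prednK // ltnW.
  case: cond => [[m mn [mx my]]|[m /andP[m1 mn] [mx _ my]]].
    have mn' : (m.+1 <= n)%N by rewrite -n1 ltnS.
    rewrite /zs (iotaE m.+1) ?mn' // map_cat flatten_cat.
    by apply: sided_cat; [exact: xs|exact: ys].
  have mn' : (m < n)%N by rewrite -n1 ltnS.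
  rewrite /zs (iotaE m) ?m1 ?(ltnW mn') // map_cat flatten_cat.
  rewrite [index_iota m n](_ : _ = m :: index_iota m.+1 n); last first.
    by rewrite /index_iota -(subnSK mn').
  (* The mixed piece is cut: its letters of x close the first half, its letters of y open the
     second. *)
  rewrite /= {2}/letters -catA catA; apply: sided_cat.
    rewrite all_cat xs // all_map; exact/allP.
  by rewrite all_cat ys // andbT all_map; apply/allP.
Qed.

Lemma pieces_vanish_of : P_products_vanish phi x y -> pieces_vanish phi x y.
Proof.
move=> vanish zs zn /and3P[al ch sd].
pose r := size zs; have r0 : (0 < r)%N by rewrite lt0n size_eq0.
(* The factors in (2) are numbered from 1. There is one index more than there are factors: the last
   one, at [r.+1], is given by the final exponent. *)
pose z k := nth [::] zs k.-1.
pose i k := if (k <= r)%N then index_of_sign (head_e (z k)) else index_of_sign (last_e (last [::] zs)).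
pose p k := pres (z k).
have zin k : (1 <= k <= r)%N -> z k \in zs.
  by case: k => // k kr; rewrite mem_nth.
have sdz k : (1 <= k <= r)%N -> sided (z k).
  move=> kr; apply: sided_subseq sd; move: (zin k kr).
  elim: (zs) => //= t s IH; rewrite inE => /predU1P[->|/IH st]; first exact: prefix_subseq.
  by apply: subseq_trans st _; exact: suffix_subseq.
have lp k : (1 <= k <= r)%N -> letters (p k) = z k by move=> kr; rewrite pres_letters ?sdz.
have ip k : (1 <= k < r.+1)%N -> in_P (i k) (i k.+1) (p k).
  rewrite ltnS => kr; rewrite in_P_piece lp //.
  have /allP/(_ _ (zin k kr))/andP[-> ->] /= := al.
  case/andP: (kr) => k1 kr'; rewrite /i kr' eqxx /=.
  case: ltnP => [kr2|rk].
    move/(sortedP [::]): ch => /(_ k.-1); rewrite prednK // => /(_ kr2) /eqP.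
    by rewrite /z /= => ->.
  have -> : k = r by apply/eqP; rewrite eqn_leq kr'.
  by rewrite /z nth_last.
rewrite -[RHS](vanish r.+1 i p r0 ip).
  congr phi; rewrite (big_nth [::]) big_add1 /= !big_mkord; apply: eq_bigr => k _.
  have kr : (1 <= k.+1 <= r)%N := ltn_ord k.
  by rewrite P_elt_letters ?lp // ip.
(* The first piece with a letter of y. Alternative (b) holds if it also has letters of x,
   alternative (a) otherwise; (a) also covers the case without such a piece. *)
pose m := find (fun t : seq letter => ~~ all fst t) zs.
have xm k : (1 <= k <= r)%N -> (k <= m)%N -> only_x (p k).
  case: k => // k kr km; have /negbFE := before_find [::] km.
  rewrite /only_x /p /pres /z /=; elim: (nth _ _ _) => //= -[[] e] t IH //= /IH ->.
have [mr|mr] := leqP r m.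
  left; exists r => //; split=> [k /andP[k1 kr]|k /andP[rk]]; last by rewrite ltnS leqNgt rk.
  by apply: xm; rewrite ?k1 ?(leq_trans kr).
have hasm : has (fun t : seq letter => ~~ all fst t) zs by rewrite has_find.
have := nth_find [::] hasm; rewrite -/m => nx.
have ym k : (m.+1 < k < r.+1)%N -> only_y (p k).
  case: k => // k /andP[mk kr].
  have kz : z k.+1 \in drop m.+1 zs.
    have mk' : (m.+1 <= k)%N by [].
    by rewrite /z /= -(subnKC mk') -nth_drop mem_nth // size_drop ltn_sub2r // (leq_ltn_trans mk').
  have allr : all (fun l : letter => ~~ l.1) (z k.+1).
    move: sd; rewrite -(cat_take_drop m zs) (drop_nth [::] mr) flatten_cat /=.
    rewrite sided_pairwise !pairwise_cat => /and3P[_ _ /and3P[/allrelP rel _ _]].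
    case/allPn: nx => l ln lx; apply/allP => l' l'z.
    have := rel l l' ln; rewrite (negPf lx) implybF; apply.
    by apply/flattenP; exists (z k.+1).
  by move: allr; rewrite /only_y /p /pres /=; elim: (z _) => //= -[[] e] t IH //= /IH ->.
have [|ny] := boolP (all (fun l : letter => ~~ l.1) (z m.+1)).
  move=> ay; left; exists m; first exact: ltnW.
  split=> [k /andP[k1 km]|k /andP[mk kr]].
    by apply: xm => //; rewrite k1 (leq_trans km) // ltnW.
  move: mk; rewrite leq_eqVlt => /predU1P[<-|mk]; last by apply: ym; rewrite mk.
  by move: ay; rewrite /only_y /p /pres /=; elim: (z _) => //= -[[] e] t IH //= /IH ->.
right; exists m.+1 => //; split=> [k /andP[k1 km]||k /andP[mk kr]].
- by apply: xm => //; rewrite k1 (leq_trans _ mr) // ltnW.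
- split; rewrite /p /pres /=.
    by move: ny; elim: (z _) => //= -[[] e] t IH.
  by move: nx; rewrite -[nth _ _ _]/(z m.+1); elim: (z _) => //= -[[] e] t IH.
- by apply: ym; rewrite mk.
Qed.
End PiecesVanish.

(** * Words in ux and uy *)

Section Twist.
Variables (C : numClosedFieldType) (A B : starAlgType C) (j : {lrmorphism A -> B}).
Hypothesis jstar : forall a, j (star a) = star (j a).
Variables (x y : A) (u : B).
Hypothesis uu : unitary u.

(** The letter ux begins with u and its adjoint ends with [star u]. Inside an alternating piece
    these factors cancel; between chained pieces [link_e] remains. *)
Definition pre_e (e : bool) : B := if e then 1 else u.
Definition post_e (e : bool) : B := if e then star u else 1.
Definition link_e (e : bool) : B := if e then star u else u.

Lemma post_pre e : post_e e * pre_e e = link_e e.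
Proof. by case: e; rewrite /= ?mulr1 ?mul1r. Qed.

Lemma lev_twist l : lev (u * j x) (u * j y) l = pre_e l.2 * j (lev x y l) * post_e l.2.
Proof.
by case: l => [[] []]; rewrite /lev /= ?jstar ?starM ?mul1r ?mulr1.
Qed.

Lemma wev_twist z : z != [::] -> alt z -> wev (u * j x) (u * j y) z =
  pre_e (head_e z) * j (wev x y z) * post_e (last_e z).
Proof.
case: z => // l z _; elim: z l => [|l' z IH] l al.
  by rewrite !wev_cons !wev_nil !mulr1 lev_twist.
have /andP[ne al'] : (l.2 != l'.2) && alt (l' :: z) by [].
rewrite wev_cons IH // lev_twist [in RHS]wev_cons rmorphM /head_e /last_e /=.
rewrite !mulrA; congr (_ * _ * _).
have [uu1 uu2] := uu; rewrite -mulrA [X in _ * X](_ : _ = 1) ?mulr1 //.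
by case: (l.2) (l'.2) ne => [] [] //= _; rewrite ?mulr1.
Qed.

Lemma pre_post_cancel (e : bool) : pre_e e * post_e (~~ e) = 1.
Proof. by case: uu => _ uu2; case: e; rewrite /= ?mulr1. Qed.

(** An even piece has end exponents that are opposite, so its outer factors multiply to 1 and
    subtracting a scalar commutes with the twist. *)
Lemma center_twist z (c : C) : z != [::] -> alt z -> (odd (size z) -> c = 0) ->
  wev (u * j x) (u * j y) z - c%:A =
  pre_e (head_e z) * j (wev x y z - c%:A) * post_e (last_e z).
Proof.
move=> zn za zc; rewrite wev_twist // linearB /= mulrBr mulrBl; congr (_ - _).
have -> : j c%:A = c%:A by rewrite linearZ /= rmorph1.
rewrite alt_last //; case: odd zc => [-> //|_]; first by rewrite !scale0r mulr0 mul0r.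
by rewrite addbT -scalerAr -scalerAl mulr1 pre_post_cancel.
Qed.

Definition link_list (c : seq letter -> C) (zs : seq (seq letter)) : seq (B * B) :=
  [seq (link_e (head_e z), j (wev x y z - (c z)%:A)) | z <- zs].

Lemma prod_twist (c : seq letter -> C) z zs :
  good_pieces (z :: zs) -> (forall t, odd (size t) -> c t = 0) ->
  \prod_(t <- z :: zs) (wev (u * j x) (u * j y) t - (c t)%:A) =
  pre_e (head_e z) * j (wev x y z - (c z)%:A) *
  (\prod_(p <- link_list c zs) (p.1 * p.2)) * post_e (last_e (last z zs)).
Proof.
move=> /and3P[al ch _] c0; elim: zs z al ch => [|z' zs IH] z.
  move=> /= /andP[/andP[zn za] _] _; rewrite big_seq1 big_nil mulr1.
  by rewrite center_twist //; exact: c0.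
move=> al ch; have /andP[/andP[zn za] al'] := al.
have /andP[/eqP zz' ch'] : (last_e z == head_e z') && chained (z' :: zs) by [].
rewrite big_cons IH // center_twist //; last exact: c0.
rewrite /link_list [in RHS]/= big_cons /= -/(link_list c zs) !mulrA.
by rewrite -(mulrA _ (post_e _)) zz' post_pre.
Qed.
End Twist.

(** * Freeness with uncentred separating factors *)

Section FreeExpansion.
Variables (C : numClosedFieldType) (B : starAlgType C) (psi : {scalar B}).
Hypothesis psi1 : psi 1 = 1.
Variables (X Y : set B).
Hypothesis free : star_free2 psi X Y.

Local Notation G := (fun b : bool => star_generated (if b then X else Y)).

Lemma star_generated_sub (S : set B) : star_subalgebra (star_generated S).
Proof.
split.
- by move=> P [P1 _ _ _] _.
- move=> c a b Sa Sb P PA SP; have [_ PL _ _] := PA.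
  by apply: PL; [exact: Sa|exact: Sb].
- move=> a b Sa Sb P PA SP; have [_ _ PM _] := PA.
  by apply: PM; [exact: Sa|exact: Sb].
- move=> a Sa P PA SP; have [_ _ _ PS] := PA.
  by apply: PS; exact: Sa.
Qed.

Lemma gen_center b v : G b v -> G b (v - (psi v)%:A).
Proof.
move=> Gv; have [G1 GL _ _] := star_generated_sub (if b then X else Y).
by rewrite addrC -scaleNr; exact: GL.
Qed.

Lemma psi_center v : psi (v - (psi v)%:A) = 0.
Proof. by rewrite linearB /= scalarZ psi1 mulr1 subrr. Qed.

Definition alt_word (s : seq (bool * B)) :=
  sorted (fun p q => p.1 != q.1) s /\
  forall p, p \in s -> G p.1 p.2 /\ psi p.2 = 0.

Lemma star_free_seq s : s != [::] -> alt_word s -> psi (\prod_(p <- s) p.2) = 0.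
Proof.
move=> sn [so sP]; pose d : bool * B := (true, 0).
rewrite (big_nth d); apply: (free (i := fun k => (nth d s k).1)).
- by rewrite lt0n size_eq0.
- by move=> k ks; apply: sP; rewrite mem_nth.
- by move=> k ks; exact: (sortedP d so).
Qed.

(* [ok q rest] is what is needed to expand the uncentered links [v] of
   [q * v1 * q1 * v2 * ...]: replacing [v] by a scalar merges its two neighbours. *)
Fixpoint ok (q : B) (rest : seq (B * B)) : Prop :=
  psi q = 0 /\
  if rest is (v, q') :: rest' then ok q' rest' /\ (psi v != 0 -> ok (q * q') rest')
  else True.

Lemma alt_word_rcons s b v : alt_word s -> (s = [::] \/ last true (map fst s) != b) ->
  G b v -> psi v = 0 -> alt_word (rcons s (b, v)).
Proof.
move=> [so sP] sb Gv v0; split; last first.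
  by move=> p; rewrite mem_rcons inE => /predU1P[->|/sP].
case: s so sb {sP} => // p s so [//|sb].
by move: so sb; rewrite /= rcons_path last_map => -> /=.
Qed.

(** Induction on [rest]: everything to the left of [q] is already a centred alternating word, so
    only the links further right remain to be centred. *)
Lemma alt_prefix_vanish rest s q w : alt_word s ->
  (s = [::] \/ last true (map fst s) != false) ->
  G false q -> (forall p, p \in rest -> G true p.1 /\ G false p.2) -> G true w ->
  ok q rest ->
  psi ((\prod_(p <- s) p.2) * q * (\prod_(p <- rest) (p.1 * p.2)) * w) = 0.
Proof.
elim: rest s q => [|[v q'] rest IH] s q sA sl Gq Gr Gw /=.
  move=> [q0 _]; rewrite big_nil mulr1.
  have sqA := alt_word_rcons sA sl Gq q0.
  have sqE : (\prod_(p <- s) p.2) * q = \prod_(p <- rcons s (false, q)) p.2.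
    by rewrite -cats1 big_cat big_seq1.
  rewrite -[w](subrK (psi w)%:A) mulrDr linearD /= sqE.
  rewrite -scalerAr mulr1 scalarZ (star_free_seq _ sqA) ?mulr0 ?addr0; last by case: (s).
  have wA : alt_word (rcons (rcons s (false, q)) (true, w - (psi w)%:A)).
    apply: (alt_word_rcons sqA _ (gen_center (b := true) Gw) (psi_center w)).
    by right; rewrite map_rcons last_rcons.
  rewrite -(star_free_seq _ wA); last by case: (s).
  by congr (psi _); rewrite -[in RHS]cats1 big_cat big_seq1.
move=> [q0 [okq' okm]]; have [Gv Gq'] := Gr (v, q') (mem_head _ _).
have Gr' p : p \in rest -> G true p.1 /\ G false p.2.
  by move=> pr; apply: Gr; rewrite inE pr orbT.
have sqA := alt_word_rcons sA sl Gq q0.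
have svA : alt_word (rcons (rcons s (false, q)) (true, v - (psi v)%:A)).
  apply: (alt_word_rcons sqA _ (gen_center (b := true) Gv) (psi_center v)).
  by right; rewrite map_rcons last_rcons.
rewrite big_cons; set P := \prod_(p <- s) _; set Q := \prod_(p <- rest) _.
(* Split [v] into its centred part, which prolongs the prefix, and its mean, which merges [q] with
   [q']. *)
have -> : P * q * (v * q' * Q) * w =
    (\prod_(p <- rcons (rcons s (false, q)) (true, v - (psi v)%:A)) p.2) * q' * Q * w +
    psi v *: (P * (q * q') * Q * w).
  rewrite -!cats1 !big_cat !big_seq1 /= -/P !mulrA mulrBr !mulrBl.
  by rewrite -!scalerAr -!scalerAl mulr1 subrK.
rewrite linearD /= scalarZ IH ?add0r //; last by right; rewrite map_rcons last_rcons.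
have [->|v0] := eqVneq (psi v) 0; first by rewrite mul0r.
rewrite IH ?mulr0 //; last exact: okm.
have [_ _ GM _] := star_generated_sub (if false then X else Y).
exact: GM.
Qed.

Lemma free_expansion v rest q w : G true v -> G false q ->
  (forall p, p \in rest -> G true p.1 /\ G false p.2) -> G true w -> ok q rest ->
  psi (v * q * (\prod_(p <- rest) (p.1 * p.2)) * w) = 0.
Proof.
move=> Gv Gq Gr Gw okq.
have nilA : alt_word [::] by split.
have vA : alt_word [:: (true, v - (psi v)%:A)].
  by split=> // p; rewrite inE => /eqP ->; split; [exact: (gen_center (b := true) Gv)|exact: psi_center].
have h1 := alt_prefix_vanish vA (or_intror isT) Gq Gr Gw okq.
have h2 := alt_prefix_vanish nilA (or_introl erefl) Gq Gr Gw okq.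
rewrite big_seq1 /= in h1; rewrite big_nil mul1r in h2.
set P := \prod_(p <- rest) _ in h1 h2 *.
have -> : v * q * P * w = (v - (psi v)%:A) * q * P * w + psi v *: (q * P * w).
  by rewrite !mulrBl -!scalerAl mul1r subrK.
by rewrite linearD /= h1 add0r scalarZ h2 mulr0.
Qed.
End FreeExpansion.

(** * Comparing the moments of (x, y) and (ux, uy) *)

Section TwistedMoments.
Variables (C : numClosedFieldType) (A B : starAlgType C) (j : {lrmorphism A -> B}).
Hypothesis jstar : forall a, j (star a) = star (j a).
Variables (phi : {scalar A}) (psi : {scalar B}).
Hypotheses (psi1 : psi 1 = 1) (psij : forall a, psi (j a) = phi a).
Variables (x y : A) (u : B).
Hypothesis uu : unitary u.
Hypothesis ufree : star_free2 psi [set u] [set j x; j y].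

Local Notation wevu := (wev (u * j x) (u * j y)).
Local Notation Gx := (star_generated [set j x; j y]).
Local Notation Gu := (star_generated [set u]).

Lemma piece_mean_odd z : odd (size z) -> piece_mean phi x y z = 0.
Proof. by rewrite /piece_mean => ->. Qed.

Lemma star_generated_mem (S : set B) a : S a -> star_generated S a.
Proof. by move=> Sa P _; apply. Qed.

Lemma gen_wev w : Gx (j (wev x y w)).
Proof.
have [G1 _ GM GS] := star_generated_sub [set j x; j y].
have jx : Gx (j x) by apply: star_generated_mem; left.
have jy : Gx (j y) by apply: star_generated_mem; right.
elim: w => [|l w IH]; first by rewrite wev_nil rmorph1.
rewrite wev_cons rmorphM; apply: GM IH.
by case: l => [[] []]; rewrite /lev /= ?jstar //; exact: GS.
Qed.

Lemma gen_wevB w (c : C) : Gx (j (wev x y w - c%:A)).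
Proof.
have [G1 GL _ _] := star_generated_sub [set j x; j y].
rewrite linearB linearZ /= rmorph1 addrC -scaleNr; apply: GL => //; exact: gen_wev.
Qed.

Lemma gen_u e : Gu (if e then star u else u).
Proof.
have [_ _ _ GS] := star_generated_sub [set u].
have gu : Gu u by exact: star_generated_mem.
by case: e => //; exact: GS.
Qed.

Lemma gen_pre e : Gu (pre_e u e).
Proof. by case: e; [case: (star_generated_sub [set u])|exact: (gen_u false)]. Qed.

Lemma gen_post e : Gu (post_e u e).
Proof. by case: e; [exact: (gen_u true)|case: (star_generated_sub [set u])]. Qed.

Lemma gen_links (c : seq letter -> C) zs p :
  p \in link_list j x y u c zs -> Gu p.1 /\ Gx p.2.
Proof. by case/mapP=> z _ -> /=; split; [exact: gen_u|exact: gen_wevB]. Qed.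

Lemma good_infix zs0 zs zs1 : good_pieces (zs0 ++ zs ++ zs1) -> good_pieces zs.
Proof.
move=> /and3P[]; rewrite !all_cat => /and3P[_ al _] ch sd; apply/and3P; split=> //.
  by move: ch; rewrite /chained => /cat_sorted2[_] /cat_sorted2[].
apply: sided_subseq sd; rewrite !flatten_cat.
by apply: subseq_trans (suffix_subseq _ _); exact: prefix_subseq.
Qed.

(** [zs0] collects the pieces merged so far. Any run of consecutive pieces is again good, so
    [pieces_vanish] gives mean zero to all merged factors. *)
Lemma ok_pieces zs zs0 : pieces_vanish phi x y -> zs0 != [::] -> good_pieces (zs0 ++ zs) ->
  ok psi (j (\prod_(z <- zs0) (wev x y z - (piece_mean phi x y z)%:A)))
    (link_list j x y u (piece_mean phi x y) zs).
Proof.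
move=> vanish; elim: zs zs0 => [|z zs IH] zs0 zn good /=.
  by split=> //; rewrite psij vanish //; move: good; rewrite cats0.
split; first by rewrite psij vanish //; exact: (@good_infix [::] _ (z :: zs)).
split=> [|_].
  have := IH [:: z] isT; rewrite big_seq1; apply.
  by apply: (@good_infix zs0 _ [::]); rewrite cats0.
have := IH (rcons zs0 z); rewrite -rmorphM -cats1 big_cat big_seq1; apply.
  by case: (zs0).
by rewrite -catA.
Qed.

(** Multiplied out, all terms but the full word are shorter sided words, on which the two moments
    agree. Hence moments can be compared through centred products, in both directions. *)
Lemma centered_product_diff n (c : seq letter -> C) zs a :
  (forall w, (size w < n)%N -> sided w -> psi (wevu w) = phi (wev x y w)) ->
  all (fun z => z != [::]) zs -> (size (a ++ flatten zs) <= n)%N -> sided (a ++ flatten zs) ->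
  psi (wevu a * \prod_(z <- zs) (wevu z - (c z)%:A)) -
  phi (wev x y a * \prod_(z <- zs) (wev x y z - (c z)%:A)) =
  psi (wevu (a ++ flatten zs)) - phi (wev x y (a ++ flatten zs)).
Proof.
move=> eqn; elim: zs a => [|z zs IH] a; first by rewrite !big_nil !mulr1 /= !cats0.
move=> /= /andP[zn al] sz sd; rewrite !big_cons.
have E (D : algType C) (p q r : D) (d : C) : p * ((q - d%:A) * r) = p * q * r - d *: (p * r).
  by rewrite mulrBl mulrBr -scalerAl mul1r -scalerAr mulrA.
rewrite !E -!wev_cat (linearB psi) (linearB phi) /= !scalarZ.
have lt : (size (a ++ flatten zs) < size (a ++ z ++ flatten zs))%N.
  by rewrite !size_cat ltn_add2l -[X in (X < _)%N]add0n ltn_add2r lt0n size_eq0.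
have sd' : sided (a ++ flatten zs).
  by apply: sided_subseq sd; rewrite cat_subseq // suffix_subseq.
have h1 := IH a al (leq_trans (ltnW lt) sz) sd'.
rewrite eqn ?subrr // in h1; last exact: leq_trans lt sz.
have h2 := IH (a ++ z) al; rewrite -catA in h2.
move/subr0_eq: h1 => h1; rewrite -h2 // h1; ring.
Qed.

Lemma twisted_words_eq : phi 1 = 1 -> pieces_vanish phi x y ->
  forall w, sided w -> psi (wevu w) = phi (wev x y w).
Proof.
move=> phi1 vanish w; have [n] := ubnP (size w); elim: n w => // n IH w wn sd.
have [->|w0] := eqVneq w [::]; first by rewrite !wev_nil psi1 phi1.
have [zs [fl al ch]] := split_pieces w0.
have good : good_pieces zs by rewrite /good_pieces al ch fl.
have zn : zs != [::] by apply: contra w0 => /eqP z0; rewrite -fl z0.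
have al' : all (fun z : seq letter => z != [::]) zs.
  by apply: sub_all al => z /andP[].
have := @centered_product_diff n (piece_mean phi x y) zs [::] IH al'.
rewrite fl /= => /(_ wn sd); rewrite !wev_nil !mul1r vanish // subr0.
suff -> : psi (\prod_(z <- zs) (wevu z - (piece_mean phi x y z)%:A)) = 0.
  by move/esym/subr0_eq.
case: zs zn {fl al ch al'} good => // z zs _ good.
rewrite (prod_twist jstar x y uu) //; last exact: piece_mean_odd.
apply: (free_expansion psi1 ufree (gen_pre _) (gen_wevB _ _) _ (gen_post _)).
  by move=> p; exact: gen_links.
by have := @ok_pieces zs [:: z] vanish isT good; rewrite big_seq1.
Qed.

Lemma pieces_vanish_of_twist : (forall z : int, z != 0 -> psi (upow u z) = 0) ->
  (forall w, sided w -> psi (wevu w) = phi (wev x y w)) -> pieces_vanish phi x y.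
Proof.
move=> haar eqw zs zn good; have [al ch sd] := and3P good.
have al' : all (fun z : seq letter => z != [::]) zs.
  by apply: sub_all al => z /andP[].
have := @centered_product_diff (size (flatten zs)) (piece_mean phi x y) zs [::]
  (fun w _ => @eqw w) al' (leqnn _) sd.
rewrite /= eqw // subrr !wev_nil !mul1r => /subr0_eq <-.
have u0 e : psi (link_e u e) = 0.
  by case: e; [exact: (haar (-1))|exact: (haar 1)].
(* An odd piece is not centred by construction. Its moment equals that of its twist, and by freeness
   this is its mean times the mean of the two outer factors, whose product is u or its adjoint; the
   latter mean is zero. *)
have q0 z : z != [::] -> alt z -> sided z -> psi (j (wev x y z - (piece_mean phi x y z)%:A)) = 0.
  move=> z0 za zs'; rewrite psij linearB /= scalarZ.
  have phi1 : phi 1 = 1 by rewrite -psij rmorph1.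
  rewrite phi1 mulr1 /piece_mean; case oz: (odd _); last by rewrite subrr.
  rewrite subr0 -eqw // (wev_twist jstar x y uu) //.
  have qc : psi (j (wev x y z - (phi (wev x y z))%:A)) = 0.
    by rewrite psij linearB /= scalarZ phi1 mulr1 subrr.
  have nilG (p : B * B) : p \in [::] -> Gu p.1 /\ Gx p.2 by [].
  have := free_expansion psi1 ufree (gen_pre (head_e z))
    (gen_wevB z (phi (wev x y z))) nilG (gen_post (last_e z)) (conj qc I).
  rewrite big_nil mulr1 (linearB j) linearZ /= rmorph1 mulrBr mulrBl (linearB psi) /=.
  rewrite -scalerAr -scalerAl scalarZ mulr1.
  have -> : psi (pre_e u (head_e z) * post_e u (last_e z)) = 0.
    rewrite alt_last // oz addbF.
    by have := u0 (head_e z); case: (head_e z); rewrite /= ?mul1r ?mulr1.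
  by rewrite mulr0 subr0.
have sdz z : z \in zs -> sided z.
  move=> zin; apply: sided_subseq sd; elim: (zs) zin => //= t s IH.
  rewrite inE => /predU1P[->|/IH st]; first exact: prefix_subseq.
  by apply: subseq_trans st _; exact: suffix_subseq.
case: zs zn {ch al'} good al sd sdz => // z zs _ good al sd sdz.
rewrite (prod_twist jstar x y uu) //; last exact: piece_mean_odd.
apply: (free_expansion psi1 ufree (gen_pre _) (gen_wevB _ _) _ (gen_post _)).
  by move=> p; exact: gen_links.
elim: zs z {good sd} al sdz => [|z' zs IH] z al sdz /=.
  split=> //; have /andP[/andP[zn za] _] := al.
  by apply: q0 => //; apply: sdz; rewrite mem_head.
have /andP[/andP[zn za] al'] := al.
split; first by apply: q0 => //; apply: sdz; rewrite mem_head.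
(* The links have mean zero, so the merging clause of [ok] is vacuous. *)
split; last by rewrite u0 eqxx.
by apply: IH => // t ts; apply: sdz; rewrite inE ts orbT.
Qed.
End TwistedMoments.

(** * Moments of left and right multiplications *)

Section L2Moments.
Variables (R : realType) (A : vnAlgebra R) (phi : {scalar A}).
Hypothesis hphi : faithful_normal_tracial_state phi.
Variables (V : L2space phi) (x y : A).
Local Notation C := R[i].
Local Notation L := (L2_left V).
Local Notation Rt := (L2_right V).
Local Notation vec := (L2vec V).

Lemma L2_sep (f g : V) : (forall a, inner V f (vec a) = inner V g (vec a)) -> f = g.
Proof.
move=> fg; apply/eqP; rewrite -subr_eq0 -normr_eq0 -sqrf_eq0 innerE; apply/eqP.
apply: (@eps_eq _ _ _ `|f - g|) => // e e0 _.
have [|h [he [a _ ah]]] := @L2_dense _ _ _ V (ball (f - g) e) _ (ball_open _ _).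
  by exists (f - g); exact: ballxx.
rewrite subr0 [X in `|X|](_ : _ = inner V (f - g) ((f - g) - vec a)).
  rewrite (le_trans (hilbert_CauchySchwarz _ _)) // ler_wpM2l // ltW //.
  by move: he; rewrite -ball_normE /= -ah.
by rewrite innerBr [X in _ = _ - X]innerBl fg subrr subr0.
Qed.

Lemma star_L2_left a b : star (L a) (vec b) = vec (star a * b).
Proof.
apply: L2_sep => c; rewrite -[star (L a) _]/(bop_adj (L a) _) bop_adjP' L2_leftE !L2_inner.
by rewrite starM mulrA.
Qed.

Lemma star_L2_right a b : star (Rt a) (vec b) = vec (b * star a).
Proof.
apply: L2_sep => c; rewrite -[star (Rt a) _]/(bop_adj (Rt a) _) bop_adjP' L2_rightE !L2_inner.
by rewrite starM -mulrA (vn_trC hphi) mulrA.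
Qed.

Lemma L2_word w a : (\prod_(c <- w) pair_letter (L x) (Rt y) c) (vec a) =
  vec (wev x y (left_letters w) * a * wev x y (right_letters w)).
Proof.
elim: w => [|[s e] w IH]; first by rewrite big_nil !wev_nil mul1r mulr1.
rewrite big_cons bop_mulE IH; case: s.
  rewrite -[left_letters (_ :: _)]/((true, e) :: left_letters w).
  rewrite -[right_letters (_ :: _)]/(right_letters w) wev_cons -!mulrA; case: e.
    by rewrite -[pair_letter _ _ _]/(star (L x)) star_L2_left.
  by rewrite -[pair_letter _ _ _]/(L x) L2_leftE.
rewrite -[left_letters (_ :: _)]/(left_letters w).
have -> : right_letters ((right_side, e) :: w) = right_letters w ++ [:: (false, e)].
  by rewrite /right_letters /= rev_cons cats1.
rewrite wev_cat wev_cons wev_nil mulr1 !mulrA; case: e.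
  by rewrite -[pair_letter _ _ _]/(star (Rt y)) star_L2_right.
by rewrite -[pair_letter _ _ _]/(Rt y) L2_rightE.
Qed.

Lemma L2_moment w :
  L2_state (\prod_(c <- w) pair_letter (L x) (Rt y) c) = phi (wev x y (sided_letters w)).
Proof. by rewrite /L2_state L2_word L2_inner star1 mul1r mulr1 -wev_cat. Qed.

End L2Moments.

(** * Vanishing products and equality of distributions *)

Section FreenessEquivalence.
Variables (R : realType) (A : vnAlgebra R) (phi : {scalar A}).
Hypothesis hphi : faithful_normal_tracial_state phi.
Variables (V : L2space phi) (x y : A).

Lemma same_distribution_of_pieces : P_products_vanish phi x y ->
  forall (B : vnAlgebra R) (psi : {scalar B}) (j : {lrmorphism A -> B})
    (W : L2space psi) (u : B),
  enlargement phi psi j -> unitary u -> star_free2 psi [set u] [set j x; j y] ->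
  same_star_distribution (L2_state (V := V)) (L2_state (V := W))
    (L2_left V x) (L2_right V y) (L2_left W (u * j x)) (L2_right W (u * j y)).
Proof.
move=> /pieces_vanish_of vanish B psi j W u [hpsi jstar psij] uu ufree w.
rewrite !L2_moment //; apply/esym/(twisted_words_eq jstar (vn_tr1 hpsi) psij uu ufree) => //.
  exact: vn_tr1.
exact: sided_letters_sided.
Qed.

Lemma pieces_of_same_distribution :
  (forall (B : vnAlgebra R) (psi : {scalar B}) (j : {lrmorphism A -> B})
    (W : L2space psi) (u : B),
  enlargement phi psi j -> Haar_unitary psi u -> star_free2 psi [set u] [set j x; j y] ->
  same_star_distribution (L2_state (V := V)) (L2_state (V := W))
    (L2_left V x) (L2_right V y) (L2_left W (u * j x)) (L2_right W (u * j y))) ->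
  P_products_vanish phi x y.
Proof.
move=> same; apply: pieces_vanishP.
have [B [psi [j [W [u [enl haar ufree]]]]]] := free_haar_enlargement hphi V.
have [hpsi jstar psij] := enl; have [uu u0] := haar.
apply: (pieces_vanish_of_twist jstar (vn_tr1 hpsi) psij uu (ufree x y) u0) => w sd.
have [w' <-] := sided_letters_surj sd.
rewrite -(L2_moment hpsi W) -(L2_moment hphi V).
by rewrite (same _ _ _ W _ enl haar (ufree x y)).
Qed.
End FreenessEquivalence.

Theorem theorem3p3 (R : realType) (A : vnAlgebra R) (phi : {scalar A})
    (hphi : faithful_normal_tracial_state phi) (V : L2space phi) (x y : A) :
  [<-> R_diagonal (L2_state (V := V)) (L2_left V x) (L2_right V y);
       P_products_vanish phi x y;
       forall (B : vnAlgebra R) (psi : {scalar B}) (j : {lrmorphism A -> B})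
           (W : L2space psi) (u : B),
         enlargement phi psi j ->
         Haar_unitary psi u ->
         star_free2 psi [set u] [set j x; j y] ->
         same_star_distribution (L2_state (V := V)) (L2_state (V := W))
           (L2_left V x) (L2_right V y)
           (L2_left W (u * j x)) (L2_right W (u * j y));
       forall (B : vnAlgebra R) (psi : {scalar B}) (j : {lrmorphism A -> B})
           (W : L2space psi) (u : B),
         enlargement phi psi j ->
         unitary u ->
         star_free2 psi [set u] [set j x; j y] ->
         same_star_distribution (L2_state (V := V)) (L2_state (V := W))
           (L2_left V x) (L2_right V y)
           (L2_left W (u * j x)) (L2_right W (u * j y)) ].
Proof.
have phi1 := vn_tr1 hphi.
tfae.
- by move=> rd; apply: pieces_vanishP; exact: (R_diagonal_pieces phi1 (L2_moment hphi V x y) rd).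
- move=> pv B psi j W u enl [uu _]; exact: (same_distribution_of_pieces hphi V pv).
(* From (3) to (4) by way of (2). *)
- move=> same B psi j W u enl uu ufree.
  exact: (same_distribution_of_pieces hphi V (pieces_of_same_distribution hphi same)).
(* A Haar unitary is a unitary, so (4) contains (3), which yields (2) and then (1). *)
- move=> same; apply: (pieces_R_diagonal phi1 (L2_moment hphi V x y)).
  apply: pieces_vanish_of; apply: (pieces_of_same_distribution hphi (V := V)) => B psi j W u enl [uu _].
  exact: same.
Qed.
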